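(* Let $n\geq 1$ be an integer and let $K$ be a field of characteristic different from $2$ such that $\mathsf{I}^{n+1}K(\sqrt{-1})=0$. Let $\varphi$ be a quadratic form over $K$ with $\varphi\in\mathsf{I}^nK$ and let $a\in K^\times$. Then $a\varphi\simeq\varphi$ if and only if $a$ is a norm in some finite $2$-extension $L/K$ (that is, $a\in \mathsf{N}_{L/K}(L^\times)$) such that $\varphi_L$ is hyperbolic.
   Context: All quadratic forms are nondegenerate; $\simeq$ denotes isometry. For a field $F$ of characteristic different from $2$, $\mathsf{I}^mF$ is the $m$th power of the fundamental ideal $\mathsf{I}F$ (classes of even-dimensional forms) of the Witt ring of $F$, and $\varphi\in\mathsf{I}^mF$ means that the Witt class of $\varphi$ lies in $\mathsf{I}^mF$. $\mathsf{N}_{L/K}$ is the norm map of a finite field extension $L/K$, and $\varphi_L$ is the scalar extension of $\varphi$ to $L$. The zero form is regarded as hyperbolic. A finite $2$-extension $L/K$ is a finite extension obtained by a (possibly empty) tower of quadratic extensions. *)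

(* Defs.v *)
From HB Require Import structures.
From mathcomp Require Import all_boot all_order all_algebra all_field.
From mathcomp Require Import boolp.
From mathcomp.real_closed Require Import mxtens.

Set Implicit Arguments.
Unset Strict Implicit.
Unset Printing Implicit Defensive.

Import GRing.Theory.
Local Open Scope ring_scope.
Local Open Scope quotient_scope.

(* In characteristic different from 2 the quadratic form                      *)
(* q(x) = \sum_(i, j) A i j x_i x_j is identified with its symmetric Gram     *)
(* matrix A, and a linear change of variables acts on A by congruence.        *)

Section Isometry.
Variable K : fieldType.
#[local] Arguments unsplit : simpl never.

(* P and Q are mutually inverse, so m = n; the two sizes are kept separate to *)
(* compare forms whose dimensions are not convertible.                        *)
Definition isometric m n (A : 'M[K]_m) (B : 'M[K]_n) : Prop :=
  exists (P : 'M[K]_(m, n)) (Q : 'M[K]_(n, m)),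
    [/\ P *m Q = 1%:M, Q *m P = 1%:M & A = P *m B *m P^T].

Definition dsum m n (A : 'M[K]_m) (B : 'M[K]_n) : 'M[K]_(m + n) :=
  block_mx A 0 0 B.

(* 2 (x_1 y_1 + ... + x_m y_m): an orthogonal sum of m hyperbolic planes.     *)
Definition hypmx m : 'M[K]_(m + m) := block_mx 0 1%:M 1%:M 0.

Definition hyperbolic m (A : 'M[K]_m) : Prop :=
  exists k, isometric A (hypmx k).

Lemma isom_refl m (A : 'M[K]_m) : isometric A A.
Proof. by exists 1%:M, 1%:M; rewrite trmx1 !mulmx1 mul1mx. Qed.

Lemma isom_sym m n (A : 'M[K]_m) (B : 'M[K]_n) :
  isometric A B -> isometric B A.
Proof.
case=> P [Q [PQ QP ->]]; exists Q, P; split=> //.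
by rewrite !mulmxA QP mul1mx -mulmxA -trmx_mul QP trmx1 mulmx1.
Qed.

Lemma isom_trans m n p (B : 'M[K]_n) (A : 'M[K]_m) (C : 'M[K]_p) :
  isometric A B -> isometric B C -> isometric A C.
Proof.
case=> P [Q [PQ QP ->]] [P' [Q' [PQ' QP' ->]]].
exists (P *m P'), (Q' *m Q); split; last by rewrite trmx_mul !mulmxA.
  by rewrite mulmxA -(mulmxA P) PQ' mulmx1.
by rewrite mulmxA -(mulmxA Q') QP mulmx1.
Qed.

Lemma isom_reindex (T : Type) m n (A : 'M[K]_m) (B : 'M[K]_n)
    (u : T -> 'I_m) (v : T -> 'I_n) :
    bijective u -> bijective v ->
    (forall x y, A (u x) (u y) = B (v x) (v y)) ->
  isometric A B.
Proof.
case=> u' uK u'K [v' vK v'K] AB.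
pose f i := v (u' i); pose g j := u (v' j).
have fK i : g (f i) = i by rewrite /f /g vK u'K.
have gK j : f (g j) = j by rewrite /f /g uK v'K.
have AE i j : A i j = B (f i) (f j) by rewrite -AB !u'K.
exists (\matrix_(i, j) (f i == j)%:R), (\matrix_(j, i) (f i == j)%:R); split.
- apply/matrixP=> i j; rewrite !mxE (bigD1 (f i)) //= !mxE eqxx mul1r.
  rewrite big1 ?addr0 => [|k /negPf nk]; last first.
    by rewrite !mxE eq_sym nk mul0r.
  by rewrite (can_eq fK) eq_sym.
- apply/matrixP=> i j; rewrite !mxE (bigD1 (g i)) //= !mxE gK eqxx mul1r.
  rewrite big1 ?addr0 // => k nk; rewrite !mxE.
  have /negPf-> : f k != i by apply: contraNneq nk => <-; rewrite fK.
  by rewrite mul0r.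
apply/matrixP=> i j; rewrite !mxE (bigD1 (f j)) //= !mxE eqxx mulr1.
rewrite (bigD1 (f i)) //= !mxE eqxx mul1r AE.
rewrite big1 ?addr0 => [|k /negPf nk]; last first.
  by rewrite !mxE eq_sym nk mul0r.
by rewrite big1 ?addr0 // => k /negPf nk; rewrite !mxE [f j == k]eq_sym nk mulr0.
Qed.

Lemma bij_unsplit m n : bijective (@unsplit m n).
Proof. by exists (@split m n); [apply: unsplitK | apply: splitK]. Qed.

Lemma bij_mxtens m n : bijective (@mxtens_index m n).
Proof.
by exists (@mxtens_unindex m n); [apply: mxtens_indexK | apply: mxtens_unindexK].
Qed.

Definition sum_map (S S' T T' : Type) (f : S -> S') (g : T -> T') (x : S + T)
  : S' + T' := match x with inl s => inl (f s) | inr t => inr (g t) end.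

Lemma bij_sum (S S' T T' : Type) (f : S -> S') (g : T -> T') :
  bijective f -> bijective g -> bijective (sum_map f g).
Proof.
case=> f' fK f'K [g' gK g'K]; exists (sum_map f' g').
  by case=> x /=; rewrite ?fK ?gK.
by case=> x /=; rewrite ?f'K ?g'K.
Qed.

Definition prod_map (S S' T T' : Type) (f : S -> S') (g : T -> T') (x : S * T)
  : S' * T' := (f x.1, g x.2).

Lemma bij_prod (S S' T T' : Type) (f : S -> S') (g : T -> T') :
  bijective f -> bijective g -> bijective (prod_map f g).
Proof.
case=> f' fK f'K [g' gK g'K]; exists (prod_map f' g').
  by case=> x y; rewrite /prod_map /= fK gK.
by case=> x y; rewrite /prod_map /= f'K g'K.
Qed.

Lemma bij_id (T : Type) : bijective (@id T).
Proof. by exists id. Qed.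

Lemma block_ll m n (A : 'M[K]_m) B C (D : 'M[K]_n) i j :
  block_mx A B C D (unsplit (inl i)) (unsplit (inl j)) = A i j.
Proof. exact: block_mxEul. Qed.
Lemma block_lr m n (A : 'M[K]_m) B C (D : 'M[K]_n) i j :
  block_mx A B C D (unsplit (inl i)) (unsplit (inr j)) = B i j.
Proof. exact: block_mxEur. Qed.
Lemma block_rl m n (A : 'M[K]_m) B C (D : 'M[K]_n) i j :
  block_mx A B C D (unsplit (inr i)) (unsplit (inl j)) = C i j.
Proof. exact: block_mxEdl. Qed.
Lemma block_rr m n (A : 'M[K]_m) B C (D : 'M[K]_n) i j :
  block_mx A B C D (unsplit (inr i)) (unsplit (inr j)) = D i j.
Proof. exact: block_mxEdr. Qed.
Definition blockE := (block_ll, block_lr, block_rl, block_rr).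

Lemma dsumC m n (A : 'M[K]_m) (B : 'M[K]_n) :
  isometric (dsum A B) (dsum B A).
Proof.
pose sw S T (x : S + T) : T + S :=
  match x with inl s => inr s | inr t => inl t end.
apply: (isom_reindex (u := @unsplit m n) (v := @unsplit n m \o @sw _ _)).
- exact: bij_unsplit.
- by apply: bij_comp; [apply: bij_unsplit | exists (@sw _ _); case].
by case=> i [] j; rewrite /dsum /= !blockE ?mxE.
Qed.

Lemma dsumA m n p (A : 'M[K]_m) (B : 'M[K]_n) (C : 'M[K]_p) :
  isometric (dsum A (dsum B C)) (dsum (dsum A B) C).
Proof.
pose h S T U (x : S + (T + U)) : (S + T) + U :=
  match x with
  | inl s => inl (inl s) | inr (inl t) => inl (inr t) | inr (inr w) => inr w
  end.
pose h' S T U (x : (S + T) + U) : S + (T + U) :=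
  match x with
  | inl (inl s) => inl s | inl (inr t) => inr (inl t) | inr w => inr (inr w)
  end.
apply: (isom_reindex
  (u := @unsplit m (n + p) \o sum_map id (@unsplit n p))
  (v := @unsplit (m + n) p \o sum_map (@unsplit m n) id \o @h _ _ _)).
- by apply: bij_comp (@bij_unsplit _ _) (bij_sum (@bij_id _) (@bij_unsplit _ _)).
- apply: bij_comp; last by exists (@h' _ _ _); do 2?case.
  exact: bij_comp (@bij_unsplit _ _) (bij_sum (@bij_unsplit _ _) (@bij_id _)).
by case=> [i|[i|i]] [j|[j|j]]; rewrite /dsum /= !blockE ?mxE // !blockE ?mxE.
Qed.

Lemma dsum0 n (Z : 'M[K]_0) (A : 'M[K]_n) : isometric (dsum Z A) A.
Proof.
apply: (isom_reindex (u := @unsplit 0 n \o inr) (v := id)) => //.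
- apply: bij_comp; first exact: bij_unsplit.
  exists (fun x : 'I_0 + 'I_n => match x with inl (Ordinal _ h) =>
     False_rect _ (notF h) | inr y => y end) => //.
  by case=> // -[].
- exact: bij_id.
by move=> x y; rewrite /dsum /= blockE.
Qed.

Lemma isom_dsum m n m' n' (A : 'M[K]_m) (B : 'M[K]_n)
    (A' : 'M[K]_m') (B' : 'M[K]_n') :
  isometric A A' -> isometric B B' -> isometric (dsum A B) (dsum A' B').
Proof.
case=> P [Q [PQ QP ->]] [P' [Q' [PQ' QP' ->]]].
exists (block_mx P 0 0 P'), (block_mx Q 0 0 Q').
rewrite /dsum tr_block_mx !mulmx_block !trmx0.
by rewrite !(mul0mx, mulmx0, addr0, add0r) PQ PQ' QP QP' -!scalar_mx_block.
Qed.

Lemma hypD i j : isometric (dsum (hypmx i) (hypmx j)) (hypmx (i + j)).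
Proof.
pose h S T (x : (S + S) + (T + T)) : (S + T) + (S + T) :=
  match x with
  | inl (inl s) => inl (inl s) | inl (inr s) => inr (inl s)
  | inr (inl t) => inl (inr t) | inr (inr t) => inr (inr t)
  end.
pose h' S T (x : (S + T) + (S + T)) : (S + S) + (T + T) :=
  match x with
  | inl (inl s) => inl (inl s) | inr (inl s) => inl (inr s)
  | inl (inr t) => inr (inl t) | inr (inr t) => inr (inr t)
  end.
apply: (isom_reindex
  (u := @unsplit (i + i) (j + j) \o sum_map (@unsplit i i) (@unsplit j j))
  (v := @unsplit (i + j) (i + j) \o sum_map (@unsplit i j) (@unsplit i j)
        \o @h _ _)).
- by apply: bij_comp (bij_sum _ _); apply: bij_unsplit.
- apply: bij_comp; last by exists (@h' _ _); do 2?case.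
  by apply: bij_comp (bij_sum _ _); apply: bij_unsplit.
have E k l (x y : 'I_k + 'I_l) : (1%:M : 'M[K]_(k + l)) (unsplit x) (unsplit y)
    = match x, y with
      | inl a, inl b => (1%:M : 'M[K]_k) a b
      | inr a, inr b => (1%:M : 'M[K]_l) a b | _, _ => 0 end.
  by rewrite scalar_mx_block; case: x => a; case: y => b; rewrite blockE ?mxE.
move=> [[a|a]|[a|a]] [[b|b]|[b|b]]; rewrite /dsum /hypmx /= ?blockE.
all: by rewrite ?E ?mxE ?blockE ?E ?mxE.
Qed.

Lemma tens11 m n : (1%:M : 'M[K]_m) *t (1%:M : 'M[K]_n) = 1%:M.
Proof.
apply/matrixP=> i j; case: (mxtens_indexP i) => i0 i1.
case: (mxtens_indexP j) => j0 j1; rewrite tensmxE !mxE.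
rewrite (can_eq (@mxtens_indexK m n)) xpair_eqE.
by case: eqP; case: eqP; rewrite ?mulr1 ?mulr0.
Qed.

Lemma isom_tens m n m' n' (A : 'M[K]_m) (B : 'M[K]_n)
    (A' : 'M[K]_m') (B' : 'M[K]_n') :
  isometric A A' -> isometric B B' -> isometric (A *t B) (A' *t B').
Proof.
case=> P [Q [PQ QP ->]] [P' [Q' [PQ' QP' ->]]].
exists (P *t P'), (Q *t Q').
by rewrite trmx_tens !tensmx_mul PQ PQ' QP QP' !tens11.
Qed.

Lemma tensC m n (A : 'M[K]_m) (B : 'M[K]_n) : isometric (A *t B) (B *t A).
Proof.
pose sw S T (x : S * T) := (x.2, x.1).
apply: (isom_reindex (u := @mxtens_index m n)
                     (v := @mxtens_index n m \o @sw _ _)).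
- exact: bij_mxtens.
- by apply: bij_comp; [apply: bij_mxtens | exists (@sw _ _); case].
by case=> i i' [j j']; rewrite /= !tensmxE mulrC.
Qed.

Lemma tensA m n p (A : 'M[K]_m) (B : 'M[K]_n) (C : 'M[K]_p) :
  isometric (A *t (B *t C)) (A *t B *t C).
Proof.
pose h S T U (x : S * (T * U)) : S * T * U := ((x.1, x.2.1), x.2.2).
pose h' S T U (x : S * T * U) : S * (T * U) := (x.1.1, (x.1.2, x.2)).
apply: (isom_reindex
  (u := @mxtens_index m (n * p) \o prod_map id (@mxtens_index n p))
  (v := @mxtens_index (m * n) p \o prod_map (@mxtens_index m n) id
        \o @h _ _ _)).
- exact: bij_comp (@bij_mxtens _ _) (bij_prod (@bij_id _) (@bij_mxtens _ _)).
- apply: bij_comp; last by exists (@h' _ _ _); [case=> ? [] | case=> [[]]].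
  exact: bij_comp (@bij_mxtens _ _) (bij_prod (@bij_mxtens _ _) (@bij_id _)).
by case=> i [i' i''] [j [j' j'']]; rewrite /= /prod_map /= !tensmxE mulrA.
Qed.

Lemma tens1 n (A : 'M[K]_n) : isometric ((1%:M : 'M[K]_1) *t A) A.
Proof.
apply: (isom_reindex (u := @mxtens_index 1 n \o pair ord0) (v := id)).
- apply: bij_comp; first exact: bij_mxtens.
  by exists snd => // -[i j]; rewrite (ord1 i).
- exact: bij_id.
by move=> x y; rewrite /= tensmxE !mxE mul1r.
Qed.

Definition dist (S T U : Type) (x : (S + T) * U) : S * U + T * U :=
  match x.1 with inl s => inl (s, x.2) | inr t => inr (t, x.2) end.

Lemma bij_dist S T U : bijective (@dist S T U).
Proof.
exists (fun x => match x with inl p => (inl p.1, p.2)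
  | inr p => (inr p.1, p.2) end); first by case=> [[]].
by case=> [[]|[]].
Qed.

Lemma tens_block m n p (A : 'M[K]_m) B C (D : 'M[K]_n) (E : 'M[K]_p) :
  isometric (block_mx A B C D *t E)
            (block_mx (A *t E) (B *t E) (C *t E) (D *t E)).
Proof.
apply: (isom_reindex
  (u := @mxtens_index (m + n) p \o prod_map (@unsplit m n) id)
  (v := @unsplit (m * p) (n * p)
        \o sum_map (@mxtens_index m p) (@mxtens_index n p) \o @dist _ _ _)).
- exact: bij_comp (@bij_mxtens _ _) (bij_prod (@bij_unsplit _ _) (@bij_id _)).
- apply: bij_comp (@bij_dist _ _ _).
  exact: bij_comp (@bij_unsplit _ _) (bij_sum (@bij_mxtens _ _) (@bij_mxtens _ _)).
by case=> [[i|i] i'] [[j|j] j']; rewrite /= /prod_map /= tensmxE !blockE tensmxE.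
Qed.

Lemma tensDl m n p (A : 'M[K]_m) (B : 'M[K]_n) (C : 'M[K]_p) :
  isometric (dsum A B *t C) (dsum (A *t C) (B *t C)).
Proof.
by have := tens_block A 0 0 B C; rewrite !tens0mx.
Qed.

Lemma hyp_block n (B : 'M[K]_n) : B^T = B -> B \in unitmx ->
  isometric (block_mx 0 B B 0) (hypmx n).
Proof.
move=> sB uB; exists (block_mx 1%:M 0 0 B), (block_mx 1%:M 0 0 (invmx B)).
rewrite /hypmx tr_block_mx !mulmx_block !trmx0 trmx1 sB.
by rewrite !(mul0mx, mulmx0, addr0, add0r, mulmx1, mul1mx)
  mulmxV // mulVmx // -!scalar_mx_block.
Qed.

Lemma tens_unit m n (A : 'M[K]_m) (B : 'M[K]_n) :
  A \in unitmx -> B \in unitmx -> A *t B \in unitmx.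
Proof.
move=> uA uB; suff /mulmx1_unit[] :
  (A *t B) *m (invmx A *t invmx B) = 1%:M by [].
by rewrite tensmx_mul !mulmxV // tens11.
Qed.

Lemma hyp_tens m n (B : 'M[K]_n) : B^T = B -> B \in unitmx ->
  isometric (hypmx m *t B) (hypmx (m * n)).
Proof.
move=> sB uB; apply: isom_trans (tens_block _ _ _ _ _) _; rewrite !tens0mx.
apply: hyp_block; first by rewrite trmx_tens trmx1 sB.
by rewrite tens_unit ?unitmx1.
Qed.

Lemma hypN (K2 : 2%N \notin [pchar K]) n (A : 'M[K]_n) :
  A^T = A -> A \in unitmx -> isometric (dsum (- A) A) (hypmx n).
Proof.
move=> sA uA; have two0 : 2 != 0 :> K by rewrite inE /= in K2.
have h2 : 2^-1 + 2^-1 = 1 :> K.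
  by rewrite -[X in X + X]mulr1 -mulrDr -(natrD _ 1 1) mulVf.
pose U : 'M[K]_(n + n) := block_mx (- A) 2^-1%:M A 2^-1%:M.
have E : dsum (- A) A = U *m hypmx n *m U^T.
  rewrite /U /hypmx tr_block_mx !mulmx_block !(mulmx0, mulmx1, addr0, add0r).
  rewrite linearN /= sA !tr_scalar_mx !mul_scalar_mx !mul_mx_scalar.
  by rewrite -!scalerDl h2 -!scalerDr addrN addNr !scaler0 !scale1r.
have : dsum (- A) A \in unitmx.
  rewrite unitmxE det_ublock unitrM -!unitmxE uA andbT.
  by rewrite -scaleN1r unitmxZ ?unitrN1.
rewrite E !unitmx_mul => /andP[/andP[uU _] _].
by exists U, (invmx U); split; rewrite ?mulmxV ?mulVmx.
Qed.

End Isometry.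

Record qform (K : fieldType) := QForm {
  qdim : nat;
  gram :> 'M[K]_qdim;
  gram_sym : gram^T = gram;
  gram_unit : gram \in unitmx }.

HB.instance Definition _ (K : fieldType) := gen_eqMixin (qform K).
HB.instance Definition _ (K : fieldType) := gen_choiceMixin (qform K).

Section Operations.
Variable K : fieldType.
Implicit Types phi psi : qform K.

Lemma qzero_sym : (1%:M : 'M[K]_0)^T = 1%:M. Proof. exact: trmx1. Qed.
Definition qzero := QForm qzero_sym (unitmx1 _ _).

Lemma qone_sym : (1%:M : 'M[K]_1)^T = 1%:M. Proof. exact: trmx1. Qed.
Definition qone := QForm qone_sym (unitmx1 _ _).

Lemma qopp_sym phi : (- (phi : 'M_(qdim phi)))^T = - (phi : 'M_(qdim phi)).
Proof. by rewrite linearN /= gram_sym. Qed.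
Lemma qopp_unit phi : - (phi : 'M_(qdim phi)) \in unitmx.
Proof. by rewrite -scaleN1r unitmxZ ?unitrN1 ?gram_unit. Qed.
Definition qopp phi := QForm (qopp_sym phi) (qopp_unit phi).

Lemma qsum_sym phi psi : (dsum phi psi)^T = dsum phi psi.
Proof. by rewrite /dsum tr_block_mx !gram_sym !trmx0. Qed.
Lemma qsum_unit phi psi : dsum phi psi \in unitmx.
Proof. by rewrite unitmxE det_ublock unitrM -!unitmxE !gram_unit. Qed.
Definition qsum phi psi := QForm (qsum_sym phi psi) (qsum_unit phi psi).

Lemma qtens_sym phi psi : (phi *t psi)^T = phi *t psi.
Proof. by rewrite trmx_tens !gram_sym. Qed.
Definition qtens phi psi :=
  QForm (qtens_sym phi psi) (tens_unit (gram_unit phi) (gram_unit psi)).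

Definition witt_equiv phi psi : Prop :=
  exists i j, isometric (dsum phi (hypmx K i)) (dsum psi (hypmx K j)).

Definition witt_rel : rel (qform K) := fun phi psi => `[< witt_equiv phi psi >].

Lemma isom_witt phi psi : isometric phi psi -> witt_equiv phi psi.
Proof. by move=> h; exists 0, 0; apply: isom_dsum h (isom_refl _). Qed.

Lemma witt_refl phi : witt_equiv phi phi.
Proof. exact/isom_witt/isom_refl. Qed.

Lemma witt_sym phi psi : witt_equiv phi psi -> witt_equiv psi phi.
Proof. by case=> i [j /isom_sym h]; exists j, i. Qed.

Lemma hyp_add m (A : 'M[K]_m) i j :
  isometric (dsum A (hypmx K (i + j))) (dsum (dsum A (hypmx K i)) (hypmx K j)).
Proof.
apply: isom_trans (dsumA _ _ _); apply: isom_dsum (isom_refl _) _.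
exact/isom_sym/hypD.
Qed.

Lemma witt_trans psi phi theta :
  witt_equiv phi psi -> witt_equiv psi theta -> witt_equiv phi theta.
Proof.
case=> i [j h] [k [l h']]; exists (i + k)%N, (l + j)%N.
apply: isom_trans (hyp_add _ _ _) _.
apply: isom_trans (isom_dsum h (isom_refl _)) _.
apply: isom_trans (isom_sym (hyp_add _ _ _)) _; rewrite (addnC j k).
apply: isom_trans (hyp_add _ _ _) _.
apply: isom_trans (isom_dsum h' (isom_refl _)) _.
exact: isom_sym (hyp_add _ _ _).
Qed.

Lemma witt_sum phi phi' psi psi' : witt_equiv phi phi' -> witt_equiv psi psi' ->
  witt_equiv (qsum phi psi) (qsum phi' psi').
Proof.
have half (f f' g : qform K) : witt_equiv f f' ->
    witt_equiv (qsum g f) (qsum g f').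
  case=> i [j h]; exists i, j => /=.
  apply: isom_trans (isom_sym (dsumA _ _ _)) _; apply: isom_trans (dsumA _ _ _).
  exact: isom_dsum (isom_refl _) h.
have comm f g : witt_equiv (qsum f g) (qsum g f).
  exact/isom_witt/dsumC.
move=> h h'; apply: witt_trans (half _ _ _ h') _.
by apply: witt_trans (comm _ _) _; apply: witt_trans (half _ _ _ h) _.
Qed.

Lemma witt_tens phi phi' psi psi' :
  witt_equiv phi phi' -> witt_equiv psi psi' ->
  witt_equiv (qtens phi psi) (qtens phi' psi').
Proof.
have half (f f' g : qform K) : witt_equiv f f' ->
    witt_equiv (qtens f g) (qtens f' g).
  have E (e : qform K) k : isometric (dsum (e *t g) (hypmx K (k * qdim g)))
                        (dsum e (hypmx K k) *t g).
    apply: isom_trans (isom_sym (tensDl _ _ _)).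
    apply: isom_dsum (isom_refl _) (isom_sym _).
    exact: hyp_tens (gram_sym _) (gram_unit _).
  case=> i [j h]; exists (i * qdim g)%N, (j * qdim g)%N => /=.
  apply: isom_trans (E _ _) _; apply: isom_trans (isom_sym (E _ _)).
  exact: isom_tens h (isom_refl _).
have comm f g : witt_equiv (qtens f g) (qtens g f).
  exact/isom_witt/tensC.
move=> h h'; apply: witt_trans (half _ _ _ h) _.
apply: witt_trans (comm _ _) _; apply: witt_trans (half _ _ _ h') _.
exact: comm.
Qed.

Lemma witt_isN (K2 : 2%N \notin [pchar K]) phi :
  witt_equiv (qsum (qopp phi) phi) qzero.
Proof.
exists 0%N, (qdim phi) => /=.
apply: isom_trans (dsumC _ _) _; apply: isom_trans (dsum0 _ _) _.
apply: isom_trans (hypN K2 (gram_sym _) (gram_unit _)) _.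
exact: isom_sym (dsum0 _ _).
Qed.

Lemma witt_oppE (K2 : 2%N \notin [pchar K]) phi psi :
  witt_equiv phi psi -> witt_equiv (qopp phi) (qopp psi).
Proof.
case=> i [j [P [Q [PQ QP h]]]].
have N : isometric (dsum (- (phi : 'M_(qdim phi))) (- hypmx K i))
                   (dsum (- (psi : 'M_(qdim psi))) (- hypmx K j)).
  exists P, Q; split=> //.
  have opp_dsum m n (A : 'M[K]_m) (B : 'M[K]_n) : dsum (- A) (- B) = - dsum A B.
    by rewrite /dsum opp_block_mx !oppr0.
  by rewrite !opp_dsum h mulmxN mulNmx.
have Nhyp k : isometric (- hypmx K k) (hypmx K k).
  exists (block_mx 1%:M 0 0 (- 1%:M)), (block_mx 1%:M 0 0 (- 1%:M)).
  rewrite /hypmx tr_block_mx opp_block_mx !mulmx_block [(- _)^T]linearN /= !trmx0 trmx1.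
  by rewrite !(mul0mx, mulmx0, addr0, add0r, mulmx1, mul1mx, mulNmx, mulmxN,
    opprK, oppr0) -!scalar_mx_block.
exists i, j; apply: isom_trans (isom_dsum (isom_refl _) (isom_sym (Nhyp _))) _.
by apply: isom_trans N _; apply: isom_dsum (isom_refl _) (Nhyp _).
Qed.

Lemma witt_relP phi psi : reflect (witt_equiv phi psi) (witt_rel phi psi).
Proof. exact: asboolP. Qed.

Lemma witt_rel_refl : reflexive witt_rel.
Proof. by move=> x; apply/witt_relP/witt_refl. Qed.
Lemma witt_rel_sym : symmetric witt_rel.
Proof. by move=> x y; apply/witt_relP/witt_relP; apply: witt_sym. Qed.
Lemma witt_rel_trans : transitive witt_rel.
Proof.
move=> y x z /witt_relP h /witt_relP h'.
exact/witt_relP/(witt_trans h h').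
Qed.

Canonical witt_equiv_rel :=
  EquivRel witt_rel witt_rel_refl witt_rel_sym witt_rel_trans.

End Operations.

(* The ring depends on the characteristic hypothesis K2, without which        *)
(* phi \perp (- phi) need not be hyperbolic.                                  *)
Definition witt (K : fieldType) (K2 : 2%N \notin [pchar K]) : Type :=
  {eq_quot @witt_rel K}.

Section WittRing.
Variables (K : fieldType) (K2 : 2%N \notin [pchar K]).
Local Notation W := (witt K2).

HB.instance Definition _ := Choice.on W.
HB.instance Definition _ := EqQuotient.on W.

Definition witt_class (phi : qform K) : W := \pi_W phi.

Lemma witt_classP phi psi :
  witt_class phi = witt_class psi <-> witt_equiv phi psi.
Proof.
by split=> [/eqmodP/witt_relP | h]; last apply/eqmodP/witt_relP.
Qed.

Lemma witt_classW (P : W -> Prop) : (forall phi, P (witt_class phi)) ->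
  forall x, P x.
Proof. by move=> h; elim/quotW. Qed.

Definition witt_add (x y : W) : W := witt_class (qsum (repr x) (repr y)).
Definition witt_mul (x y : W) : W := witt_class (qtens (repr x) (repr y)).
Definition witt_opp (x : W) : W := witt_class (qopp (repr x)).

Lemma repr_class phi : witt_equiv (repr (witt_class phi)) phi.
Proof. by apply/witt_classP; rewrite /witt_class reprK. Qed.

Lemma witt_addE phi psi :
  witt_add (witt_class phi) (witt_class psi) = witt_class (qsum phi psi).
Proof. by apply/witt_classP/witt_sum; apply: repr_class. Qed.

Lemma witt_mulE phi psi :
  witt_mul (witt_class phi) (witt_class psi) = witt_class (qtens phi psi).
Proof. by apply/witt_classP/witt_tens; apply: repr_class. Qed.

Lemma witt_opp_classE phi : witt_opp (witt_class phi) = witt_class (qopp phi).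
Proof. by apply/witt_classP/witt_oppE => //; apply: repr_class. Qed.

Lemma witt_addA : associative witt_add.
Proof.
elim/witt_classW=> x; elim/witt_classW=> y; elim/witt_classW=> z.
by rewrite !witt_addE; apply/witt_classP/isom_witt/dsumA.
Qed.

Lemma witt_addC : commutative witt_add.
Proof.
elim/witt_classW=> x; elim/witt_classW=> y.
by rewrite !witt_addE; apply/witt_classP/isom_witt/dsumC.
Qed.

Lemma witt_add0 : left_id (witt_class (qzero K)) witt_add.
Proof.
elim/witt_classW=> x; rewrite witt_addE.
exact/witt_classP/isom_witt/dsum0.
Qed.

Lemma witt_addN : left_inverse (witt_class (qzero K)) witt_opp witt_add.
Proof.
elim/witt_classW=> x; rewrite witt_opp_classE witt_addE.
exact/witt_classP/witt_isN.
Qed.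

HB.instance Definition _ :=
  GRing.isZmodule.Build W witt_addA witt_addC witt_add0 witt_addN.

Lemma witt_mulA : associative witt_mul.
Proof.
elim/witt_classW=> x; elim/witt_classW=> y; elim/witt_classW=> z.
by rewrite !witt_mulE; apply/witt_classP/isom_witt/tensA.
Qed.

Lemma witt_mulC : commutative witt_mul.
Proof.
elim/witt_classW=> x; elim/witt_classW=> y.
by rewrite !witt_mulE; apply/witt_classP/isom_witt/tensC.
Qed.

Lemma witt_mul1 : left_id (witt_class (qone K)) witt_mul.
Proof.
elim/witt_classW=> x; rewrite witt_mulE.
exact/witt_classP/isom_witt/tens1.
Qed.

Lemma witt_mulDl : left_distributive witt_mul +%R.
Proof.
elim/witt_classW=> x; elim/witt_classW=> y; elim/witt_classW=> z.
rewrite -![_ + _]/(witt_add _ _) !(witt_addE, witt_mulE).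
exact/witt_classP/isom_witt/tensDl.
Qed.

HB.instance Definition _ :=
  GRing.Zmodule_isComPzRing.Build W witt_mulA witt_mulC witt_mul1 witt_mulDl.

(* The parity of the dimension is a Witt invariant, so one even-dimensional   *)
(* representative suffices.                                                   *)
Definition fund_ideal (x : W) : Prop :=
  exists2 phi : qform K, ~~ odd (qdim phi) & x = witt_class phi.

End WittRing.

(* The ideal generated by the m-fold products of elements of I.               *)
Definition ideal_power (R : comPzRingType) (I : R -> Prop) (m : nat) (x : R)
  : Prop :=
  exists k (c : 'I_k -> R) (y : 'I_k -> 'I_m -> R),
    (forall i j, I (y i j)) /\ x = \sum_(i < k) c i * \prod_(j < m) y i j.

Definition fund_power (K : fieldType) (K2 : 2%N \notin [pchar K]) (m : nat)
  : witt K2 -> Prop := ideal_power (@fund_ideal K K2) m.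

Section Extension.
Variables (K : fieldType) (L : fieldExtType K).

Lemma pchar2_ext : 2%N \notin [pchar K] -> 2%N \notin [pchar L].
Proof. by rewrite pchar_lalg. Qed.

Lemma qext_sym (phi : qform K) : (map_mx (in_alg L) phi)^T = map_mx (in_alg L) phi.
Proof. by rewrite map_trmx gram_sym. Qed.
Lemma qext_unit (phi : qform K) : map_mx (in_alg L) phi \in unitmx.
Proof. by rewrite map_unitmx gram_unit. Qed.
Definition qext (phi : qform K) : qform L := QForm (qext_sym phi) (qext_unit phi).

Definition ext_norm (x : L) : K :=
  \det (passmx.mxof (vbasis {:L}) (vbasis {:L}) (amull x)).

(* A tower K = E_0 < E_1 < ... < E_r = L with every E_(i+1) / E_i quadratic;  *)
(* r = 0 is allowed.                                                          *)
Definition two_extension : Prop :=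
  exists s : seq {subfield L},
    path (fun E F : {subfield L} => (E <= F)%VS && (\dim_E F == 2)%N) 1%AS s
    /\ last 1%AS s = {:L}%AS.

End Extension.

(* Main.v *)
From HB Require Import structures.
Require Import Defs.
From mathcomp Require Import all_boot all_order all_algebra all_field.
From mathcomp Require Import boolp ring zify.
From mathcomp.real_closed Require Import mxtens.

Set Implicit Arguments.
Unset Strict Implicit.
Unset Printing Implicit Defensive.

Import GRing.Theory.
Local Open Scope ring_scope.

(** A factor $x$ with $x\varphi_L\simeq\varphi_L$ is passed down a quadratic step
    $E=F(\sqrt d)$ by the transfer along the functional $E\to F$ that reads the
    coefficient of $\sqrt d$: it sends $\varphi_E$ to a hyperbolic form and
    $z\varphi_E$, $z=u+v\sqrt d$, to $v(\varphi\perp-\mathsf N(z)\varphi)$, so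
    $z\varphi_E\simeq\varphi_E$ forces $\mathsf N(z)\varphi\simeq\varphi$
    ([norm_principle]).  When $\varphi_L$ is hyperbolic, every $x\in L^\times$ is such a
    factor, and transitivity of the norm ([ext_norm_quadratic]) brings $\mathsf N_{L/K}(x)$
    down to $K$ ([norm_similarity]).  This direction holds for every form.

    Conversely, let $a\varphi\simeq\varphi$.  Over $K(\sqrt{-a})$ the element $a$ is the
    norm of $\sqrt{-a}$, and $-a$ is a square, so that $-\varphi\simeq\varphi$, that is
    $2\varphi=0$.  From there on the hypothesis on $\mathsf I^{n+1}$ enters through one fact:
    if $\mathsf I^{n+1}F(\sqrt{-1})=0$, then $\mathsf I^{n+1}F$ is torsion free, so
    a form in $\mathsf I^nF$ killed by $2$ has every $y\in F^\times$ as a similarity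
    factor ([torsion_similarity]).  Given $y$ with $\mathsf N(y)=a$, an
    anisotropic $\varphi$ with $y\varphi\simeq\varphi$ contains a binary form
    $p\langle 1,-d\rangle$ such that $y$ is a norm from $F(\sqrt d)$
    ([split_binary]).  Over $F(\sqrt d)$ this binary form becomes a hyperbolic plane, $a$ is
    still a norm, and $\mathsf I^{n+1}$ of $F(\sqrt d,\sqrt{-1})$ is still zero
    ([good_quadratic]).  Repeating this until nothing anisotropic is left gives the tower
    ([split_tower]).

    Torsion freeness of $\mathsf I^{n+1}F$ is usually read off from signatures at the orderings
    of $F$; here it is obtained from Pfister forms alone.  Let $\pi,\pi'$ be
    $(n+1)$-fold Pfister forms.  If $2\pi=0$ then $\pi=0$ ([double_pf_eq0]), if
    $2\pi=2\pi'$ then $\pi=\pi'$ ([double_pf_inj]), and $\pi=2\rho$ for an $n$-fold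
    $\rho$ ([pf_halve]).  The last property cuts $\pi$ into pieces
    $\langle\langle f\rangle\rangle\rho+\langle\langle -f\rangle\rangle\rho$ according to the
    sign of an element $f$.  Doing so for all slots $f$ that occur in an integral combination
    of Pfister forms splits the combination into parts, the algebraic counterpart
    of a partition of the space of orderings, and on each part the Pfister forms involved
    coincide or vanish ([pfcomb_torsion_free]). *)

(** * Values of quadratic forms *)

Section Values.
Variable K : fieldType.

Definition qval n (A : 'M[K]_n) (v : 'rV[K]_n) : K := (v *m A *m v^T) 0 0.

Definition represents n (A : 'M[K]_n) (c : K) : Prop := exists v, qval A v = c.

Definition isotropic n (A : 'M[K]_n) : Prop :=
  exists2 v, v != 0 & qval A v = 0.

Lemma qvalE n (A : 'M[K]_n) v : v *m A *m v^T = (qval A v)%:M.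
Proof. exact: mx11_scalar. Qed.

Lemma qval0 n (A : 'M[K]_n) : qval A 0 = 0.
Proof. by rewrite /qval !mul0mx mxE. Qed.

Lemma qvalZ n (A : 'M[K]_n) a v : qval A (a *: v) = a ^+ 2 * qval A v.
Proof.
by rewrite /qval linearZ /= -scalemxAr -!scalemxAl !mxE mulrA expr2.
Qed.

Lemma qval_scale n (A : 'M[K]_n) a v : qval (a *: A) v = a * qval A v.
Proof. by rewrite /qval -scalemxAr -scalemxAl mxE. Qed.

Lemma qval_dsum m n (A : 'M[K]_m) (B : 'M[K]_n) v w :
  qval (dsum A B) (row_mx v w) = qval A v + qval B w.
Proof.
rewrite /qval /dsum mul_row_block tr_row_mx mul_row_col.
by rewrite !mulmx0 addr0 add0r mxE.
Qed.

Lemma qval1 (a : K) x : qval (a%:M : 'M_1) x%:M = a * x ^+ 2.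
Proof.
by rewrite /qval -scalar_mxM tr_scalar_mx -scalar_mxM mxE eqxx mulr1n; ring.
Qed.

Lemma represents1 (a c : K) :
  represents (a%:M : 'M_1) c <-> exists x, c = a * x ^+ 2.
Proof.
split=> [[v <-]|[x ->]]; last by exists x%:M; rewrite qval1.
by exists (v 0 0); rewrite [in LHS](mx11_scalar v) qval1.
Qed.

Lemma represents0 n (A : 'M[K]_n) : represents A 0.
Proof. by exists 0; rewrite qval0. Qed.

Lemma represents_sqr n (A : 'M[K]_n) a c :
  represents A c -> represents A (a ^+ 2 * c).
Proof. by case=> v <-; exists (a *: v); rewrite qvalZ. Qed.

Lemma represents_dsum m n (A : 'M[K]_m) (B : 'M[K]_n) c :
  represents (dsum A B) c <->
  exists p q, [/\ represents A p, represents B q & c = p + q].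
Proof.
split=> [[v <-]|[p [q [[v <-] [w <-] ->]]]]; last first.
  by exists (row_mx v w); rewrite qval_dsum.
exists (qval A (lsubmx v)), (qval B (rsubmx v)).
by split; [eexists | eexists | rewrite -{1}[v]hsubmxK qval_dsum].
Qed.

Lemma represents_scale n (A : 'M[K]_n) a c :
  represents (a *: A) c <-> exists2 p, represents A p & c = a * p.
Proof.
split=> [[v <-]|[p [v <-] ->]]; last by exists v; rewrite qval_scale.
by exists (qval A v); [exists v | rewrite qval_scale].
Qed.

Lemma represents_isometric m n (A : 'M[K]_m) (B : 'M[K]_n) c :
  isometric A B -> represents A c -> represents B c.
Proof.
case=> P [Q [_ _ ->]] [v <-]; exists (v *m P).
by rewrite /qval trmx_mul !mulmxA.
Qed.

Lemma isotropic_isometric m n (A : 'M[K]_m) (B : 'M[K]_n) :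
  isometric A B -> isotropic A -> isotropic B.
Proof.
case=> P [Q [PQ _ ->]] [v v0 qv]; exists (v *m P); last first.
  by rewrite -qv /qval trmx_mul !mulmxA.
by apply: contra_neq v0 => /(congr1 (mulmx^~ Q)); rewrite mul0mx -mulmxA PQ mulmx1.
Qed.

Lemma isometric_dim m n (A : 'M[K]_m) (B : 'M[K]_n) : isometric A B -> m = n.
Proof.
case=> P [Q [PQ QP _]]; apply/eqP.
by rewrite eqn_leq (mulmx1_min PQ) (mulmx1_min QP).
Qed.

Lemma isometric_sym m n (A : 'M[K]_m) (B : 'M[K]_n) :
  isometric A B -> A^T = A -> B^T = B.
Proof.
by case/isom_sym=> P [Q [_ _ ->]] sA; rewrite !trmx_mul trmxK sA mulmxA.
Qed.

Lemma isometric_unit m n (A : 'M[K]_m) (B : 'M[K]_n) :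
  isometric A B -> A \in unitmx -> B \in unitmx.
Proof.
case/isom_sym=> Q [P [QP PQ ->]] uA.
suff /mulmx1_unit[] : (Q *m A *m Q^T) *m (P^T *m invmx A *m P) = 1%:M by [].
rewrite !mulmxA -(mulmxA _ Q^T) -trmx_mul PQ trmx1 mulmx1.
by rewrite -(mulmxA Q) mulmxV // mulmx1.
Qed.

Lemma dsum_unit m n (A : 'M[K]_m) (B : 'M[K]_n) :
  (dsum A B \in unitmx) = (A \in unitmx) && (B \in unitmx).
Proof. by rewrite unitmxE det_ublock unitrM -!unitmxE. Qed.

Lemma isotropic_dsumr m n (A : 'M[K]_m) (B : 'M[K]_n) :
  isotropic B -> isotropic (dsum A B).
Proof.
case=> v v0 qv; exists (row_mx 0 v); last by rewrite qval_dsum qval0 add0r.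
by apply: contra_neq v0; rewrite -row_mx0 => /eq_row_mx[].
Qed.

Lemma isotropic_dsum m n (A : 'M[K]_m) (B : 'M[K]_n) : isotropic (dsum A B) ->
  [\/ isotropic A, isotropic B |
      exists c, [/\ c != 0, represents A c & represents B (- c)]].
Proof.
case=> v v0; rewrite -[v]hsubmxK qval_dsum => /eqP.
rewrite addrC addr_eq0 => /eqP qv.
case: (eqVneq (qval A (lsubmx v)) 0) => [q0|q0]; last first.
  by apply: Or33; exists (qval A (lsubmx v)); split; [|eexists|eexists; apply: qv].
case: (eqVneq (lsubmx v) 0) => [l0|l0]; last by apply: Or31; exists (lsubmx v).
apply: Or32; exists (rsubmx v); last by rewrite qv q0 oppr0.
by apply: contra_neq v0 => r0; rewrite -[v]hsubmxK l0 r0 row_mx0.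
Qed.

End Values.

Section Splitting.
Variable K : fieldType.

(** The orthogonal complement of an anisotropic vector [v] is the kernel of
    pairing with [v]; projecting along [v] shows that the two span the space. *)
Lemma split_vector n (A : 'M[K]_n) v : A^T = A -> qval A v != 0 ->
  exists m (B : 'M[K]_m), isometric A (dsum ((qval A v)%:M : 'M_1) B) /\
    forall u, u *m A *m v^T = 0 -> represents B (qval A u).
Proof.
move=> sA c0; set c := qval A v.
have [m [W [fW W0 inW]]] : exists m (W : 'M_(m, n)),
    [/\ row_free W, W *m (A *m v^T) = 0 & forall p (u : 'M_(p, n)),
       u *m (A *m v^T) = 0 -> u *m pinvmx W *m W = u].
  exists _, (row_base (kermx (A *m v^T))); split; first exact: row_base_free.
    by apply/sub_kermxP; rewrite eq_row_base.
  by move=> p u u0; apply: mulmxKpV; rewrite eq_row_base; apply/sub_kermxP.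
have vE : v *m (A *m v^T) = c%:M by rewrite mulmxA qvalE.
exists _, (W *m A *m W^T); split; last first.
  move=> u; rewrite -mulmxA => u0; exists (u *m pinvmx W).
  rewrite /qval -[in RHS](inW _ u u0) !trmx_mul.
  by rewrite !mulmxA.
pose R := 1%:M - c^-1 *: (A *m v^T *m v).
have R0 : R *m (A *m v^T) = 0.
  rewrite mulmxBl mul1mx -scalemxAl -(mulmxA _ v) vE mul_mx_scalar scalerA.
  by rewrite mulVf // scale1r subrr.
exists (row_mx (c^-1 *: (A *m v^T)) (R *m pinvmx W)), (col_mx v W).
have E1 : row_mx (c^-1 *: (A *m v^T)) (R *m pinvmx W) *m col_mx v W = 1%:M.
  by rewrite mul_row_col inW // -scalemxAl addrC subrK.
split=> //.
  rewrite mul_col_row -!scalemxAr vE W0 scaler0 (mulmxA v) (mulmxA W).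
  have -> : v *m R = 0.
    rewrite mulmxBr mulmx1 -scalemxAr mulmxA vE mul_scalar_mx scalerA.
    by rewrite mulVf // scale1r subrr.
  have -> : W *m R = W.
    by rewrite mulmxBr mulmx1 -scalemxAr mulmxA W0 mul0mx scaler0 subr0.
  by rewrite mul0mx mulmxVp // scale_scalar_mx mulVf // -scalar_mx_block.
have -> : dsum (c%:M : 'M_1) (W *m A *m W^T) = col_mx v W *m A *m (col_mx v W)^T.
  rewrite tr_col_mx mul_col_mx mul_col_row -!(mulmxA _ A) vE W0.
  have -> : v *m (A *m W^T) = 0; last by rewrite mulmxA.
  by apply: trmx_inj; rewrite !trmx_mul trmxK sA -(mulmxA W) W0 trmx0.
move: (row_mx _ _) (col_mx v W) E1 => P Q E1.
by rewrite !mulmxA E1 mul1mx -mulmxA -trmx_mul E1 trmx1 mulmx1.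
Qed.

(** Replacing $0$ by $1$ makes the scaled form and the line nondegenerate for every scalar. *)
Definition nz (a : K) := if a == 0 then 1 else a.

Lemma nz_neq0 a : nz a != 0.
Proof. by rewrite /nz; case: ifPn => // _; apply: oner_neq0. Qed.

Lemma nzE a : a != 0 -> nz a = a.
Proof. by rewrite /nz => /negPf->. Qed.

Lemma qscale_sym a (phi : qform K) :
  (nz a *: (phi : 'M_(qdim phi)))^T = nz a *: (phi : 'M_(qdim phi)).
Proof. by rewrite linearZ /= gram_sym. Qed.
Lemma qscale_unit a (phi : qform K) : nz a *: (phi : 'M_(qdim phi)) \in unitmx.
Proof. by rewrite unitmxZ ?gram_unit // unitfE nz_neq0. Qed.
Definition qscale a phi := QForm (qscale_sym a phi) (qscale_unit a phi).

Lemma qline_sym a : ((nz a)%:M : 'M[K]_1)^T = (nz a)%:M.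
Proof. exact: tr_scalar_mx. Qed.
Lemma qline_unit a : ((nz a)%:M : 'M[K]_1) \in unitmx.
Proof. by rewrite unitmxE det_scalar1 unitfE nz_neq0. Qed.
Definition qline a := QForm (qline_sym a) (qline_unit a).

Lemma qsplit_vector (phi : qform K) v : qval phi v != 0 ->
  exists psi : qform K, isometric phi (qsum (qline (qval phi v)) psi) /\
    forall u, u *m phi *m v^T = 0 -> represents psi (qval phi u).
Proof.
move=> c0; have [m [B [iB oB]]] := split_vector (gram_sym phi) c0.
have := isometric_unit iB (gram_unit phi); rewrite dsum_unit => /andP[_ uB].
have := isometric_sym iB (gram_sym phi); rewrite /dsum tr_block_mx.
move=> /eq_block_mx[_ _ _ sB].
by exists (QForm sB uB); split; rewrite //= nzE.
Qed.

Lemma qsplit (phi : qform K) c : c != 0 -> represents phi c ->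
  exists psi : qform K, isometric phi (qsum (qline c) psi).
Proof. by move=> c0 [v vc]; subst; have [psi []] := qsplit_vector c0; exists psi. Qed.

Hypothesis K2 : 2%N \notin [pchar K].

Lemma two_neq0 : 2 != 0 :> K.
Proof. by move: K2; rewrite inE. Qed.

Lemma qval_polar n (A : 'M[K]_n) (u v : 'rV_n) : A^T = A ->
  qval A (u + v) = qval A u + qval A v + 2 * (u *m A *m v^T) 0 0.
Proof.
move=> sA; have E : v *m A *m u^T = (u *m A *m v^T)^T.
  by rewrite !trmx_mul trmxK sA mulmxA.
rewrite /qval linearD /= mulmxDr !mulmxDl E.
move: (u *m A *m u^T) (u *m A *m v^T) (v *m A *m v^T) => x y z.
by rewrite !mxE; ring.
Qed.

Lemma qform_represents (phi : qform K) : (0 < qdim phi)%N ->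
  exists2 c : K, c != 0 & represents phi c.
Proof.
move=> n0; apply: contrapT => h.
have q0 v : qval phi v = 0.
  by apply: contrapT => /eqP q; apply: h; exists (qval phi v); [|exists v].
have B0 (u v : 'rV_(qdim phi)) : (u *m phi *m v^T) 0 0 = 0.
  have := qval_polar u v (gram_sym phi); rewrite !q0 !add0r => /esym/eqP.
  by rewrite mulf_eq0 (negPf two_neq0) => /eqP.
have g0 : (phi : 'M_(qdim phi)) = 0.
  apply/matrixP=> i j; rewrite [RHS]mxE -(B0 (delta_mx 0 i) (delta_mx 0 j)).
  by rewrite trmx_delta -rowE -colE !mxE.
have := gram_unit phi; rewrite g0 unitmxE; move: n0; case: (qdim phi) => // m _.
by rewrite det0 unitr0.
Qed.

Lemma qform_ind (P : qform K -> Prop) :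
  (forall phi, qdim phi = 0 -> P phi) ->
  (forall (c : K) (psi phi : qform K), c != 0 -> isometric phi (qsum (qline c) psi) ->
     P psi -> P phi) ->
  forall phi, P phi.
Proof.
move=> P0 PS phi; move: {2}(qdim phi) (erefl (qdim phi)) => n.
elim: n phi => [|n IH] phi nE; first exact: P0.
have [c c0 rc] : exists2 c : K, c != 0 & represents phi c.
  by apply: qform_represents; rewrite nE.
have [psi i] := qsplit c0 rc; have iE := isometric_dim i.
by apply: PS c0 i (IH _ _); move: iE; rewrite nE /= add1n => -[].
Qed.

(** The isometry maps the first basis vector to $(p, q)$ and the others to $(r, S)$;
    choosing $e=\pm1$ different from $p$, the matrix $S - rq/(p-e)$ is an isometry of the
    complements: it is the lower block after composing with the reflection that brings
    $(p,q)$ to $(e,0)$. *)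
Lemma cancel_line m n (A : 'M[K]_m) (B : 'M[K]_n) a : a != 0 ->
  A \in unitmx -> B \in unitmx -> B^T = B ->
  isometric (dsum (a%:M : 'M_1) A) (dsum (a%:M : 'M_1) B) -> isometric A B.
Proof.
move=> a0 uA uB sB i; have mn : m = n by have := isometric_dim i; case.
subst n; case: i => P [_ [_ _]].
rewrite -[P]submxK; set p := ulsubmx P; set q := ursubmx P.
set r := dlsubmx P; set S := drsubmx P.
rewrite /dsum tr_block_mx !mulmx_block !(mulmx0, addr0, add0r).
move=> /eq_block_mx[].
rewrite [p]mx11_scalar; move: (p 0 0) => {}p.
rewrite tr_scalar_mx -!scalar_mxM => E1 _ E3 E4.
have [e e2 pe] : exists2 e : K, e ^+ 2 = 1 & p - e != 0.
  case: (eqVneq p 1) => [->|p1]; last by exists 1; rewrite ?expr1n // subr_eq0.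
  by exists (-1); rewrite ?sqrrN ?expr1n // opprK two_neq0.
have E3' : S *m B *m q^T = - (p * a) *: r.
  apply/eqP; rewrite scaleNr -addr_eq0; apply/eqP.
  by rewrite [RHS]E3 mul_mx_scalar mul_mx_scalar scalerA addrC.
have E3'' : q *m B *m S^T = - (p * a) *: r^T.
  by rewrite -linearZ -E3' /= !trmx_mul trmxK sB mulmxA.
have E1' : q *m B *m q^T = (a - p * a * p)%:M.
  by apply/eqP; rewrite raddfB /= eq_sym subr_eq addrC -E1.
have E4' : S *m B *m S^T = A - a *: (r *m r^T).
  by rewrite E4 mul_mx_scalar -scalemxAl addrC addKr.
pose S' := S - (p - e)^-1 *: (r *m q).
have S'E : S' *m B *m S'^T = A.
  have T1 : S *m B *m (q^T *m r^T) = - (p * a) *: (r *m r^T).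
    by rewrite mulmxA E3' -scalemxAl.
  have T2 : r *m q *m B *m S^T = - (p * a) *: (r *m r^T).
    by rewrite -2!mulmxA (mulmxA q) E3'' -scalemxAr.
  have T3 : r *m q *m B *m (q^T *m r^T) = (a - p * a * p) *: (r *m r^T).
    by rewrite -(mulmxA r q) -mulmxA (mulmxA (q *m B)) E1' mul_scalar_mx -scalemxAr.
  have -> : S'^T = S^T - (p - e)^-1 *: (q^T *m r^T).
    by rewrite linearB linearZ /= trmx_mul.
  rewrite /S' mulmxBr !mulmxBl E4'.
  rewrite -!scalemxAr -!scalemxAl T1 T2 T3 !scalerA.
  rewrite -[RHS]addr0 -!addrA; congr (_ + _).
  rewrite -!scalerBl -!scaleNr -!scalerDl; apply/eqP; rewrite scaler_eq0.
  apply/orP; left; apply/eqP.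
  have -> : a - p * a * p = (e ^+ 2 - p ^+ 2) * a by rewrite e2; ring.
  by field.
have uS : S' \in unitmx.
  by move: uA; rewrite -S'E !unitmx_mul => /andP[/andP[]].
by exists S', (invmx S'); rewrite mulmxV ?mulVmx.
Qed.

End Splitting.

(** * Witt cancellation and anisotropic parts *)

Section WittTheory.
Variables (K : fieldType) (K2 : 2%N \notin [pchar K]).
Implicit Types phi psi theta : qform K.
Local Notation W := (witt K2).

Let two0 : 2 != 0 :> K := two_neq0 K2.

Lemma dim0_isometric phi psi : qdim phi = 0 -> isometric (dsum phi psi) psi.
Proof. by case: phi => n A sA uA /= n0; subst n; apply: dsum0. Qed.

Lemma witt_cancel theta phi psi :
  isometric (dsum theta phi) (dsum theta psi) -> isometric phi psi.
Proof.
elim/(qform_ind K2): theta => [theta t0 i|c theta' theta c0 it IH i].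
  apply: isom_trans (isom_sym (dim0_isometric phi t0)) _.
  exact: isom_trans i (dim0_isometric psi t0).
apply: IH; apply: (@cancel_line _ K2 _ _ _ _ (nz c)); first exact: nz_neq0.
- by rewrite dsum_unit !gram_unit.
- by rewrite dsum_unit !gram_unit.
- exact: (gram_sym (qsum theta' psi)).
have E (f : qform K) : isometric (dsum theta f)
    (dsum ((nz c)%:M : 'M_1) (dsum theta' f)).
  apply: isom_trans (isom_dsum it (isom_refl _)) _.
  exact: isom_sym (dsumA _ _ _).
apply: isom_trans (isom_sym (E phi)) _.
exact: isom_trans i (E psi).
Qed.

Lemma qhyp_sym k : (hypmx K k)^T = hypmx K k.
Proof. by rewrite /hypmx tr_block_mx !trmx0 trmx1. Qed.
Lemma qhyp_unit k : hypmx K k \in unitmx.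
Proof.
suff /mulmx1_unit[] : hypmx K k *m hypmx K k = 1%:M by [].
by rewrite /hypmx mulmx_block !(mulmx0, mul0mx, mulmx1, addr0, add0r)
  -scalar_mx_block.
Qed.
Definition qhyp k := QForm (qhyp_sym k) (qhyp_unit k).

Lemma witt_isometric_hyp phi psi k : witt_equiv phi psi ->
  qdim psi = (qdim phi + (k + k))%N -> isometric psi (dsum phi (hypmx K k)).
Proof.
case=> i [j h] dE; have iE := isometric_dim h.
have {}iE : i = (k + j)%N by rewrite dE in iE; lia.
subst i.
apply: (@witt_cancel (qhyp j) psi (qsum phi (qhyp k))).
apply: isom_trans (dsumC _ _) _; apply: isom_trans (dsumC _ _).
apply: isom_trans (isom_sym h) _; exact: hyp_add.
Qed.

Lemma witt_isometric phi psi :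
  witt_equiv phi psi -> qdim phi = qdim psi -> isometric phi psi.
Proof.
move=> h dE; apply: isom_sym.
have dE0 : qdim psi = (qdim phi + (0 + 0))%N by rewrite dE !addn0.
apply: isom_trans (witt_isometric_hyp h dE0) _.
apply: isom_trans (dsumC _ _) _.
exact: (@dim0_isometric (qhyp 0) phi erefl).
Qed.

Lemma hyp_isotropic k : (0 < k)%N -> isotropic (hypmx K k).
Proof.
case: k => // k _; exists (row_mx (const_mx 1) 0).
  rewrite -row_mx0; apply/negP => /eqP/eq_row_mx[/matrixP/(_ 0 0)].
  by rewrite !mxE => /eqP; rewrite oner_eq0.
rewrite /qval /hypmx mul_row_block tr_row_mx mul_row_col.
by rewrite !mulmx0 !mul0mx !addr0 trmx0 mulmx0 mul0mx addr0 mxE.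
Qed.

Lemma witt_class_zeroP phi :
  witt_class K2 phi = 0 <-> hyperbolic phi.
Proof.
have zE : witt_class K2 (qzero K) = 0 by [].
split=> [h|[k h]]; last first.
  rewrite -zE; apply/witt_classP; exists 0, k => /=.
  apply: isom_trans (dsumC _ _) _.
  apply: isom_trans (@dim0_isometric (qhyp 0) phi erefl) _.
  exact: isom_trans h (isom_sym (dsum0 _ _)).
move: h; rewrite -zE => /witt_classP h; case: (h) => i [j /isometric_dim /= dE].
have kE : qdim phi = (qdim (qzero K) + ((j - i) + (j - i)))%N by rewrite /=; lia.
exists (j - i)%N; apply: isom_trans (dsum0 _ _).
exact: witt_isometric_hyp (witt_sym h) kE.
Qed.

Lemma witt_class_eq_isometric phi psi : witt_class K2 phi = witt_class K2 psi ->
  qdim phi = qdim psi -> isometric phi psi.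
Proof. by move=> /witt_classP; apply: witt_isometric. Qed.

Lemma isometric_class phi psi :
  isometric phi psi -> witt_class K2 phi = witt_class K2 psi.
Proof. by move=> h; apply/witt_classP/isom_witt. Qed.

Lemma class_eq_isotropic phi psi : witt_class K2 phi = witt_class K2 psi ->
  (qdim phi < qdim psi)%N -> isotropic psi.
Proof.
move=> /witt_classP h lt; case: (h) => i [j /isometric_dim dE].
have [k k0 kE] : exists2 k, (0 < k)%N & qdim psi = (qdim phi + (k + k))%N.
  by exists (i - j)%N; lia.
apply: isotropic_isometric (isom_sym (witt_isometric_hyp h kE)) _.
exact/isotropic_dsumr/hyp_isotropic.
Qed.

Lemma class0_isotropic phi : witt_class K2 phi = 0 -> (0 < qdim phi)%N ->
  isotropic phi.
Proof. by move=> h lt; apply: (@class_eq_isotropic (qzero K)). Qed.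

(** An isotropic vector [v] and some [w] pairing to [1] with it span a
    hyperbolic plane, whose vectors $tv+w$ already take every value. *)
Lemma isotropic_universal phi c : isotropic phi -> represents phi c.
Proof.
case=> v v0 qv; have [w vw] : exists w : 'rV_(qdim phi), (v *m phi *m w^T) 0 0 = 1.
  have x0 : v *m phi != 0.
    apply: contra_neq v0 => /(congr1 (mulmx^~ (invmx phi))).
    by rewrite mul0mx -mulmxA mulmxV ?gram_unit // mulmx1.
  have /rV0Pn[i xi] := x0; exists (((v *m phi) 0 i)^-1 *: delta_mx 0 i).
  rewrite linearZ /= -scalemxAr trmx_delta -colE.
  by move: (v *m phi) xi => x xi; rewrite !mxE mulVf.
exists (((c - qval phi w) / 2) *: v + w).
rewrite (qval_polar _ _ (gram_sym _)) qvalZ qv mulr0 add0r -!scalemxAl mxE vw mulr1.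
by rewrite [2 * _]mulrC divfK // addrC subrK.
Qed.

Definition wline a : W := witt_class K2 (qline a).

Lemma class_sum phi psi :
  witt_class K2 (qsum phi psi) = witt_class K2 phi + witt_class K2 psi.
Proof. by rewrite -witt_addE. Qed.

Lemma class_tens phi psi :
  witt_class K2 (qtens phi psi) = witt_class K2 phi * witt_class K2 psi.
Proof. by rewrite -witt_mulE. Qed.

Lemma tens_line n (A : 'M[K]_n) a : isometric ((a%:M : 'M_1) *t A) (a *: A).
Proof.
apply: (isom_reindex (u := @mxtens_index 1 n \o pair ord0) (v := id)).
- apply: bij_comp; first exact: bij_mxtens.
  by exists snd => // -[i j]; rewrite (ord1 i).
- exact: bij_id.
by move=> x y; rewrite /= tensmxE !mxE mulr1n.
Qed.

Lemma class_scale a phi :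
  witt_class K2 (qscale a phi) = wline a * witt_class K2 phi.
Proof.
by rewrite -class_tens; apply/isometric_class/isom_sym/tens_line.
Qed.

Lemma wline1 : wline 1 = 1.
Proof.
have -> : 1 = witt_class K2 (qone K) :> W by [].
by apply: isometric_class; rewrite /= nzE ?oner_neq0 //; apply: isom_refl.
Qed.

Lemma wlineM a b : a != 0 -> b != 0 -> wline (a * b) = wline a * wline b.
Proof.
move=> a0 b0; rewrite -class_scale; apply: isometric_class => /=.
by rewrite !nzE ?mulf_neq0 // scale_scalar_mx; apply: isom_refl.
Qed.

Lemma wline_sqr a : a != 0 -> wline (a ^+ 2) = 1.
Proof.
move=> a0; rewrite -wline1; apply: isometric_class => /=.
rewrite !nzE ?expf_neq0 ?oner_neq0 //; exists a%:M, a^-1%:M.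
by rewrite tr_scalar_mx -!scalar_mxM mulfV // mulVf // mulr1 -expr2.
Qed.

Lemma wlineMsqr a b : a != 0 -> b != 0 -> wline (a * b ^+ 2) = wline a.
Proof. by move=> a0 b0; rewrite wlineM ?expf_neq0 // wline_sqr // mulr1. Qed.

Lemma wlineK a : a != 0 -> wline a * wline a = 1.
Proof. by move=> a0; rewrite -wlineM // -expr2 wline_sqr. Qed.

Lemma wlineN a : a != 0 -> wline (- a) = - wline a.
Proof.
move=> a0; have -> : - wline a = witt_opp (wline a) by [].
rewrite witt_opp_classE; apply: isometric_class => /=.
rewrite !nzE ?oppr_eq0 //.
rewrite -(raddfN (@scalar_mx K 1)); exact: isom_refl.
Qed.

Lemma wlineD a b : a != 0 -> b != 0 -> a + b != 0 ->
  wline a + wline b = wline (a + b) + wline (a * b * (a + b)).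
Proof.
move=> a0 b0 ab0; rewrite -!class_sum; apply/esym/isometric_class => /=.
rewrite !nzE ?mulf_neq0 //.
exists (block_mx 1%:M 1%:M (- b)%:M a%:M).
exists (block_mx (a / (a + b))%:M (- (a + b)^-1)%:M (b / (a + b))%:M (a + b)^-1%:M).
rewrite /dsum tr_block_mx !tr_scalar_mx !mulmx_block !mulmx0.
rewrite !(addr0, add0r) -!scalar_mxM -!raddfD /= !scalar_mx_block.
have B (x y z t x' t' : K) : x = x' -> y = 0 -> z = 0 -> t = t' ->
    block_mx x%:M y%:M z%:M t%:M = block_mx x'%:M 0 0 t'%:M :> 'M_(1 + 1).
  by move=> -> -> -> ->; rewrite raddf0.
by split; [apply: B | apply: B | apply/esym/B]; field.
Qed.

Lemma class_split phi c : c != 0 -> represents phi c ->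
  exists psi, witt_class K2 phi = wline c + witt_class K2 psi /\
              qdim phi = (qdim psi).+1.
Proof.
move=> c0 /(qsplit c0)[psi i]; exists psi; split.
  by rewrite -class_sum; apply: isometric_class.
by rewrite (isometric_dim i).
Qed.

Lemma represents_class phi psi c : witt_class K2 phi = witt_class K2 psi ->
  qdim phi = qdim psi -> represents phi c -> represents psi c.
Proof.
by move=> h dE; apply: represents_isometric; apply: witt_class_eq_isometric.
Qed.

Lemma witt_ind (P : W -> Prop) : P 0 ->
  (forall c x, c != 0 -> P x -> P (wline c + x)) -> forall x, P x.
Proof.
move=> P0 PS; elim/witt_classW=> phi; elim/(qform_ind K2): phi => [phi d0|].
  have -> : witt_class K2 phi = 0; last by [].
  apply/witt_class_zeroP; exists 0.
  by case: phi d0 => n A sA uA /= n0; subst n; exists 1%:M, 1%:M;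
    split; apply/matrixP=> -[].
by move=> c psi phi c0 /isometric_class->; rewrite class_sum; apply: PS.
Qed.

Lemma represents_qline (c x : K) : c != 0 ->
  represents (qline c) x <-> exists t, x = c * t ^+ 2.
Proof. by move=> c0; rewrite represents1 nzE. Qed.

Lemma anisotropic_part phi : exists psi,
  [/\ witt_class K2 psi = witt_class K2 phi, ~ isotropic psi
    & (qdim psi <= qdim phi)%N].
Proof.
have [n] := ubnP (qdim phi); elim: n phi => // n IH phi lt.
have [iso|ani] := EM (isotropic phi); last by exists phi.
have [psi [pE dE]] := class_split (oner_neq0 K) (isotropic_universal 1 iso).
have [psi' [pE' dE']] : exists psi', witt_class K2 psi = wline (-1) + witt_class K2 psi' /\
    qdim psi = (qdim psi').+1.
  apply: class_split; first by rewrite oppr_eq0 oner_neq0.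
  have i : isometric phi (qsum (qline 1) psi).
    by apply: witt_class_eq_isometric; rewrite ?class_sum // dE.
  case: (isotropic_dsum (isotropic_isometric i iso)) => [[v v0]||[c [c0]]].
  - rewrite [v]mx11_scalar /= nzE ?oner_neq0 // qval1 mul1r => /eqP.
    rewrite expf_eq0 /= => /eqP ve; case/eqP: v0.
    by rewrite [v]mx11_scalar ve raddf0.
  - exact: isotropic_universal.
  case/(represents_qline _ (oner_neq0 K))=> t cE rc.
  have t0 : t != 0 by apply: contraNneq c0 => t0; rewrite cE t0 expr0n mulr0.
  have := represents_sqr t^-1 rc; rewrite cE mul1r mulrN -exprMn mulVf // expr1n.
  by [].
have [|chi [cE ani cd]] := IH psi'; first by rewrite dE dE' in lt; lia.
exists chi; split=> //; last by rewrite dE dE'; lia.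
by rewrite cE pE pE' wlineN ?oner_neq0 // addNKr.
Qed.

End WittTheory.

(** * Pfister forms *)

Section PfisterForms.
Variables (K : fieldType) (K2 : 2%N \notin [pchar K]).
Implicit Types (s t sigma alpha beta : seq K).
Local Notation W := (witt K2).
Local Notation wline := (wline K2).

(** The class of $\langle\langle a\rangle\rangle=\langle 1,-a\rangle$; in this sign convention
    $\langle\langle y,s\rangle\rangle=0$ for the nonzero values $y$ of
    $\langle\langle s\rangle\rangle$. *)
Definition wpf (a : K) : W := 1 - wline a.

Definition pf s : W := \prod_(a <- s) wpf a.

Fixpoint pfq s : qform K :=
  if s is a :: s' then qsum (pfq s') (qscale (- a) (pfq s')) else qline 1.

Definition nzs s := all (fun a => a != 0) s.

Lemma pf_nil : pf [::] = 1.
Proof. by rewrite /pf big_nil. Qed.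

Lemma pf_cons a s : pf (a :: s) = wpf a * pf s.
Proof. by rewrite /pf big_cons. Qed.

Lemma pf_cat s t : pf (s ++ t) = pf s * pf t.
Proof. by rewrite /pf big_cat. Qed.

Lemma class_pfq s : nzs s -> witt_class K2 (pfq s) = pf s.
Proof.
elim: s => [|a s IH] /=; first by rewrite pf_nil -(wline1 K2).
case/andP=> a0 /IH{}IH.
rewrite class_sum class_scale wlineN // pf_cons /wpf IH; ring.
Qed.

Lemma qdim_pfq s : qdim (pfq s) = (2 ^ size s)%N.
Proof. by elim: s => //= a s ->; rewrite expnS mul2n addnn. Qed.

Lemma qdim_pfq_gt0 s : (0 < qdim (pfq s))%N.
Proof. by rewrite qdim_pfq expn_gt0. Qed.

Lemma represents_pfq_cons a s c : a != 0 -> represents (pfq (a :: s)) c <->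
  exists p q, [/\ represents (pfq s) p, represents (pfq s) q & c = p - a * q].
Proof.
move=> a0; rewrite represents_dsum; split=> [[p [q [rp]]]|[p [q [rp rq ->]]]].
  rewrite represents_scale nzE ?oppr_eq0 // => -[q' rq -> ->].
  by exists p, q'; rewrite mulNr.
exists p, (- a * q); split; rewrite ?mulNr //.
by rewrite represents_scale nzE ?oppr_eq0 //; exists q; rewrite ?mulNr.
Qed.

Lemma wpf1 : wpf 1 = 0.
Proof. by rewrite /wpf wline1 subrr. Qed.

Lemma wpfN1 : wpf (-1) = 2.
Proof. by rewrite /wpf wlineN ?oner_neq0 // wline1 opprK. Qed.

Lemma wpf_mul_self a : a != 0 -> wpf a * wpf a = 2 * wpf a.
Proof.
move=> a0; transitivity (1 - 2 * wline a + wline a * wline a); first by rewrite /wpf; ring.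
by rewrite wlineK // /wpf; ring.
Qed.

Lemma wpf_mul_opp a : a != 0 -> wpf a * wpf (- a) = 0.
Proof.
move=> a0; rewrite /wpf wlineN //.
by transitivity (1 - wline a * wline a); [ring | rewrite wlineK // subrr].
Qed.

Lemma wpf_add_opp a : a != 0 -> wpf a + wpf (- a) = 2.
Proof. by move=> a0; rewrite /wpf wlineN //; ring. Qed.

Lemma wpf_mulD a b : a != 0 -> b != 0 -> a + b != 0 ->
  wpf a * wpf b = wpf (a + b) * wpf (- (a * b)).
Proof.
move=> a0 b0 ab0; have := wlineD K2 a0 b0 ab0.
rewrite !wlineM ?mulf_neq0 // => E.
rewrite /wpf wlineN ?mulf_neq0 // wlineM //.
transitivity (1 - (wline a + wline b) + wline a * wline b); first by ring.
by rewrite E; ring.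
Qed.

(** A similarity factor of a form may be absorbed in a slot next to it. *)
Lemma wpf_round x q (P : W) : x != 0 -> q != 0 -> wline q * P = P ->
  wpf (x * q) * P = wpf x * P.
Proof.
move=> x0 q0 E; rewrite /wpf wlineM // !mulrBl; congr (_ - _).
by rewrite -mulrA E.
Qed.

(** Roundness is inherited from $\langle\langle s\rangle\rangle$ by
    $\langle\langle a,s\rangle\rangle$: for $y=p-aq$ with $p,q$ values of
    $\langle\langle s\rangle\rangle$, both are similarity factors of it, and
    $\langle p,-aq\rangle\simeq y\langle 1,-apq\rangle$. *)
Lemma pf_round s y : nzs s -> y != 0 -> represents (pfq s) y ->
  wline y * pf s = pf s.
Proof.
elim: s y => [|a s IH] y /=.
  move=> _ y0; rewrite (represents_qline _ (oner_neq0 K)) => -[t].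
  rewrite mul1r => yE; rewrite yE wline_sqr ?mul1r //.
  by apply: contraNneq y0 => t0; rewrite yE t0 expr0n.
case/andP=> a0 ns y0; rewrite -/(pfq (a :: s)) represents_pfq_cons //.
case=> p [q [rp rq yE]]; rewrite !pf_cons.
have [q0|q0] := eqVneq q 0.
  have py : p = y by rewrite yE q0 mulr0 subr0.
  by subst p; rewrite mulrCA IH.
have aq0 : a * q != 0 by rewrite mulf_neq0.
have [p0|p0] := eqVneq p 0.
  rewrite yE p0 sub0r wlineN // wlineM //; have Eq := IH q ns q0 rq.
  transitivity (- wline a * wpf a * (wline q * pf s)); first by ring.
  rewrite Eq /wpf.
  transitivity ((wline a * wline a - wline a) * pf s); first by ring.
  by rewrite wlineK.
have E : wline p + wline (- (a * q)) = wline y + wline (- (a * q) * p * y).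
  rewrite yE wlineD ?oppr_eq0 ?mulf_neq0 // -?yE //.
  by congr (_ + wline _); rewrite mulrC; ring.
have := IH p ns p0 rp; have := IH q ns q0 rq; move: (pf s) => P Eq Ep.
have E1 : wpf a * P = (wline p + wline (- (a * q))) * P.
  rewrite wlineN // wlineM // /wpf; apply: esym.
  transitivity (wline p * P - wline a * (wline q * P)); first by ring.
  by rewrite Ep Eq; ring.
have E2 : (wline y + wline (- (a * q) * p * y)) * P = wline y * (wpf a * P).
  rewrite !mulNr wlineN ?mulf_neq0 // !wlineM ?mulf_neq0 // /wpf.
  transitivity (wline y * P - wline a * wline y * (wline q * (wline p * P))); first by ring.
  by rewrite Ep Eq; ring.
by rewrite -E2 -E -E1.
Qed.

(** If $\langle\langle s\rangle\rangle$ is anisotropic and $\langle\langle a,s\rangle\rangle$ is not,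
    then $p=aq$ for nonzero values $p,q$ of $\langle\langle s\rangle\rangle$, so $a$ is a
    similarity factor of it. *)
Lemma isotropic_pf0 s : nzs s -> isotropic (pfq s) -> pf s = 0.
Proof.
elim: s => [_ [v v0]|a s IH /= /andP[a0 ns]].
  rewrite [v]mx11_scalar /= nzE ?oner_neq0 // qval1 mul1r => /eqP.
  rewrite expf_eq0 /= => /eqP ve; case/eqP: v0.
  by rewrite [v]mx11_scalar ve raddf0.
rewrite pf_cons => /isotropic_dsum[/IH-> //||].
- by rewrite mulr0.
- case=> v v0; rewrite qval_scale => /eqP; rewrite mulf_eq0 (negPf (nz_neq0 _)).
  by move=> /eqP qv; rewrite IH ?mulr0 //; exists v.
case=> c [c0 rc] /represents_scale[q rq]; rewrite nzE ?oppr_eq0 // mulNr.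
move=> /oppr_inj cE; have q0 : q != 0.
  by apply: contraNneq c0 => q0; rewrite cE q0 mulr0.
have := pf_round ns c0 rc; rewrite cE wlineM // -mulrA (pf_round ns q0 rq) => E.
by rewrite /wpf mulrBl E mul1r subrr.
Qed.

Lemma represents_wpf0 s y : nzs s -> y != 0 -> represents (pfq s) y ->
  pf (y :: s) = 0.
Proof.
by move=> ns y0 ry; rewrite pf_cons /wpf mulrBl mul1r pf_round // subrr.
Qed.

Lemma represents_pfq1 s : nzs s -> represents (pfq s) 1.
Proof.
elim: s => [_|a s IH /= /andP[a0 ns]].
  by apply/(represents_qline _ (oner_neq0 K)); exists 1; rewrite expr1n mulr1.
apply/represents_dsum; exists 1, 0; split; [exact: IH | exact: represents0 |].
by rewrite addr0.
Qed.

(** A form $\tau$ with $\langle\langle\alpha,\sigma\rangle\rangle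
    =\langle\langle\sigma\rangle\rangle\perp\tau$: the pure part relative to
    $\sigma$. *)
Fixpoint pureq sigma alpha : qform K :=
  if alpha is x :: alpha' then
    qsum (pureq sigma alpha') (qscale (- x) (pfq (alpha' ++ sigma)))
  else qzero K.

Lemma nzs_cat s t : nzs (s ++ t) = nzs s && nzs t.
Proof. exact: all_cat. Qed.

Lemma class_pureq sigma alpha : nzs (alpha ++ sigma) ->
  witt_class K2 (pureq sigma alpha) = pf (alpha ++ sigma) - pf sigma.
Proof.
elim: alpha => [_|x alpha IH /= /andP[x0 na]]; first by rewrite subrr.
rewrite class_sum class_scale IH // class_pfq // wlineN // pf_cons /wpf; ring.
Qed.

Lemma qdim_pureq sigma alpha :
  (qdim (pureq sigma alpha) + 2 ^ size sigma = 2 ^ size (alpha ++ sigma))%N.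
Proof.
elim: alpha => [|x alpha IH] //=.
by rewrite qdim_pfq expnS -IH; lia.
Qed.

(** The pure subform theorem relative to $\sigma$.  In the step, $y=p-xq$ with $q$ a value of
    $\langle\langle\alpha,\sigma\rangle\rangle$ and $p$ one of its pure part: roundness turns the
    slot $x$ into $xq$, induction makes $-p$ a slot, and
    $\langle\langle -p,xq\rangle\rangle=\langle\langle -p+xq,pxq\rangle\rangle$, where
    $-p+xq=-y$. *)
Lemma pure_subform sigma alpha y : nzs (alpha ++ sigma) -> y != 0 ->
  represents (pureq sigma alpha) y ->
  exists beta, [/\ nzs beta, (size beta).+1 = size alpha &
    pf (alpha ++ sigma) = pf (- y :: beta ++ sigma)].
Proof.
elim: alpha y => [|x alpha IH] y.
  move=> _ y0 [v]; rewrite [v]thinmx0 qval0 => /eqP.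
  by rewrite eq_sym (negPf y0).
rewrite [_ ++ _]/= => /= /andP[x0 na] y0.
case/represents_dsum=> p [r [rp /represents_scale[q rq rE] yE]].
move: rE; rewrite nzE ?oppr_eq0 // mulNr => rE; subst r.
have nas : nzs alpha by move: na; rewrite nzs_cat => /andP[].
have [q0|q0] := eqVneq q 0.
  have py : p = y by rewrite yE q0 mulr0 subr0.
  subst p; have [beta [nb sb E]] := IH y na y0 rp.
  exists (x :: beta); split; rewrite /= ?x0 ?nb ?sb //.
  by rewrite pf_cons E !pf_cons mulrCA.
have xq0 : x * q != 0 by rewrite mulf_neq0.
have Eq : wpf (x * q) * pf (alpha ++ sigma) = wpf x * pf (alpha ++ sigma).
  by apply: wpf_round; rewrite ?pf_round.
have [p0|p0] := eqVneq p 0.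
  by exists alpha; rewrite yE p0 sub0r opprK !pf_cons Eq.
have [beta [nb sb E]] := IH p na p0 rp.
exists (- (- p * (x * q)) :: beta); split; rewrite /= ?sb //.
  by rewrite nb !oppr_eq0 mulf_neq0 // oppr_eq0.
have yE' : - p + x * q = - y by rewrite yE opprB addrC.
rewrite pf_cons -Eq E !pf_cons mulrCA !(mulrA (wpf _)); congr (_ * _).
by rewrite wpf_mulD ?yE' ?oppr_eq0.
Qed.

End PfisterForms.

(** * Base change, transfer and the norm principle for quadratic extensions *)

Section BaseChange.
Variables (F E : fieldType) (j : {rmorphism F -> E}).
Variables (K2 : 2%N \notin [pchar F]) (L2 : 2%N \notin [pchar E]).
Implicit Types phi psi : qform F.

Lemma qmap_sym phi : (map_mx j phi)^T = map_mx j phi.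
Proof. by rewrite map_trmx gram_sym. Qed.
Lemma qmap_unit phi : map_mx j phi \in unitmx.
Proof. by rewrite map_unitmx gram_unit. Qed.
Definition qmap phi := QForm (qmap_sym phi) (qmap_unit phi).

Lemma isometric_map m n (A : 'M[F]_m) (B : 'M[F]_n) :
  isometric A B -> isometric (map_mx j A) (map_mx j B).
Proof.
case=> P [Q [PQ QP ->]]; exists (map_mx j P), (map_mx j Q).
by rewrite -!map_mxM PQ QP !map_mx1 map_trmx !map_mxM.
Qed.

Lemma map_hyp k : map_mx j (hypmx F k) = hypmx E k.
Proof. by rewrite /hypmx map_block_mx !map_mx0 map_mx1. Qed.

Lemma map_dsum m n (A : 'M[F]_m) (B : 'M[F]_n) :
  map_mx j (dsum A B) = dsum (map_mx j A) (map_mx j B).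
Proof. by rewrite /dsum map_block_mx !map_mx0. Qed.

Lemma class_map phi psi : witt_class K2 phi = witt_class K2 psi ->
  witt_class L2 (qmap phi) = witt_class L2 (qmap psi).
Proof.
move=> /witt_classP[k [l /isometric_map]]; rewrite !map_dsum !map_hyp => h.
by apply/witt_classP; exists k, l.
Qed.

Definition wres (x : witt K2) : witt L2 := witt_class L2 (qmap (repr x)).

Lemma wres_class phi : wres (witt_class K2 phi) = witt_class L2 (qmap phi).
Proof. by apply: class_map; rewrite /witt_class reprK. Qed.

Lemma wresD x y : wres (x + y) = wres x + wres y.
Proof.
elim/witt_classW: x => x; elim/witt_classW: y => y.
rewrite -class_sum !wres_class -class_sum; apply: isometric_class => /=.
by rewrite map_dsum; apply: isom_refl.
Qed.

Lemma wresM x y : wres (x * y) = wres x * wres y.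
Proof.
elim/witt_classW: x => x; elim/witt_classW: y => y.
rewrite -class_tens !wres_class -class_tens; apply: isometric_class => /=.
by rewrite map_mxT; apply: isom_refl.
Qed.

Lemma wres0 : wres 0 = 0.
Proof. by apply: (addrI (wres 0)); rewrite -wresD !addr0. Qed.

Lemma wresN x : wres (- x) = - wres x.
Proof. by apply/eqP; rewrite -addr_eq0 -wresD addNr wres0. Qed.

Lemma wres_wline a : a != 0 -> wres (wline K2 a) = wline L2 (j a).
Proof.
move=> a0; rewrite wres_class; apply: isometric_class => /=.
by rewrite map_scalar_mx /= !nzE ?fmorph_eq0 //; apply: isom_refl.
Qed.

Lemma wres1 : wres 1 = 1.
Proof. by rewrite -(wline1 K2) wres_wline ?oner_neq0 // rmorph1 wline1. Qed.

Lemma wres_wpf a : a != 0 -> wres (wpf K2 a) = wpf L2 (j a).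
Proof. by move=> a0; rewrite /wpf wresD wresN wres1 wres_wline. Qed.

Lemma nzs_map s : nzs (map j s) = nzs s.
Proof. by rewrite /nzs all_map; apply: eq_all => a /=; rewrite fmorph_eq0. Qed.

Lemma wres_pf s : nzs s -> wres (pf K2 s) = pf L2 (map j s).
Proof.
elim: s => [|a s IH] /=; first by rewrite !pf_nil wres1.
by case/andP=> a0 ns; rewrite !pf_cons wresM wres_wpf ?IH.
Qed.

End BaseChange.

(** The extension $E=F(\sqrt d)$ for a nonsquare $d$.  An embedding in place of an algebra
    structure lets one field be quadratic over several subfields at once. *)
Definition quadratic (F E : fieldType) (j : {rmorphism F -> E}) (d : F) (r : E) :=
  [/\ r ^+ 2 = j d, forall z, exists u v, z = j u + j v * r &
      forall u v, j u + j v * r = 0 -> u = 0 /\ v = 0].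

Section Quadratic.
Variables (F E : fieldType) (j : {rmorphism F -> E}) (d : F) (r : E).
Hypothesis Q : quadratic j d r.
Variables (K2 : 2%N \notin [pchar F]) (L2 : 2%N \notin [pchar E]).

Let rr : r * r = j d. Proof. by case: Q; rewrite expr2. Qed.

Lemma quadratic_inj u v u' v' :
  j u + j v * r = j u' + j v' * r -> u = u' /\ v = v'.
Proof.
case: Q => _ _ inj /eqP; rewrite -subr_eq0 => /eqP h.
have [] : u - u' = 0 /\ v - v' = 0.
  by apply: inj; rewrite -h !rmorphB; ring.
by move=> /eqP + /eqP; rewrite !subr_eq0 => /eqP-> /eqP->.
Qed.

Lemma quadratic_norm_neq0 u v : j u + j v * r != 0 -> u ^+ 2 - d * v ^+ 2 != 0.
Proof.
move=> z0; apply: contra_neq z0 => N0.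
have : (j u + j v * r) * (j u + j (- v) * r) = 0.
  transitivity (j (u ^+ 2 - d * v ^+ 2)); last by rewrite N0 rmorph0.
  rewrite rmorphB !rmorphM /= -rr rmorphN; ring.
move/eqP; rewrite mulf_eq0 => /orP[/eqP//|/eqP].
case: Q => _ _ inj /inj[-> /eqP]; rewrite oppr_eq0 => /eqP->.
by rewrite !rmorph0 mul0r addr0.
Qed.

(** The transfer of $z\varphi_E$, $z=u+vr$, along the $F$-linear functional
    $E\to F$ taking the coefficient of $r$. *)
Definition transfer n (A : 'M[F]_n) u v : 'M[F]_(n + n) :=
  block_mx (v *: A) (u *: A) (u *: A) ((d * v) *: A).

Lemma transfer_isometric n (A : 'M[F]_n) u v : v != 0 ->
  isometric (transfer A u v)
    (dsum (v *: A) ((- (u ^+ 2 - d * v ^+ 2) * v) *: A)).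
Proof.
move=> v0; pose P : 'M[F]_(n + n) := block_mx 1%:M 0 (u / v)%:M v^-1%:M.
have PK : P *m block_mx 1%:M 0 (- u)%:M v%:M = 1%:M.
  rewrite mulmx_block !(mul0mx, mulmx0, addr0, add0r, mul1mx, mulmx1).
  rewrite -!scalar_mxM -raddfD /= mulVf //.
  have -> : u / v + v^-1 * - u = 0 by rewrite mulrN mulrC subrr.
  by rewrite raddf0 -scalar_mx_block.
exists P, (block_mx 1%:M 0 (- u)%:M v%:M); split=> //; first exact: mulmx1C PK.
rewrite /P /dsum /transfer tr_block_mx !mulmx_block !tr_scalar_mx trmx0.
rewrite !(mul0mx, mulmx0, addr0, add0r, mul1mx, mulmx1).
rewrite !mul_mx_scalar !mul_scalar_mx !scalerA -scalerDl.
by congr block_mx; congr (_ *: _); field.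
Qed.

Lemma transfer_sym (phi : qform F) u v :
  (transfer phi u v)^T = transfer (phi : 'M_(qdim phi)) u v.
Proof. by rewrite /transfer tr_block_mx !linearZ /= !gram_sym. Qed.

Section ClassTransfer.
Variables (phi : qform F) (u v : F).
Hypotheses (v0 : v != 0) (N0 : u ^+ 2 - d * v ^+ 2 != 0).

Lemma transfer_unit : transfer (phi : 'M_(qdim phi)) u v \in unitmx.
Proof.
apply: isometric_unit (isom_sym (transfer_isometric _ _ v0)) _.
by rewrite dsum_unit !unitmxZ ?gram_unit // unitfE ?mulf_neq0 ?oppr_eq0.
Qed.

Definition qtransfer := QForm (transfer_sym phi u v) transfer_unit.

Lemma class_transfer : witt_class K2 qtransfer =
  wline K2 v * ((1 - wline K2 (u ^+ 2 - d * v ^+ 2)) * witt_class K2 phi).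
Proof.
have -> : witt_class K2 qtransfer = witt_class K2
    (qsum (qscale v phi) (qscale (- (u ^+ 2 - d * v ^+ 2) * v) phi)).
  apply: isometric_class => /=; rewrite !nzE ?mulf_neq0 ?oppr_eq0 //.
  exact: transfer_isometric.
rewrite class_sum !class_scale wlineM ?oppr_eq0 // wlineN //; ring.
Qed.

End ClassTransfer.

Lemma qval_quadratic n (A : 'M[F]_n) a b : A^T = A ->
  qval (map_mx j A) (map_mx j a + r *: map_mx j b) =
    j (qval A a + d * qval A b) + j (2 * (a *m A *m b^T) 0 0) * r.
Proof.
move=> sA; rewrite qval_polar ?map_trmx ?sA // qvalZ.
have qj (w : 'rV_n) : qval (map_mx j A) (map_mx j w) = j (qval A w).
  by rewrite /qval map_trmx -!map_mxM mxE.
have -> : (map_mx j a *m map_mx j A *m (r *: map_mx j b)^T) 0 0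
    = r * j ((a *m A *m b^T) 0 0).
  by rewrite linearZ /= -scalemxAr map_trmx -!map_mxM !mxE.
rewrite !qj; move: (qval A a) (qval A b) (_ 0 0) => x y z.
rewrite !(rmorph_nat, rmorphD, rmorphM) /= -rr; ring.
Qed.

(** At an isotropic vector of the transfer, $z\varphi_E$ takes a value in $F$. *)
Lemma qval_transfer n (A : 'M[F]_n) u v a b : A^T = A ->
  exists f, (j u + j v * r) * qval (map_mx j A) (map_mx j a + r *: map_mx j b)
            = j f + j (qval (transfer A u v) (row_mx a b)) * r.
Proof.
move=> sA; exists (u * (qval A a + d * qval A b) + 2 * d * v * (a *m A *m b^T) 0 0).
rewrite qval_quadratic //.
have -> : qval (transfer A u v) (row_mx a b) =
    v * (qval A a + d * qval A b) + 2 * u * (a *m A *m b^T) 0 0.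
  have baE : b *m A *m a^T = (a *m A *m b^T)^T.
    by rewrite !trmx_mul trmxK sA mulmxA.
  rewrite /qval /transfer mul_row_block tr_row_mx mul_row_col.
  rewrite -!scalemxAr !mulmxDl -!scalemxAl baE.
  move: (a *m A *m a^T) (a *m A *m b^T) (b *m A *m b^T) => x y z.
  by rewrite !mxE; ring.
move: (qval A a) (qval A b) (_ 0 0) => x y z.
rewrite !(rmorph_nat, rmorphD, rmorphM) /= -rr; ring.
Qed.

Lemma quadratic_mx_inj m n (X Y X' Y' : 'M[F]_(m, n)) :
  map_mx j X + r *: map_mx j Y = map_mx j X' + r *: map_mx j Y' ->
  X = X' /\ Y = Y'.
Proof.
move=> h; suff S i k : X i k = X' i k /\ Y i k = Y' i k.
  by split; apply/matrixP=> i k; case: (S i k).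
apply: quadratic_inj; have := congr1 (fun M : 'M_(m, n) => M i k) h.
by rewrite !mxE ![r * _]mulrC.
Qed.

Lemma quadratic_mx m n (Z : 'M[E]_(m, n)) : exists X Y,
  Z = map_mx j X + r *: map_mx j Y.
Proof.
have [z|c cE] := @boolp.choice _ _ (fun z (c : F * F) => z = j c.1 + j c.2 * r).
  by case: Q => _ /(_ z)[u [v ->]] _; exists (u, v).
exists (map_mx (fun z => (c z).1) Z), (map_mx (fun z => (c z).2) Z).
by apply/matrixP=> i k; rewrite !mxE mulrC -cE.
Qed.

(** Over $F$ the underlying space of $\varphi_E$ is $V\oplus rV$, and the transfer of
    $\varphi_E$ itself is hyperbolic.  The isometry $z\varphi_E\simeq\varphi_E$, split
    into its two components over $F$, makes the transfer of $z\varphi_E$ hyperbolic too, and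
    this is $v(\varphi\perp-\mathsf N(z)\varphi)$. *)
Lemma norm_principle (phi : qform F) u v : j u + j v * r != 0 ->
  wline L2 (j u + j v * r) * witt_class L2 (qmap j phi) = witt_class L2 (qmap j phi) ->
  wline K2 (u ^+ 2 - d * v ^+ 2) * witt_class K2 phi = witt_class K2 phi.
Proof.
move=> z0; rewrite -class_scale => zE; have N0 := quadratic_norm_neq0 z0.
have [v0|v0] := eqVneq v 0.
  subst v; rewrite expr0n mulr0 subr0 wline_sqr ?mul1r //.
  by apply: contraNneq z0 => ->; rewrite !rmorph0 mul0r addr0.
have [|P [_ [_ _]]] := witt_class_eq_isometric zE; first by [].
have [P0 [P1 ->]] := quadratic_mx P; rewrite /= nzE //.
set A : 'M_(qdim phi) := phi => PE.
have [uE vE] : u *: A = P0 *m A *m P0^T + d *: (P1 *m A *m P1^T) /\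
    v *: A = P0 *m A *m P1^T + P1 *m A *m P0^T.
  apply: quadratic_mx_inj.
  transitivity ((j u + j v * r) *: map_mx j A).
    by rewrite scalerDl !map_mxZ scalerA [r * _]mulrC.
  rewrite PE.
  have -> : (map_mx j P0 + r *: map_mx j P1)^T = map_mx j P0^T + r *: map_mx j P1^T.
    by rewrite linearD linearZ /= !map_trmx.
  rewrite mulmxDr !mulmxDl -!scalemxAr -!scalemxAl -!map_mxM.
  rewrite !map_mxD map_mxZ scalerA rr scalerDr.
  rewrite -!addrA; congr (_ + _); rewrite addrCA [RHS]addrCA; congr (_ + _).
  exact: addrC.
have PdT : (d *: P1)^T = d *: P1^T by rewrite linearZ.
have TE : transfer A u v = block_mx P0 P1 (d *: P1) P0 *m block_mx 0 A A 0
    *m (block_mx P0 P1 (d *: P1) P0)^T.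
  rewrite /transfer tr_block_mx PdT !mulmx_block !mulmx0 !(add0r, addr0).
  rewrite -!scalemxAl -!scalemxAr -scalerA vE uE scalerDr.
  by congr block_mx; rewrite // addrC.
have uT := transfer_unit phi v0 N0.
have T0 : witt_class K2 (qtransfer phi v0 N0) = 0.
  apply/witt_class_zeroP; exists (qdim phi).
  apply: isom_trans (hyp_block (gram_sym phi) (gram_unit phi)).
  move: uT; rewrite /= TE !unitmx_mul => /andP[/andP[uM _] _].
  set M := block_mx P0 _ _ _ in uM *.
  by exists M, (invmx M); rewrite mulmxV // mulVmx.
move: T0; rewrite class_transfer => /(congr1 (fun x => wline K2 v * x)).
rewrite mulr0 mulrA wlineK // mul1r mulrBl mul1r => /eqP.
by rewrite subr_eq0 => /eqP.
Qed.

End Quadratic.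

(** * Vanishing of the powers of the fundamental ideal goes up *)

(** $\mathsf I^mF=0$: the $m$-fold Pfister forms generate this ideal. *)
Definition vanish m (F : fieldType) : Prop :=
  forall (K2 : 2%N \notin [pchar F]) s, size s = m -> nzs s -> pf K2 s = 0.

Lemma vanishS m F : vanish m F -> vanish m.+1 F.
Proof.
by move=> V K2 [//|a s] [sm] /andP[_ ns]; rewrite pf_cons V ?mulr0.
Qed.

Section GoingUp.
Variables (F E : fieldType) (j : {rmorphism F -> E}) (d : F) (r : E).
Hypothesis Q : quadratic j d r.
Variables (K2 : 2%N \notin [pchar F]) (L2 : 2%N \notin [pchar E]).

(** If $\langle\langle e,b\rangle\rangle$ is hyperbolic for every $b\in F$, then every
    $x\in E$ lies in $F\cdot D(\langle\langle e\rangle\rangle_E)$, because the transfer of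
    $x\langle\langle e\rangle\rangle_E$ is isotropic. *)
Lemma vanish_one_slot e x : nzs e -> x != 0 ->
  (forall b, b != 0 -> pf K2 (b :: e) = 0) -> pf L2 (x :: map j e) = 0.
Proof.
move=> ne x0 V; have [_ /(_ x)[u [v xE]] inj] := Q.
have base b : b != 0 -> pf L2 (j b :: map j e) = 0.
  by move=> b0; rewrite -(wres_pf j K2 L2 (s := b :: e)) /= ?b0 // V // wres0.
have [v0|v0] := eqVneq v 0.
  have xu : x = j u by rewrite xE v0 rmorph0 mul0r addr0.
  by rewrite xu; apply: base; rewrite -(fmorph_eq0 j) -xu.
have N0 : u ^+ 2 - d * v ^+ 2 != 0 by apply: (quadratic_norm_neq0 Q); rewrite -xE.
have T0 : witt_class K2 (qtransfer (pfq e) v0 N0) = 0.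
  by rewrite class_transfer class_pfq // -pf_cons V // mulr0.
have [|w w0 qw] := class0_isotropic T0; first by rewrite /= addn_gt0 qdim_pfq_gt0.
rewrite -[w]hsubmxK in w0 qw; set a := lsubmx w in w0 qw; set b := rsubmx w in w0 qw.
have [f] := qval_transfer Q u v a b (gram_sym (pfq e)).
rewrite -xE /= in qw *; rewrite qw rmorph0 mul0r addr0.
set ab := map_mx j a + _; set y := qval _ ab => fE.
have iso : isometric (qmap j (pfq e)) (pfq (map j e)).
  apply: (@witt_class_eq_isometric _ L2).
    by rewrite -(wres_class j K2) !class_pfq ?nzs_map ?wres_pf.
  by rewrite /= !qdim_pfq size_map.
have ab0 : ab != 0.
  apply: contra_neq w0 => ab0.
  have [|-> ->] := @quadratic_mx_inj _ _ _ _ _ Q _ _ a b 0 0; last by rewrite row_mx0.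
  by rewrite !map_mx0 scaler0 addr0.
have nje : nzs (map j e) by rewrite nzs_map.
have [y0|y0] := eqVneq y 0.
  rewrite pf_cons (isotropic_pf0 L2 nje) ?mulr0 //.
  by apply: isotropic_isometric iso _; exists ab.
have Py : wline L2 y * pf L2 (map j e) = pf L2 (map j e).
  by apply: pf_round => //; apply: represents_isometric iso _; exists ab.
have f0 : f != 0 by rewrite -(fmorph_eq0 j) -fE mulf_neq0.
by rewrite pf_cons -(wpf_round x0 y0 Py) fE -pf_cons base.
Qed.

(** Slots outside $F$ are eliminated two at a time.  Two such slots $x,y$ satisfy a linear
    relation over $F$ with right hand side in $F$; unless $x/y\in F$, this means $x=\alpha x'$,
    $y=\beta y'$ with $\alpha,\beta\in F$ and $x'+y'=1$.  Expanding
    $\langle\langle\alpha x'\rangle\rangle=\langle\langle\alpha\rangle\rangle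
    +\langle\alpha\rangle\langle\langle x'\rangle\rangle$ and the same for $y$ leaves terms
    with at least one slot more in $F$, and $\langle\langle x',y'\rangle\rangle=0$. *)
Lemma vanish_quadratic m : vanish m.+1 F -> vanish m.+1 E.
Proof.
move=> V L2'; rewrite (bool_irrelevance L2' L2).
suff main k s e : (size s <= k)%N -> (size s + size e)%N = m.+1 -> nzs s -> nzs e ->
    pf L2 (s ++ map j e) = 0.
  by move=> s sm ns; have := main (size s) s [::] (leqnn _);
    rewrite /= cats0 addn0; apply.
elim: k s e => [|k IH] s e.
  rewrite leqn0 size_eq0 => /eqP-> /= em _ ne.
  by rewrite -(wres_pf j K2 L2) // V // wres0.
case: s => [|x [|y s]] //= sk sm; first by move=> ns ne; apply: (IH [::]).
  rewrite add1n in sm; case: sm => sm /andP[x0 _] ne; apply: vanish_one_slot => //.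
  by move=> b b0; apply: V; rewrite /= ?sm ?b0.
case/and3P=> x0 y0 ns ne.
have drop z t : size t = size s -> nzs t -> z != 0 -> forall a, a != 0 ->
    wpf L2 (j a) * wpf L2 z * pf L2 (t ++ map j e) = 0.
  move=> tE nt z0 a a0; have H : pf L2 ((z :: t) ++ map j (a :: e)) = 0.
    by apply: IH; rewrite /= ?z0 ?a0 ?tE //; move: sk sm; clear; lia.
  by rewrite pf_cat -[RHS]H pf_cat !pf_cons; ring.
rewrite !pf_cons mulrA; move: (drop) => /(_ _ s erefl ns) {}drop.
have wsc a z : a != 0 -> z != 0 -> wpf L2 (j a * z) = wpf L2 (j a) + wline L2 (j a) * wpf L2 z.
  by move=> a0 z0; rewrite /wpf wlineM ?fmorph_eq0 //; ring.
have [_ cE _] := Q; have [x1 [x2 xE]] := cE x; have [y1 [y2 yE]] := cE y.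
have [x20|x20] := eqVneq x2 0.
  rewrite x20 rmorph0 mul0r addr0 in xE; rewrite xE; apply: drop => //.
  by rewrite -(fmorph_eq0 j) -xE.
have [y20|y20] := eqVneq y2 0.
  rewrite y20 rmorph0 mul0r addr0 in yE; rewrite [wpf _ x * _]mulrC yE; apply: drop => //.
  by rewrite -(fmorph_eq0 j) -yE.
pose g := y2 * x1 - x2 * y1.
have gE : j y2 * x - j x2 * y = j g.
  by rewrite xE yE rmorphB !rmorphM /=; ring.
have [g0|g0] := eqVneq g 0.
  have xy : x = j (x2 / y2) * y.
    apply: (mulfI (x := j y2)); first by rewrite fmorph_eq0.
    rewrite mulrA -rmorphM /= [y2 * _]mulrC divfK //.
    by apply/eqP; rewrite -subr_eq0 gE g0 rmorph0.
  have l0 : x2 / y2 != 0 by rewrite mulf_neq0 ?invr_eq0.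
  rewrite -[RHS](drop y y0 (- (x2 / y2))) ?oppr_eq0 //; congr (_ * _).
  rewrite xy /wpf rmorphN wlineN ?fmorph_eq0 // wlineM ?fmorph_eq0 //.
  move: (wline _ _) (wline _ y) (wlineK L2 y0) => A Y YY.
  transitivity (1 - Y - A * Y + A * (Y * Y)); first by ring.
  by rewrite YY; ring.
have a0 : g / y2 != 0 by rewrite mulf_neq0 ?invr_eq0.
have b0 : - (g / x2) != 0 by rewrite oppr_eq0 mulf_neq0 ?invr_eq0.
pose x' := j (y2 / g) * x; pose y' := j (- (x2 / g)) * y.
have x'0 : x' != 0 by rewrite mulf_neq0 ?fmorph_eq0 // mulf_neq0 ?invr_eq0.
have y'0 : y' != 0.
  by rewrite mulf_neq0 ?fmorph_eq0 // oppr_eq0 mulf_neq0 ?invr_eq0.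
have xx' : x = j (g / y2) * x'.
  by rewrite mulrA -rmorphM /= mulrA divfK // mulfV // rmorph1 mul1r.
have yy' : y = j (- (g / x2)) * y'.
  by rewrite mulrA -rmorphM /= mulrNN mulrA divfK // mulfV // rmorph1 mul1r.
have xy1 : x' + y' = 1.
  transitivity (j g^-1 * (j y2 * x - j x2 * y)).
    by rewrite /x' /y' rmorphN !rmorphM /=; ring.
  by rewrite gE -rmorphM /= mulVf // rmorph1.
have XY : wpf L2 x' * wpf L2 y' = 0.
  by rewrite wpf_mulD ?xy1 ?oner_neq0 // wpf1 mul0r.
have AB : wpf L2 (j (g / y2)) * wpf L2 (j (- (g / x2))) * pf L2 (s ++ map j e) = 0.
  have H : pf L2 (s ++ map j (g / y2 :: - (g / x2) :: e)) = 0.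
    by apply: IH; rewrite /= ?a0 ?b0 //; move: sk sm; clear; lia.
  by rewrite pf_cat -[RHS]H pf_cat !pf_cons; ring.
have D1 := drop x' x'0 _ b0; have D2 := drop y' y'0 _ a0.
rewrite xx' yy' (wsc _ x') // (wsc _ y') //.
move: AB XY D1 D2; rewrite -!mulrA.
move: (wpf _ x') (wpf _ y') (wpf _ (j _)) (wpf _ (j _)) (wline _ _) (wline _ _) (pf _ _).
move=> X Y B A b a P AB XY D1 D2.
transitivity (A * (B * P) + b * (A * (Y * P)) + a * (B * (X * P)) + a * b * P * (X * Y)).
  by ring.
by rewrite AB XY D1 D2; ring.
Qed.

End GoingUp.

(** * Pfister forms over a field with I^(n+1)F(i) = 0 *)

(** $\mathsf I^{n+1}F(\sqrt{-1})=0$, where $F(\sqrt{-1})$ is $F$ itself if $-1$ is a square. *)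
Definition good n (F : fieldType) : Prop :=
  (exists2 t : F, t ^+ 2 = -1 & vanish n.+1 F) \/
  (exists (E : fieldType) (j : {rmorphism F -> E}) (i : E),
     quadratic j (-1) i /\ vanish n.+1 E).

Lemma goodS n F : good n F -> good n.+1 F.
Proof.
case=> [[t tE /vanishS V]|[E [j [i [q /vanishS V]]]]]; first by left; exists t.
by right; exists E, j, i.
Qed.

Section Torsion.
Variables (F : fieldType) (K2 : 2%N \notin [pchar F]).
Implicit Types s t sigma alpha beta : seq F.
Local Notation pf := (pf K2).
Local Notation wpf := (wpf K2).
Local Notation wline := (wline K2).

Lemma pf_split1 s : nzs s ->
  isometric (pfq s) (qsum (qline 1) (pureq [::] s)).
Proof.
move=> ns; apply: (@witt_class_eq_isometric _ K2); last first.
  by have /= := qdim_pureq K2 [::] s; rewrite qdim_pfq cats0 => <-; rewrite addnC.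
rewrite class_sum class_pfq // class_pureq ?cats0 // pf_nil.
by rewrite -[witt_class _ _]/(wline 1) wline1 addrC subrK.
Qed.

(** Since $2\pi=0$, the form $\pi$ represents $-1$, so its pure part
    represents $-(1+x^2)$ for some $x$ and $\pi=\langle\langle 1+x^2,\beta\rangle\rangle$; as
    $1+x^2=\mathsf N(1+x\sqrt{-1})$, the norm principle applies to
    $\langle\langle\beta\rangle\rangle$, of which every element of $F(\sqrt{-1})^\times$ is a
    similarity factor over $F(\sqrt{-1})$. *)
Lemma double_pf_eq0 n s : good n F -> size s = n.+1 -> nzs s ->
  2 * pf s = 0 -> pf s = 0.
Proof.
move=> [[t _ V] sn ns _|[E [j [i [q V]]]] sn ns s0]; first exact: V.
have L2 : 2%N \notin [pchar E] by rewrite (fmorph_pchar j).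
have N1 : (-1 : F) != 0 by rewrite oppr_eq0 oner_neq0.
have rN1 : represents (pfq s) (-1).
  apply: (@represents_class _ K2 (qscale (-1) (pfq s))) => //.
    rewrite class_scale class_pfq // wlineN ?oner_neq0 // wline1 mulN1r.
    by apply/eqP; rewrite eq_sym -addr_eq0 -mulr2n -mulr_natl s0.
  apply/represents_scale; exists 1; first exact: represents_pfq1.
  by rewrite nzE // mulr1.
have /represents_dsum[p [y [/(represents_qline _ (oner_neq0 F))[x ->] ry yE]]] :=
  represents_isometric (pf_split1 ns) rN1.
rewrite mul1r in yE; have {}yE : y = - (1 + x ^+ 2).
  by apply: (addrI (x ^+ 2)); rewrite -yE; ring.
have [i2 _ inj] := q.
have y0 : y != 0.
  rewrite yE oppr_eq0; apply/eqP => x2; have : (j x + i) * (j x - i) = 0.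
    transitivity (j (1 + x ^+ 2) - 1 - i ^+ 2).
      by rewrite rmorphD rmorph1 rmorphXn /=; ring.
    by rewrite x2 i2 rmorphN rmorph1 rmorph0; ring.
  move/eqP; rewrite mulf_eq0 => /orP[] /eqP h.
    have [|_ /eqP] := inj x 1; first by rewrite rmorph1 mul1r.
    by rewrite oner_eq0.
  have [|_ /eqP] := inj x (-1); first by rewrite rmorphN rmorph1 mulN1r.
  by rewrite oppr_eq0 oner_eq0.
have [beta [nb sb]] := pure_subform (sigma := [::]) (alpha := s) K2
  (etrans (congr1 _ (cats0 s)) ns) y0 ry.
rewrite !cats0 yE opprK => ->.
have z0 : j 1 + j x * i != 0.
  by apply/eqP => /inj[/eqP]; rewrite oner_eq0.
have := norm_principle q K2 (L2 := L2) (phi := pfq beta) z0.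
rewrite -(wres_class j K2) !class_pfq // wres_pf //.
rewrite expr1n mulN1r opprK pf_cons /wpf mulrBl mul1r => -> //; first by rewrite subrr.
have := V L2 ((j 1 + j x * i) :: map j beta).
rewrite /= size_map sb sn z0 nzs_map nb pf_cons mulrBl mul1r => /(_ erefl isT) /eqP.
by rewrite subr_eq0 => /eqP.
Qed.

Lemma double_pf_eq0_ge n s : good n F -> (n < size s)%N -> nzs s ->
  2 * pf s = 0 -> pf s = 0.
Proof.
move=> G lt; apply: (@double_pf_eq0 (size s).-1); last by rewrite prednK // (leq_ltn_trans _ lt).
have [k ->] : exists k, (size s).-1 = (n + k)%N by exists ((size s).-1 - n)%N; lia.
by elim: k => [|k IH]; rewrite ?addn0 // addnS; apply: goodS.
Qed.

(** If $\pi$ is anisotropic, then its becoming hyperbolic over $F(\sqrt{-1})$ means that it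
    takes one value $c$ on two orthogonal vectors; after scaling by $c$, its pure part
    represents $1$, which makes $-1$ a slot. *)
Lemma pf_halve n s : (0 < n)%N -> good n F -> size s = n.+1 -> nzs s ->
  exists t, [/\ size t = n, nzs t & pf s = 2 * pf t].
Proof.
move=> n0 G sn ns.
have [s0|s0] := EM (pf s = 0).
  exists (nseq n 1); rewrite size_nseq s0; split=> //.
    by rewrite /nzs all_nseq oner_neq0 orbT.
  by case: (n) n0 => // k _; rewrite pf_cons wpf1 mul0r mulr0.
case: G => [[t _ V]|[E [j [i [q V]]]]]; first by case: s0; apply: V.
have L2 : 2%N \notin [pchar E] by rewrite (fmorph_pchar j).
have ani : ~ isotropic (pfq s) by move=> /(isotropic_pf0 K2 ns).
have [w w0 qw] : isotropic (qmap j (pfq s)).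
  apply: (@class0_isotropic _ L2); last exact: qdim_pfq_gt0.
  rewrite -(wres_class j K2) class_pfq // wres_pf //.
  by apply: V; rewrite ?size_map ?nzs_map.
have [a [b wE]] := quadratic_mx q w; rewrite wE in qw w0.
rewrite /= (qval_quadratic q) ?gram_sym // mulN1r in qw.
have [_ _ inj] := q; have [/eqP + /eqP] := inj _ _ qw.
rewrite subr_eq0 mulf_eq0 (negPf (two_neq0 K2)) => /eqP qab /eqP ab0.
set c := qval (pfq s) b in qab.
have c0 : c != 0.
  apply/eqP => c0; case: ani.
  have [b0|b0] := eqVneq b 0; last by exists b.
  exists a; last by rewrite qab.
  by apply: contra_neq w0 => a0; rewrite a0 b0 !map_mx0 scaler0 addr0.
have [psi [iso /(_ a)]] := qsplit_vector c0.
rewrite [_ *m b^T]mx11_scalar ab0 raddf0 qab => /(_ erefl) rc.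
have [chi [chiE chid]] := class_split K2 c0 rc.
have rb : represents (pfq s) c by exists b.
have sE : pf s = 1 + 1 + wline c * witt_class K2 chi.
  rewrite -(pf_round K2 ns c0 rb) -class_pfq // (isometric_class K2 iso) class_sum chiE.
  rewrite -/c -[witt_class _ (qline c)]/(wline c) !mulrDr wlineK //; ring.
have r1 : represents (pureq [::] s) 1.
  apply: (@represents_class _ K2 (qsum (qline 1) (qscale c chi))).
  - rewrite class_sum class_scale class_pureq ?cats0 // pf_nil sE.
    by rewrite -[witt_class _ (qline 1)]/(wline 1) wline1; ring.
  - have := isometric_dim iso; have /= := qdim_pureq K2 [::] s.
    rewrite cats0 chid qdim_pfq /=; lia.
  apply/represents_dsum; exists 1, 0; split; last by rewrite addr0.
    by apply/(represents_qline _ (oner_neq0 F)); exists 1; rewrite expr1n mulr1.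
  exact: represents0.
have [beta [nb sb]] := pure_subform (sigma := [::]) (alpha := s) K2
  (etrans (congr1 _ (cats0 s)) ns) (oner_neq0 F) r1.
rewrite !cats0 pf_cons wpfN1 => ->; exists beta; split=> //.
by apply: succn_inj; rewrite sb sn.
Qed.

End Torsion.

Section TorsionFree.
Variables (F : fieldType) (K2 : 2%N \notin [pchar F]) (n : nat).
Hypothesis G : good n F.
Implicit Types s t sigma alpha beta gamma : seq F.
Local Notation pf := (pf K2).
Local Notation wpf := (wpf K2).
Local Notation wline := (wline K2).

(** The element $1+p$ is a value of $2\langle\langle\sigma\rangle\rangle$, so
    $\langle\langle 1+p,\sigma\rangle\rangle$ is killed by $2$; it vanishes once it has been
    multiplied by enough slots for [double_pf_eq0] to apply. *)
Lemma succ_value_similarity sigma gamma p : nzs sigma -> nzs gamma ->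
  (n <= size gamma + size sigma)%N -> 1 + p != 0 -> represents (pfq sigma) p ->
  wline (1 + p) * pf (gamma ++ sigma) = pf (gamma ++ sigma).
Proof.
move=> ns ng lt w0 rp.
suff : pf (1 + p :: gamma ++ sigma) = 0.
  by rewrite pf_cons /wpf mulrBl mul1r => /eqP; rewrite subr_eq0 => /eqP.
have nN : nzs (-1 :: sigma) by rewrite /= oppr_eq0 oner_neq0.
apply: (double_pf_eq0_ge G).
- by rewrite /= size_cat.
- by rewrite /= w0 nzs_cat ng.
have : pf (1 + p :: -1 :: sigma) = 0.
  apply: represents_wpf0 => //.
  apply/represents_pfq_cons; first by rewrite oppr_eq0 oner_neq0.
  by exists 1, p; split; rewrite ?mulN1r ?opprK //; apply: represents_pfq1.
rewrite !pf_cons wpfN1 pf_cat => E.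
transitivity (pf gamma * (wpf (1 + p) * (2 * pf sigma))); first by ring.
by rewrite E mulr0.
Qed.

(** The two forms are made to share one more slot at each step.  If $\sigma$ is common and
    $x$ is a further slot of the first, then $-x=b+b'$ with $b,b'$ values of the relative
    pure part of the second; after making $-b$ a slot, $-x=b(1+p)+q$ where $p$ is a value of
    $\langle\langle\sigma\rangle\rangle$ and $q$ of the new relative pure part.  As $1+p$ is
    a similarity factor, $x$ becomes a slot of the second form as well. *)
Lemma double_pf_inj_aux k sigma alpha beta :
  size alpha = k -> size beta = k -> (n < k + size sigma)%N ->
  nzs (alpha ++ sigma) -> nzs (beta ++ sigma) ->
  2 * pf (alpha ++ sigma) = 2 * pf (beta ++ sigma) ->
  pf (alpha ++ sigma) = pf (beta ++ sigma).
Proof.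
elim: k sigma alpha beta => [|k IH] sigma alpha beta.
  by move=> /size0nil-> /size0nil->.
case: alpha => [//|x alpha] [sa] sb lt nxa nb E2.
have [x0 na] : x != 0 /\ nzs (alpha ++ sigma) by case/andP: (nxa).
have [nal ns] : nzs alpha /\ nzs sigma by move: na; rewrite nzs_cat => /andP.
suff [beta' [nb' sb' E]] : exists beta', [/\ nzs beta', size beta' = k &
    pf (beta ++ sigma) = pf (x :: beta' ++ sigma)].
  have mv gamma : pf (x :: gamma ++ sigma) = pf (gamma ++ x :: sigma).
    by rewrite !(pf_cons, pf_cat); ring.
  rewrite E [_ ++ _]/= !mv; apply: IH => //.
  - by rewrite /= addnS.
  - by rewrite nzs_cat nal /= x0.
  - by rewrite nzs_cat nb' /= x0.
  by rewrite -!mv -E -E2.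
set A := pureq sigma (x :: alpha); set B := pureq sigma beta.
have cA : witt_class K2 A = pf ((x :: alpha) ++ sigma) - pf sigma by rewrite class_pureq.
have cB : witt_class K2 B = pf (beta ++ sigma) - pf sigma by rewrite class_pureq.
have dAB : qdim A = qdim B.
  apply/eqP; rewrite -(eqn_add2r (2 ^ size sigma)) !(qdim_pureq K2) /=.
  by rewrite !size_cat sa sb addSn.
have rA : represents A (- x).
  apply/represents_dsum; exists 0, (- x); split; rewrite ?add0r //.
    exact: represents0.
  apply/represents_scale; exists 1; first exact: represents_pfq1.
  by rewrite nzE ?oppr_eq0 ?mulr1.
have [b [b2 [rb rb2 xE]]] : exists b b2,
    [/\ represents B b, represents B b2 & - x = b + b2].
  apply/represents_dsum; apply: (@represents_class _ K2 (qsum A A) (qsum B B)).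
  - rewrite (class_sum _ A A) (class_sum _ B B) cA cB.
    rewrite -[LHS]mulr2n -[RHS]mulr2n -[LHS]mulr_natl -[RHS]mulr_natl.
    by rewrite !mulrBr E2.
  - by rewrite -[LHS]/(qdim A + qdim A)%N dAB.
  apply/represents_dsum; exists (- x), 0; split; rewrite ?addr0 //.
  exact: represents0.
have Nx0 : - x != 0 by rewrite oppr_eq0.
have [b0|b0] := eqVneq b 0.
  move: rb2; rewrite -[b2]add0r -b0 -xE => rb2.
  have [beta' [nb' sb' E]] := pure_subform K2 nb Nx0 rb2.
  by exists beta'; rewrite E opprK; split=> //; apply: succn_inj; rewrite sb'.
have [beta2 [nb2 sb2 E]] := pure_subform K2 nb b0 rb.
have {}sb2 : size beta2 = k by apply: succn_inj; rewrite sb2.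
have Nb0 : - b != 0 by rewrite oppr_eq0.
set x1 := - b in E.
have nx1 : nzs (beta2 ++ x1 :: sigma) by rewrite nzs_cat nb2 /= Nb0.
have mvE gamma : pf (gamma ++ x1 :: sigma) = pf (x1 :: gamma ++ sigma).
  by rewrite !(pf_cons, pf_cat); ring.
have : represents (qsum (qscale b (pfq sigma)) (pureq (x1 :: sigma) beta2)) b2.
  apply: (represents_class (K2 := K2) _ _ rb2).
    rewrite class_sum class_scale class_pfq // cB class_pureq // E mvE pf_cons.
    by rewrite [pf (x1 :: sigma)]pf_cons /wpf /x1 wlineN //; ring.
  have := qdim_pureq K2 sigma beta; have := qdim_pureq K2 (x1 :: sigma) beta2.
  rewrite /= -/B !size_cat sb sb2 qdim_pfq /= addSn addnS !expnS.
  by move: (qdim _) (qdim _) (2 ^ _)%N (2 ^ _)%N; clear; lia.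
case/represents_dsum=> r [q [/represents_scale[p rp]]].
rewrite nzE // => -> rq b2E.
have {}xE : x = x1 * (1 + p) - q.
  by rewrite -[LHS]opprK xE b2E /x1; ring.
have [q0|q0] := eqVneq q 0.
  have w0 : 1 + p != 0.
    by apply: contra_neq x0 => w0; rewrite xE w0 q0 mulr0 subrr.
  exists beta2; split=> //; rewrite E !pf_cons xE q0 subr0.
  rewrite wpf_round //.
  by apply: succ_value_similarity => //; rewrite sb2 -ltnS -addSn.
have [beta3 [nb3 sb3 E3]] := pure_subform K2 nx1 q0 rq.
rewrite mvE in E3.
have [w0|w0] := eqVneq (1 + p) 0.
  exists (x1 :: beta3); rewrite /= Nb0 nb3 sb3 sb2; split=> //.
  by rewrite E E3 xE w0 mulr0 add0r !(pf_cons, pf_cat); ring.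
have x1w0 : x1 * (1 + p) != 0 by rewrite mulf_neq0.
exists (- (x1 * (1 + p) * - q) :: beta3); split.
- by rewrite /= oppr_eq0 mulf_neq0 ?oppr_eq0.
- by rewrite /= sb3.
have Nq0 : - q != 0 by rewrite oppr_eq0.
have Pw : wline (1 + p) * pf ((- q :: beta3) ++ sigma) = pf ((- q :: beta3) ++ sigma).
  apply: (succ_value_similarity ns _ _ w0 rp); first by rewrite /= Nq0.
  by rewrite /= sb3 sb2 -ltnS -addSn.
transitivity (wpf x1 * pf ((- q :: beta3) ++ sigma)).
  by rewrite E E3 [in RHS]pf_cons pf_cons mvE pf_cons mulrCA.
rewrite -(wpf_round Nb0 w0 Pw) /= !pf_cons !(mulrA (wpf _)); congr (_ * _).
by rewrite wpf_mulD // -?xE.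
Qed.

Lemma double_pf_inj s t : size s = size t -> (n < size s)%N -> nzs s -> nzs t ->
  2 * pf s = 2 * pf t -> pf s = pf t.
Proof.
move=> st lt ns nt E.
have := @double_pf_inj_aux (size s) [::] s t erefl (esym st).
by rewrite !cats0 addn0; apply.
Qed.

Lemma pow2_pf_inj k s t : size s = size t -> (n < size s)%N -> nzs s -> nzs t ->
  2 ^+ k * pf s = 2 ^+ k * pf t -> pf s = pf t.
Proof.
elim: k s t => [|k IH] s t st lt ns nt; first by rewrite !mul1r.
rewrite exprS -mulrA -[in RHS]mulrA; rewrite ![2 * _]mulrCA.
have D u : 2 * pf u = pf (-1 :: u) by rewrite pf_cons wpfN1.
rewrite !D => /IH h; apply: double_pf_inj => //; rewrite !D.
have N1 : (-1 : F) != 0 by rewrite oppr_eq0 oner_neq0.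
by apply: h; rewrite /= ?st ?N1 // -st; lia.
Qed.

Lemma pow2_pf_eq0 k s : (n < size s)%N -> nzs s -> 2 ^+ k * pf s = 0 -> pf s = 0.
Proof.
elim: k s => [|k IH] s lt ns; first by rewrite mul1r.
rewrite exprS -mulrA mulrCA => E; apply: (double_pf_eq0_ge G) => //.
have D : 2 * pf s = pf (-1 :: s) by rewrite pf_cons wpfN1.
by rewrite D in E *; apply: IH => //=; rewrite ?oppr_eq0 ?oner_neq0 //; lia.
Qed.

End TorsionFree.

(** * I^(n+1)F is torsion free *)

Section Combinations.
Variables (F : fieldType) (K2 : 2%N \notin [pchar F]).
Implicit Types s t : seq F.
Implicit Types (x y : witt K2) (l : seq (int * seq F)).
Local Notation pf := (pf K2).
Local Notation wpf := (wpf K2).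
Local Notation wline := (wline K2).

Definition pfcomb l : witt K2 := \sum_(p <- l) pf p.2 *~ p.1.

(** The ideal $\mathsf I^mF$ as an additive group; coefficients from the Witt ring are
    integral combinations of Pfister forms themselves and only raise the fold. *)
Definition inI m x := exists2 l,
  all (fun p => (m <= size p.2)%N && nzs p.2) l & x = pfcomb l.

Lemma inI_pf m s : (m <= size s)%N -> nzs s -> inI m (pf s).
Proof.
move=> sm ns; exists [:: (1, s)]; first by rewrite /= sm ns.
by rewrite /pfcomb big_seq1.
Qed.

Lemma inID m x y : inI m x -> inI m y -> inI m (x + y).
Proof.
case=> l al -> [k ak ->]; exists (l ++ k); first by rewrite all_cat al.
by rewrite /pfcomb big_cat.
Qed.

Lemma inIN m x : inI m x -> inI m (- x).
Proof.
case=> l al ->; exists [seq (- p.1, p.2) | p <- l]; first by rewrite all_map.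
by rewrite /pfcomb big_map -sumrN; apply: eq_bigr => p _; rewrite mulrNz.
Qed.

Lemma inI0 m : inI m 0.
Proof. by exists [::] => //; rewrite /pfcomb big_nil. Qed.

Lemma inIMz m x (c : int) : inI m x -> inI m (x *~ c).
Proof.
move=> ix; have N k : inI m (x *+ k).
  by elim: k => [|k IH]; [apply: inI0 | rewrite mulrS; apply: inID].
by case: c => k; [apply: N | rewrite NegzE mulrNz; apply/inIN/N].
Qed.

Lemma inI_sum m (I : Type) (r : seq I) (f : I -> witt K2) :
  (forall i, inI m (f i)) -> inI m (\sum_(i <- r) f i).
Proof. by move=> h; elim/big_rec: _ => [|i x _]; [apply: inI0 | apply: inID]. Qed.

Lemma inI_ind m (P : witt K2 -> Prop) :
  P 0 -> (forall x y, P x -> P y -> P (x + y)) -> (forall x, P x -> P (- x)) ->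
  (forall s, (m <= size s)%N -> nzs s -> P (pf s)) -> forall x, inI m x -> P x.
Proof.
move=> P0 PD PN Ppf x [l al ->]; elim: l al => [|[c s] l IH] /=.
  by rewrite /pfcomb big_nil.
case/andP=> /andP[sm ns] /IH{}IH; rewrite /pfcomb big_cons; apply: (PD) => //=.
have N k : P (pf s *+ k).
  by elim: k => [|k IHk] //; rewrite mulrS; apply: (PD) => //; apply: (Ppf).
by case: c => k; [apply: N | rewrite NegzE mulrNz; apply/PN/N].
Qed.

Lemma inIM m k x y : inI m x -> inI k y -> inI (m + k) (x * y).
Proof.
move=> ix iy; move: x ix; apply: inI_ind.
- by rewrite mul0r; apply: inI0.
- by move=> x x' ix ix'; rewrite mulrDl; apply: inID.
- by move=> x ix; rewrite mulNr; apply: inIN.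
move=> s sm ns; move: y iy; apply: inI_ind.
- by rewrite mulr0; apply: inI0.
- by move=> x x' ix ix'; rewrite mulrDr; apply: inID.
- by move=> x ix; rewrite mulrN; apply: inIN.
move=> t tk nt; rewrite -pf_cat; apply: inI_pf; last by rewrite nzs_cat ns.
by rewrite size_cat leq_add.
Qed.

Lemma inI_mem0 x : inI 0 x.
Proof.
elim/witt_ind: x => [|c x c0 ix]; first exact: inI0.
apply: inID ix; have -> : wline c = pf [::] - pf [:: c].
  by rewrite pf_cons pf_nil mulr1 opprB addrC subrK.
by apply: inID; [|apply: inIN]; apply: inI_pf => //=; rewrite c0.
Qed.

(** After subtracting $\dim\varphi$ times $\langle 1\rangle$ from $\varphi$ there
    remains a sum of forms $-\langle\langle c\rangle\rangle$, and what was subtracted is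
    a multiple of $2=\langle\langle -1\rangle\rangle$. *)
Lemma inI_fund x : fund_ideal x -> inI 1 x.
Proof.
case=> phi even ->.
have D (f : qform F) : inI 1 (witt_class K2 f - (qdim f)%:R).
  elim/(qform_ind K2): f => [f f0|c g f c0 i ig].
    have -> : witt_class K2 f = 0.
      apply/witt_class_zeroP; exists 0.
      by case: f f0 => n A sA uA /= n0; subst n; exists 1%:M, 1%:M;
        split; apply/matrixP=> -[].
    by rewrite f0 subrr; apply: inI0.
  rewrite (isometric_class K2 i) (isometric_dim i) class_sum /= natrD opprD addrACA.
  apply: inID => //; rewrite -opprB; apply: inIN.
  have -> : 1 - witt_class K2 (qline c) = pf [:: c] by rewrite pf_cons pf_nil mulr1.
  by apply: inI_pf => //=; rewrite c0.
rewrite -[witt_class _ _](subrK (qdim phi)%:R); apply: inID => //.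
rewrite -[qdim phi]odd_double_half (negPf even) add0n -mul2n mulrnA.
apply: (@inIMz 1 _ ((qdim phi)./2 : int)).
have -> : 2 = pf [:: -1] by rewrite pf_cons wpfN1 pf_nil mulr1.
by apply: inI_pf => //=; rewrite oppr_eq0 oner_neq0.
Qed.

Lemma inI_fund_power m x : fund_power m x -> inI m x.
Proof.
case=> k [c [y [Iy ->]]]; apply: inI_sum => i.
apply: (@inIM 0 m) (inI_mem0 _) _.
have {Iy} : forall j, inI 1 (y i j) by move=> j; apply/inI_fund/Iy.
elim: m {y} (y i) => [|m IH] z iz; first by rewrite big_ord0 -(pf_nil K2); apply: inI_pf.
by rewrite big_ord_recl; apply: (@inIM 1 m) => //; apply: IH.
Qed.

Fixpoint copies k (phi : qform F) : qform F :=
  if k is k'.+1 then qsum phi (copies k' phi) else qzero F.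

Lemma class_copies k phi : witt_class K2 (copies k phi) = witt_class K2 phi *+ k.
Proof. by elim: k => [|k IH] //=; rewrite class_sum IH mulrS. Qed.

Lemma qdim_copies k phi : qdim (copies k phi) = (k * qdim phi)%N.
Proof. by elim: k => [|k IH] //=; rewrite IH mulSn. Qed.

Lemma isotropic_copies k m phi : (k <= m)%N ->
  isotropic (copies k phi) -> isotropic (copies m phi).
Proof.
move=> /subnK <-; elim: (m - k)%N => [|d IH] // /IH ik.
by rewrite addSn; apply: isotropic_dsumr.
Qed.

Section Torsion.
Variable n : nat.
Hypotheses (n0 : (0 < n)%N) (G : good n F).

(** If $k\pi=0$, then the Pfister form $2^k\pi$ contains the isotropic $k\pi$, so it
    vanishes, and division by $2$ is possible. *)
Lemma pf_torsion s k : (n < size s)%N -> nzs s -> (0 < k)%N -> pf s *+ k = 0 ->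
  pf s = 0.
Proof.
move=> lt ns k0 E; apply: (pow2_pf_eq0 G (k := k)) => //.
have pE : 2 ^+ k * pf s = pf (nseq k (-1) ++ s).
  rewrite pf_cat; congr (_ * _); elim: (k) => [|m IH]; first by rewrite pf_nil.
  by rewrite pf_cons -IH wpfN1 exprS.
have nN : nzs (nseq k (-1) ++ s).
  by rewrite nzs_cat ns andbT /nzs all_nseq oppr_eq0 oner_neq0 orbT.
rewrite pE; apply: isotropic_pf0 => //.
have iso : isometric (copies (2 ^ k) (pfq s)) (pfq (nseq k (-1) ++ s)).
  apply: (@witt_class_eq_isometric _ K2).
    by rewrite class_copies !class_pfq // -pE -natrX mulr_natl.
  by rewrite qdim_copies !qdim_pfq size_cat size_nseq expnD.
apply: isotropic_isometric iso _.
apply: (@isotropic_copies k); first exact/ltnW/ltn_expl.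
apply: (@class0_isotropic _ K2); first by rewrite class_copies class_pfq.
by rewrite qdim_copies muln_gt0 k0 qdim_pfq_gt0.
Qed.

(** The Pfister form with slots $\pm f$, $f\in S$.  Its signature is $2^{|S|}$ at the orderings
    where all these slots are negative and $0$ at the others: up to that factor it is the
    indicator of a sign pattern. *)
Fixpoint atom (S : seq F) (e : bitseq) : witt K2 :=
  if S is f :: S' then
    wpf (if head true e then f else - f) * atom S' (behead e)
  else 1.

Fixpoint bits k : seq bitseq :=
  if k is k'.+1 then map (cons true) (bits k') ++ map (cons false) (bits k')
  else [:: [::]].

(** From $\pi=2\rho$ one gets
    $\pi=\langle\langle f\rangle\rangle\rho+\langle\langle -f\rangle\rangle\rho$; iterating over $S$
    writes $\pi$ as a sum of Pfister forms, one for each sign pattern on $S$. *)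
Lemma pf_refine (S : seq F) s : nzs S -> size s = n.+1 -> nzs s ->
  exists kappa : bitseq -> seq F,
    (forall e, [/\ size (kappa e) = n.+1, nzs (kappa e) &
       2 ^+ size S * pf (kappa e) = pf s * atom S e]) /\
    pf s = \sum_(e <- bits (size S)) pf (kappa e).
Proof.
elim: S s => [|f S IH] s /=.
  move=> _ sn ns; exists (fun=> s); split; last by rewrite big_seq1.
  by move=> e; rewrite mul1r mulr1.
case/andP=> f0 nS sn ns; have [t [tn nt sE]] := pf_halve K2 n0 G sn ns.
have [|//||k1 [k1P k1E]] := IH (f :: t); first by [].
- by rewrite /= tn.
- by rewrite /= f0.
have [|//||k2 [k2P k2E]] := IH (- f :: t); first by [].
- by rewrite /= tn.
- by rewrite /= oppr_eq0 f0.
exists (fun e => if head true e then k1 (behead e) else k2 (behead e)); split.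
  move=> e; case: (head true e).
    have [-> -> E] := k1P (behead e); split=> //.
    by rewrite exprS -mulrA E sE pf_cons; ring.
  have [-> -> E] := k2P (behead e); split=> //.
  by rewrite exprS -mulrA E sE pf_cons; ring.
rewrite big_cat !big_map /= -k1E -k2E !pf_cons -mulrDl wpf_add_opp //.
Qed.

Lemma wpf_atom (S : seq F) e a : nzs S -> a \in S ->
  wpf a * atom S e = 0 \/ wpf a * atom S e = 2 * atom S e.
Proof.
elim: S e => [|f S IH] e //= /andP[f0 nS]; rewrite inE => /orP[/eqP->|aS].
  rewrite !mulrA; case: (head true e); last by left; rewrite wpf_mul_opp // mul0r.
  by right; rewrite wpf_mul_self.
rewrite mulrCA [2 * _]mulrCA; case: (IH (behead e) nS aS) => ->; last by right.
by left; rewrite mulr0.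
Qed.

Lemma pf_atom (S : seq F) e s : nzs S -> {subset s <= S} ->
  pf s * atom S e = 0 \/ pf s * atom S e = 2 ^+ size s * atom S e.
Proof.
move=> nS; elim: s => [|a s IH] sub; first by right; rewrite pf_nil.
have [|E|E] := IH; first by move=> b bs; apply: sub; rewrite inE bs orbT.
  by left; rewrite pf_cons -mulrA E mulr0.
have aS : a \in S by apply: sub; rewrite mem_head.
rewrite pf_cons -mulrA E mulrCA; case: (wpf_atom e nS aS) => ->.
  by left; rewrite mulr0.
by right; rewrite /= exprSr mulrA.
Qed.

(** On each atom of the set of all slots, the Pfister forms of the combination become equal
    or vanish, so what is left there is an integral multiple of a single Pfister form, to
    which [pf_torsion] applies. *)
Lemma pfcomb_torsion_free l : all (fun p => (size p.2 == n.+1) && nzs p.2) l ->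
  2 * pfcomb l = 0 -> pfcomb l = 0.
Proof.
move=> al E0; pose S := flatten [seq p.2 | p <- l].
have nS : nzs S.
  apply/allP=> a /flatten_mapP[p pl]; have /andP[_ /allP np] := allP al p pl.
  exact: np.
have sub p : p \in l -> {subset p.2 <= S}.
  by move=> pl a ap; apply/flatten_mapP; exists p.
have K s : exists kappa : bitseq -> seq F, size s = n.+1 -> nzs s ->
    (forall e, [/\ size (kappa e) = n.+1, nzs (kappa e) &
       2 ^+ size S * pf (kappa e) = pf s * atom S e]) /\
    pf s = \sum_(e <- bits (size S)) pf (kappa e).
  have [[sn ns]|h] := EM (size s = n.+1 /\ nzs s).
    by have [k kP] := pf_refine nS sn ns; exists k.
  by exists (fun=> [::]) => sn ns; case: h.
have [k kP] := boolp.choice K.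
have lE : pfcomb l = \sum_(e <- bits (size S)) \sum_(p <- l) pf (k p.2 e) *~ p.1.
  rewrite exchange_big /=; apply: eq_big_seq => p pl.
  have /andP[/eqP sn ns] := allP al p pl.
  by rewrite {1}(kP _ sn ns).2 mulrz_suml.
rewrite lE big1_seq // => e _; set X := \sum_(p <- l) _.
pose q : witt K2 := 2 ^+ size S.
have XE : q * X = pfcomb l * atom S e.
  rewrite /X mulr_sumr mulr_suml; apply: eq_big_seq => p pl.
  have /andP[/eqP sn ns] := allP al p pl.
  have [_ _ E] := (kP _ sn ns).1 e.
  by rewrite mulrzAr E mulrzAl.
have X2 : X *+ (2 * 2 ^ size S) = 0.
  rewrite mulrnA -mulr_natl natrX -/q mulrnAr XE -mulr_natl mulrA.
  by rewrite E0 mul0r.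
have lt p : p \in l -> (n < size (k p.2 e))%N.
  move=> pl; have /andP[/eqP sn ns] := allP al p pl.
  by have [-> _ _] := (kP _ sn ns).1 e.
have [[p0 [p0l p00]]|none] := EM (exists p, p \in l /\ pf p.2 * atom S e <> 0); last first.
  rewrite /X big1_seq // => p /andP[_ pl]; have /andP[/eqP sn ns] := allP al p pl.
  have [_ nk E] := (kP _ sn ns).1 e.
  rewrite (pow2_pf_eq0 G (lt p pl) nk (k := size S)) ?mul0rz // E.
  by apply: contrapT => h; apply: none; exists p.
have /andP[/eqP sn0 ns0] := allP al p0 p0l.
have [sk0 nk0 E0'] := (kP _ sn0 ns0).1 e.
set kap := pf (k p0.2 e) in E0'.
have [c XkE] : exists c : int, X = kap *~ c.
  rewrite /X big_seq.
  elim/big_rec: _ => [|p x pl [c ->]]; first by exists 0; rewrite mulr0z.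
  have /andP[/eqP sn ns] := allP al p pl.
  have [sk nk E] := (kP _ sn ns).1 e.
  have [z|pE] := pf_atom e nS (sub p pl).
    exists c; rewrite (pow2_pf_eq0 G (lt p pl) nk (k := size S)) ?E //.
    by rewrite mul0rz add0r.
  have [z|p0E] := pf_atom e nS (sub p0 p0l); first by case: p00.
  exists (p.1 + c); rewrite mulrzDr; congr (_ *~ _ + _).
  apply: (pow2_pf_inj G (k := size S)) => //; rewrite ?sk ?sk0 //.
  by rewrite E E0' pE p0E sn sn0.
rewrite XkE; have [->|c0] := eqVneq c 0; first by rewrite mulr0z.
rewrite /kap (@pf_torsion _ (`|c| * (2 * 2 ^ size S))%N) ?mul0rz ?lt //.
  by rewrite !muln_gt0 expn_gt0 absz_gt0 c0.
move: X2; rewrite XkE -/kap; move: (2 * _)%N => N.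
case: (c) => m; first by rewrite mulrnA.
by rewrite NegzE mulrNz mulNrn mulrnA => /eqP; rewrite oppr_eq0 => /eqP.
Qed.

(** Halving lowers the fold of all the Pfister forms to exactly $n+1$. *)
Lemma inI_torsion_free x : inI n.+1 x -> 2 * x = 0 -> x = 0.
Proof.
suff P : inI n.+1 x -> exists2 l, all (fun p => (size p.2 == n.+1) && nzs p.2) l
    & x = pfcomb l.
  by move=> /P[l al ->]; apply: pfcomb_torsion_free.
move: x; apply: inI_ind.
- by exists [::] => //; rewrite /pfcomb big_nil.
- move=> x y [l al ->] [k ak ->]; exists (l ++ k); first by rewrite all_cat al.
  by rewrite /pfcomb big_cat.
- move=> x [l al ->]; exists [seq (- p.1, p.2) | p <- l]; first by rewrite all_map.
  by rewrite /pfcomb big_map -sumrN; apply: eq_bigr => p _; rewrite mulrNz.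
move=> s lt ns; have [k sE] : exists k, size s = (n + k).+1.
  by exists (size s - n.+1)%N; lia.
have [c [t [tn nt ->]]] : exists (c : nat) t, [/\ size t = n.+1, nzs t & pf s = pf t *+ c].
  clear lt; elim: k s sE ns => [|k IH] s sE ns.
    by exists 1%N, s; rewrite sE addn0.
  have Gk : good (n + k.+1) F.
    by elim: (k.+1) => [|m IHm]; rewrite ?addn0 // addnS; apply: goodS.
  have nk : (0 < n + k.+1)%N by rewrite addnS.
  have [t [tn nt ->]] := pf_halve K2 nk Gk sE ns.
  have [|c [t' [tn' nt' ->]]] := IH t _ nt; first by rewrite tn addnS.
  by exists (c * 2)%N, t'; rewrite mulr_natl mulrnA.
exists [:: (c%:Z, t)]; first by rewrite /= tn eqxx nt.
by rewrite /pfcomb big_seq1.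
Qed.

(** The form $\langle\langle b\rangle\rangle\varphi$ lies in the torsion free group
    $\mathsf I^{n+1}F$ and is killed by $2$. *)
Lemma torsion_similarity x b : inI n x -> 2 * x = 0 -> b != 0 -> wline b * x = x.
Proof.
move=> ix x2 b0; apply/eqP; rewrite eq_sym -subr_eq0 -[X in X - _]mul1r -mulrBl.
apply/eqP; apply: inI_torsion_free; last by rewrite mulrCA x2 mulr0.
rewrite -add1n; apply: inIM => //.
have -> : 1 - wline b = pf [:: b] by rewrite pf_cons pf_nil mulr1.
by apply: inI_pf => //=; rewrite b0.
Qed.

End Torsion.
End Combinations.

Lemma inI_res (F E : fieldType) (j : {rmorphism F -> E}) K2 L2 m (x : witt K2) :
  inI m x -> inI m (wres j L2 x).
Proof.
move: x; apply: inI_ind.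
- by rewrite wres0; apply: inI0.
- by move=> x y ix iy; rewrite wresD; apply: inID.
- by move=> x ix; rewrite wresN; apply: inIN.
by move=> s sm ns; rewrite wres_pf //; apply: inI_pf; rewrite ?size_map ?nzs_map.
Qed.

(** * Quadratic extensions *)

Lemma extend_morphism (F E F' : fieldType) (j : {rmorphism F -> E}) d r
    (h0 : {rmorphism F -> F'}) r' :
  quadratic j d r -> r' ^+ 2 = h0 d ->
  exists h : {rmorphism E -> F'}, (forall u v, h (j u + j v * r) = h0 u + h0 v * r').
Proof.
move=> Q r2'; have [r2 cE _] := Q.
have [z|c cP] := @boolp.choice _ _ (fun z (c : F * F) => z = j c.1 + j c.2 * r).
  by have [u [v ->]] := cE z; exists (u, v).
pose f z := h0 (c z).1 + h0 (c z).2 * r'.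
have fE u v : f (j u + j v * r) = h0 u + h0 v * r'.
  by rewrite /f; have [-> ->] := quadratic_inj Q (esym (cP (j u + j v * r))).
have fB : {morph f : x y / x - y}.
  move=> x y; rewrite {1}(cP x) {1}(cP y).
  have -> : j (c x).1 + j (c x).2 * r - (j (c y).1 + j (c y).2 * r)
      = j ((c x).1 - (c y).1) + j ((c x).2 - (c y).2) * r.
    by rewrite !rmorphB; ring.
  by rewrite fE /f !rmorphB; ring.
have fM : monoid_morphism f.
  split.
    have -> : 1 = j 1 + j 0 * r by rewrite rmorph1 rmorph0 mul0r addr0.
    by rewrite fE rmorph1 rmorph0 mul0r addr0.
  move=> x y; rewrite {1}(cP x) {1}(cP y) [in RHS]/f.
  move: (c x) (c y) => -[a b] -[a' b'] /=.
  have -> : (j a + j b * r) * (j a' + j b' * r)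
      = j (a * a' + d * b * b') + j (a * b' + b * a') * r.
    rewrite !rmorphD !rmorphM /= -r2; ring.
  rewrite fE !rmorphD !rmorphM /= -r2'; ring.
pose fB' := GRing.isZmodMorphism.Build _ _ f fB.
pose fM' := GRing.isMonoidMorphism.Build _ _ f fM.
by exists (HB.pack f fB' fM' : {rmorphism E -> F'}).
Qed.

Lemma sqrt_extension (M : fieldType) (d : M) : (forall x, x ^+ 2 != d) ->
  exists (L : fieldExtType M) (r : L), quadratic (in_alg L) d r.
Proof.
move=> nd; pose p := 'X^2 - d%:P.
have sp : size p = 3 by rewrite size_XnsubC.
have irr : irreducible_poly p.
  apply: cubic_irreducible; first by rewrite sp.
  by move=> x; rewrite /root !hornerE subr_eq0; apply: nd.
have [L dimL [r rr Lr]] := irredp_FAdjoin irr.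
exists L, r.
have r2 : r ^+ 2 = in_alg L d.
  move: rr; rewrite /root rmorphB /= map_polyXn map_polyC /= !hornerE subr_eq0.
  by move/eqP.
rewrite sp /= in dimL.
have rN1 : r \notin 1%VS.
  apply/negP => /vlineP[x xE]; have /negP[] := nd x; apply/eqP.
  apply: (fmorph_inj (in_alg L)); rewrite rmorphXn; apply: etrans r2.
  by rewrite xE.
have V2 : (1 + <[r]>)%VS = {:L}%VS.
  apply/eqP; rewrite eqEdim subvf dimL dimv_disjoint_sum ?dimv1 ?dim_vline.
    by case: eqP rN1 => // ->; rewrite mem0v.
  apply/eqP; rewrite -subv0; apply/subvP=> x; rewrite memv_cap => /andP[x1 /vlineP[k xE]].
  rewrite memv0 xE; have [->|k0] := eqVneq k 0; first by rewrite scale0r.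
  case/negP: rN1; rewrite -[r]scale1r -(mulVf k0) -scalerA -xE; exact: memvZ.
split=> //.
  move=> z; have : z \in (1 + <[r]>)%VS by rewrite V2 memvf.
  case/memv_addP=> x /vlineP[u ->] [y /vlineP[v ->] ->]; exists u, v.
  by rewrite /= mulr_algl.
move=> u v /eqP; rewrite /= mulr_algl addr_eq0 => /eqP uE.
have [v0|v0] := eqVneq v 0.
  rewrite v0 scale0r oppr0 in uE; split=> //; apply/eqP.
  by rewrite -(fmorph_eq0 (in_alg L)) /= uE.
case/negP: rN1; rewrite -[r]scale1r -(mulVf v0) -scalerA -[v *: r]opprK -uE.
by rewrite memvZ // memvN memvZ // mem1v.
Qed.

Lemma vanish_surj m (E F' : fieldType) (h : {rmorphism E -> F'}) :
  (forall z, exists x, z = h x) -> vanish m E -> vanish m F'.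
Proof.
move=> surj V L2 s sm ns; have E2 : 2%N \notin [pchar E] by rewrite -(fmorph_pchar h).
have [g gK] := boolp.choice surj.
have sE : s = map h (map g s).
  by rewrite -map_comp -[LHS]map_id; apply: eq_map => x /=; rewrite -gK.
rewrite sE nzs_map in ns *; rewrite -(wres_pf h E2) // V ?wres0 //.
by rewrite size_map.
Qed.

Lemma quadratic_nonsquare (F E : fieldType) (j : {rmorphism F -> E}) d r x :
  quadratic j d r -> x ^+ 2 != d.
Proof.
move=> [r2 _ inj]; apply/eqP => xd; have : (j x + r) * (j x - r) = 0.
  transitivity (j (x ^+ 2) - r ^+ 2); first by rewrite rmorphXn /=; ring.
  by rewrite xd r2 subrr.
move/eqP; rewrite mulf_eq0 => /orP[] /eqP h.
  have [|_ /eqP] := inj x 1; first by rewrite rmorph1 mul1r.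
  by rewrite oner_eq0.
have [|_ /eqP] := inj x (-1); first by rewrite rmorphN rmorph1 mulN1r.
by rewrite oppr_eq0 oner_eq0.
Qed.

(** If $-1$ becomes a square in $E$, then $E=F(\sqrt{-1})$; otherwise $E(\sqrt{-1})$ is a
    quadratic extension of $F(\sqrt{-1})$, generated by $r$. *)
Lemma good_quadratic n (F E : fieldType) (j : {rmorphism F -> E}) d r :
  2%N \notin [pchar F] -> quadratic j d r -> good n F -> good n E.
Proof.
move=> K2 Q; have L2 : 2%N \notin [pchar E] by rewrite (fmorph_pchar j).
case=> [[t t2 V]|[E0 [k [i [q V]]]]].
  left; exists (j t); last exact: (vanish_quadratic Q K2 L2).
  by rewrite -rmorphXn t2 rmorphN rmorph1.
have E02 : 2%N \notin [pchar E0] by rewrite (fmorph_pchar k).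
have [[t t2]|nt] := EM (exists t : E, t ^+ 2 = -1).
  left; exists t => //.
  have [h hE] : exists h : {rmorphism E0 -> E},
      forall u v, h (k u + k v * i) = j u + j v * t.
    by apply: extend_morphism q _; rewrite rmorphN rmorph1.
  apply: (vanish_surj (h := h)) V => z.
  have [_ cE _] := Q; have [u [v zE]] := cE z; have [a [b tE]] := cE t.
  have b0 : b != 0.
    apply/eqP => b0; have /negP[] := quadratic_nonsquare a q; apply/eqP.
    apply: (fmorph_inj j); rewrite rmorphXn /= rmorphN rmorph1 -t2 tE b0.
    by rewrite rmorph0 mul0r addr0.
  exists (k (u - v * a / b) + k (v / b) * i).
  have jb0 : j b != 0 by rewrite fmorph_eq0.
  rewrite hE zE tE rmorphB !rmorphM !fmorphV /=; field.
  by [].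
right; have [x|L [i1 q1]] := @sqrt_extension E (-1).
  by apply/eqP => x2; apply: nt; exists x.
exists L, (in_alg L), i1; split=> //.
have [h hE] : exists h : {rmorphism E0 -> L},
    forall u v, h (k u + k v * i) = (in_alg L \o j) u + (in_alg L \o j) v * i1.
  by apply: extend_morphism q _; case: q1 => -> _ _; rewrite rmorphN rmorph1 rmorphN rmorph1.
have M2 : 2%N \notin [pchar L] by rewrite (fmorph_pchar h).
apply: (@vanish_quadratic _ _ h (k d) (in_alg L r) _ E02 M2) V.
have hk x : h (k x) = in_alg L (j x).
  by have := hE x 0; rewrite !rmorph0 !mul0r !addr0.
have [r2 cE inj] := Q; have [_ cL injL] := q1; have [_ cE0 _] := q.
split.
- by rewrite hk -r2 rmorphXn.
- move=> z; have [z0 [z1 ->]] := cL z.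
  have [a [b ->]] := cE z0; have [a' [b' ->]] := cE z1.
  exists (k a + k a' * i), (k b + k b' * i).
  by rewrite !hE !(rmorphD (in_alg L)) !(rmorphM (in_alg L)) /=; ring.
move=> x y; have [a [a' ->]] := cE0 x; have [b [b' ->]] := cE0 y.
rewrite !hE => h0; have [] := injL (j a + j b * r) (j a' + j b' * r).
  rewrite -[RHS]h0 !(rmorphD (in_alg L)) !(rmorphM (in_alg L)) /=; ring.
by move=> /inj[-> ->] /inj[-> ->]; rewrite !rmorph0 !mul0r !addr0.
Qed.

(** * Norms *)

Section Norm.
Variables (K : fieldType) (L : fieldExtType K).
Local Notation b := (vbasis {:L}).
Local Notation N := (\dim {:L}).
Implicit Types x y : L.

Definition mulmat x : 'M[K]_N := passmx.mxof b b (amull x).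

Lemma mulmatP x (i : 'I_N) : x * b`_i = \sum_k mulmat x i k *: b`_k.
Proof.
have bP := vbasisP {:L}.
have /= := passmx.hom_vecof b bP (amull x) (delta_mx 0 i).
rewrite passmx.vecof_delta lfunE /= => ->.
by rewrite /passmx.vecof -rowE; apply: eq_bigr => k _; rewrite mxE.
Qed.

Lemma mulmatM x y : mulmat (x * y) = mulmat x *m mulmat y.
Proof.
have bP := vbasisP {:L}.
by rewrite mulrC /mulmat -(passmx.mxof_comp b b bP) amullM.
Qed.

Lemma mulmat1 : mulmat 1 = 1%:M.
Proof. by rewrite /mulmat amull1 passmx.mxof1 // (basis_free (vbasisP _)). Qed.

Lemma mulmatB x y : mulmat (x - y) = mulmat x - mulmat y.
Proof.
apply/matrixP=> i k; rewrite !mxE /=.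
by rewrite !lfunE /= mulrBl linearB.
Qed.

Lemma ext_normM x y : ext_norm (x * y) = ext_norm x * ext_norm y.
Proof. by rewrite /ext_norm -!/(mulmat _) mulmatM det_mulmx. Qed.

Lemma ext_norm1 : ext_norm (1 : L) = 1.
Proof. by rewrite /ext_norm -!/(mulmat _) mulmat1 det1. Qed.

Lemma ext_norm_neq0 x : x != 0 -> ext_norm x != 0.
Proof.
move=> x0; apply/eqP => n0; have := ext_normM x x^-1.
by rewrite mulfV // ext_norm1 n0 mul0r => /eqP; rewrite oner_eq0.
Qed.

Lemma det_conj m n (C : 'M[K]_(m, n)) (D : 'M[K]_(n, m)) (M : 'M[K]_n) :
  C *m D = 1%:M -> D *m C = 1%:M -> \det (C *m M *m D) = \det M.
Proof.
move=> CD DC; have mn : m = n.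
  by apply/eqP; rewrite eqn_leq (mulmx1_min CD) (mulmx1_min DC).
subst n; rewrite !det_mulmx mulrAC -det_mulmx CD det1 mul1r //.
Qed.

Section Basis.
Variables (m : nat) (e : 'I_m -> L).
Hypothesis span_e : forall z, exists c : 'I_m -> K, z = \sum_i c i *: e i.
Hypothesis free_e : forall c : 'I_m -> K, \sum_i c i *: e i = 0 -> forall i, c i = 0.

Lemma sum_mulmx n1 n2 (X : 'M[K]_(n1, n2)) n3 (Y : 'M[K]_(n2, n3)) (f : 'I_n3 -> L) i :
  \sum_k X i k *: (\sum_l Y k l *: f l) = \sum_l (X *m Y) i l *: f l.
Proof.
transitivity (\sum_k \sum_l (X i k * Y k l) *: f l).
  by apply: eq_bigr => k _; rewrite scaler_sumr; apply: eq_bigr => l _; rewrite scalerA.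
by rewrite exchange_big; apply: eq_bigr => l _; rewrite mxE scaler_suml.
Qed.

Lemma coord_inj (c c' : 'I_m -> K) :
  \sum_i c i *: e i = \sum_i c' i *: e i -> c =1 c'.
Proof.
move=> h i; apply/eqP; rewrite -subr_eq0; apply/eqP.
apply: (free_e (c := fun i => c i - c' i)); rewrite -[RHS](subrr (\sum_i c' i *: e i)).
rewrite -[in X in _ = X - _]h -sumrB; apply: eq_bigr => k _.
by rewrite scalerBl.
Qed.

Lemma basis_change : exists (C : 'M[K]_(m, N)) (D : 'M[K]_(N, m)),
  [/\ C *m D = 1%:M, D *m C = 1%:M, forall i, e i = \sum_k C i k *: b`_k &
      forall k : 'I_N, b`_k = \sum_i D k i *: e i].
Proof.
have [d dE] := boolp.choice span_e.
pose C : 'M[K]_(m, N) := \matrix_(i, k) coord b k (e i).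
pose D : 'M[K]_(N, m) := \matrix_(k, i) d b`_k i.
have CE i : e i = \sum_k C i k *: b`_k.
  by rewrite [LHS](coord_vbasis (memvf _)); apply: eq_bigr => k _; rewrite mxE.
have DE (k : 'I_N) : b`_k = \sum_i D k i *: e i.
  by rewrite [LHS]dE; apply: eq_bigr => i _; rewrite mxE.
have freeb (c c' : 'I_N -> K) : \sum_i c i *: b`_i = \sum_i c' i *: b`_i -> c =1 c'.
  move=> h i; have fb := basis_free (vbasisP {:L}).
  by rewrite -(coord_sum_free c i fb) h coord_sum_free.
exists C, D; split=> //; apply/matrixP=> i.
  apply: coord_inj; rewrite -sum_mulmx.
  transitivity (e i); first by rewrite [RHS]CE; apply: eq_bigr => k _; rewrite -DE.
  rewrite (bigD1 i) //= mxE eqxx scale1r big1 ?addr0 // => k /negPf ki.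
  by rewrite mxE eq_sym ki scale0r.
apply: freeb; rewrite -sum_mulmx.
transitivity (b`_i); first by rewrite [RHS]DE; apply: eq_bigr => k _; rewrite -CE.
rewrite (bigD1 i) //= mxE eqxx scale1r big1 ?addr0 // => k /negPf ki.
by rewrite mxE eq_sym ki scale0r.
Qed.

Lemma dim_basis : N = m.
Proof.
have [C [D [CD DC _ _]]] := basis_change.
by apply/eqP; rewrite eqn_leq (mulmx1_min CD) (mulmx1_min DC).
Qed.

Lemma ext_norm_basis (A : 'M[K]_m) x :
  (forall i, x * e i = \sum_k A i k *: e k) -> ext_norm x = \det A.
Proof.
move=> AE; have [C [D [CD DC CE DE]]] := basis_change.
rewrite /ext_norm -/(mulmat x) -(det_conj (mulmat x) CD DC); congr (\det _).
apply/matrixP=> i; apply: coord_inj; apply: esym; rewrite -AE CE mulr_sumr.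
transitivity (\sum_k (C *m mulmat x) i k *: b`_k).
  by rewrite -sum_mulmx; apply: eq_bigr => k _; rewrite -scalerAr mulmatP.
by rewrite -[RHS]sum_mulmx; apply: eq_bigr => k _; rewrite -DE.
Qed.

End Basis.

End Norm.

Lemma det_block_comm (K : fieldType) n (U V W : 'M[K]_n) : U \in unitmx ->
  W *m U = U *m W -> \det (block_mx U V W U) = \det (U *m U - W *m V).
Proof.
move=> uU UW.
have -> : block_mx U V W U = block_mx 1%:M 0 (W *m invmx U) 1%:M
    *m block_mx U V 0 (U - W *m invmx U *m V).
  rewrite mulmx_block !(mul1mx, mul0mx, mulmx0, addr0, add0r) -mulmxA mulVmx //.
  by rewrite mulmx1 addrC subrK.
rewrite det_mulmx det_lblock !det1 !mul1r det_ublock -det_mulmx mulmxBr !mulmxA.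
by rewrite -UW -(mulmxA W) mulmxV // mulmx1.
Qed.

Section QuadraticNorm.
Variables (K : fieldType) (M L : fieldExtType K) (j : {rmorphism M -> L}).
Variables (d : M) (r : L).
Hypotheses (jZ : forall k x, j (k *: x) = k *: j x) (Q : quadratic j d r).
Local Notation b := (vbasis {:M}).
Local Notation N := (\dim {:M}).

Let rr : r * r = j d. Proof. by case: Q; rewrite expr2. Qed.

Let e (i : 'I_(N + N)) : L :=
  match split i with inl k => j b`_k | inr k => j b`_k * r end.

Let el k : e (lshift N k) = j b`_k.
Proof. by rewrite /e (unsplitK (inl k)). Qed.
Let er k : e (rshift N k) = j b`_k * r.
Proof. by rewrite /e (unsplitK (inr k)). Qed.

Let sum_e (c : 'I_(N + N) -> K) : \sum_i c i *: e i =
  j (\sum_k c (lshift N k) *: b`_k) + j (\sum_k c (rshift N k) *: b`_k) * r.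
Proof.
rewrite big_split_ord /= !rmorph_sum mulr_suml; congr (_ + _);
  by apply: eq_bigr => k _; rewrite ?el ?er jZ ?scalerAl.
Qed.

Let span_e z : exists c : 'I_(N + N) -> K, z = \sum_i c i *: e i.
Proof.
have [_ /(_ z)[u [v ->]] _] := Q.
exists (fun i => match split i with inl k => coord b k u | inr k => coord b k v end).
rewrite sum_e [u in LHS](coord_vbasis (memvf u)) [v in LHS](coord_vbasis (memvf v)).
by congr (j _ + j _ * r); apply: eq_bigr => k _;
  [rewrite (unsplitK (inl k)) | rewrite (unsplitK (inr k))].
Qed.

Let free_e (c : 'I_(N + N) -> K) : \sum_i c i *: e i = 0 -> forall i, c i = 0.
Proof.
have fb := freeP (basis_free (vbasisP {:M})).
rewrite sum_e; have [_ _ inj] := Q; move=> /inj[h1 h2] i.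
by rewrite -[i]splitK; case: (split i) => k; [apply: (fb _ h1) | apply: (fb _ h2)].
Qed.

Let mul_e u v : ext_norm (j u + j v * r) =
  \det (block_mx (mulmat u) (mulmat v) (mulmat (d * v)) (mulmat u)).
Proof.
apply: (ext_norm_basis span_e free_e) => i; rewrite sum_e.
rewrite -[i]splitK; case: (split i) => k /=.
  rewrite el mulrDl -mulrA [r * _]mulrC mulrA -!rmorphM /= !mulmatP.
  by congr (j _ + j _ * r); apply: eq_bigr => l _;
    rewrite ?block_mxEul ?block_mxEur.
rewrite er; have -> : (j u + j v * r) * (j b`_k * r) =
   j (d * v * b`_k) + j (u * b`_k) * r by rewrite !rmorphM /= -rr; ring.
rewrite !mulmatP.
by congr (j _ + j _ * r); apply: eq_bigr => l _;
    rewrite ?block_mxEdl ?block_mxEdr.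
Qed.

Lemma dim_quadratic : \dim {:L} = (2 * \dim {:M})%N.
Proof. by rewrite (dim_basis span_e free_e) mul2n addnn. Qed.

(** Transitivity of the norm in the step $L=M(r)$.  In a basis of the form $b_k$, $b_kr$
    multiplication by $u+vr$ has commuting blocks; evaluating the determinant requires the
    block of $u$ to be invertible, and the case $u=0$ is reached through the product with
    $1+r$, whose norm $1-d$ is nonzero. *)
Lemma ext_norm_quadratic u v : j u + j v * r != 0 ->
  ext_norm (j u + j v * r) = ext_norm (u ^+ 2 - d * v ^+ 2).
Proof.
have main u' v' : u' != 0 ->
    ext_norm (j u' + j v' * r) = ext_norm (u' ^+ 2 - d * v' ^+ 2).
  move=> u0; rewrite mul_e det_block_comm.
  - by rewrite /ext_norm -/(mulmat _) mulmatB -!mulmatM mulrA.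
  - have := ext_norm_neq0 u0; rewrite /ext_norm -/(mulmat _).
    by rewrite unitmxE unitfE.
  by rewrite -!mulmatM mulrC.
move=> z0; have [u0|] := eqVneq u 0; last exact: main.
subst u; have v0 : v != 0.
  by apply: contraNneq z0 => ->; rewrite !rmorph0 mul0r addr0.
have d0 : d != 0.
  by apply: contraTneq (quadratic_nonsquare 0 Q) => ->; rewrite expr0n eqxx.
have d1 : 1 - d != 0.
  rewrite subr_eq0 eq_sym; apply: contraTneq (quadratic_nonsquare 1 Q) => ->.
  by rewrite expr1n eqxx.
have := main 1 1 (oner_neq0 _); rewrite expr1n mulr1 => E1.
have := main (v * d) v (mulf_neq0 v0 d0).
have -> : j (v * d) + j v * r = (j 0 + j v * r) * (j 1 + j 1 * r).
  by rewrite rmorphM -rr rmorph0 rmorph1; ring.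
have -> : (v * d) ^+ 2 - d * v ^+ 2 = (0 ^+ 2 - d * v ^+ 2) * (1 - d) by ring.
rewrite !ext_normM E1 => /mulIf; apply; exact: ext_norm_neq0.
Qed.

End QuadraticNorm.

(** * Towers of quadratic extensions *)

Section Tower.
Variable K : fieldType.

Lemma aimg_is_aspace (M L : fieldExtType K) (f : 'AHom(M, L)) (E : {subfield M}) :
  is_aspace (f @: E).
Proof.
rewrite /is_aspace has_algid1; last by rewrite -(rmorph1 f) memv_img ?mem1v.
by rewrite -aimgM limgS // asubv.
Qed.
Definition aimg_subfield (M L : fieldExtType K) (f : 'AHom(M, L)) (E : {subfield M})
  : {subfield L} := ASpace (aimg_is_aspace f E).

(** The image of a tower of $M$ is continued by $L$ itself. *)
Lemma two_extension_quadratic (M L : fieldExtType K) (j : {rmorphism M -> L}) d r :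
  (forall k x, j (k *: x) = k *: j x) -> quadratic j d r ->
  two_extension M -> two_extension L.
Proof.
move=> jZ Q [s [ps ls]].
pose jZ' := GRing.isScalable.Build K M L *:%R j jZ.
pose jl : {lrmorphism M -> L} := HB.pack (j : M -> L) j jZ'.
pose f : 'AHom(M, L) := linfun_ahom jl.
have kf : lker f == 0%VS.
  by apply/lker0P => x y; rewrite !lfunE /=; apply: fmorph_inj.
have dimf (V : {vspace M}) : \dim (f @: V) = \dim V.
  by rewrite limg_dim_eq // (eqP kf) capv0.
have i1 : aimg_subfield f 1%AS = 1%AS by apply/val_inj; apply: aimg1.
exists (rcons (map (aimg_subfield f) s) {:L}%AS); rewrite last_rcons; split=> //.
rewrite rcons_path -i1 last_map ls; apply/andP; split.
  apply: homo_path ps => E F /andP[sEF dEF].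
  by rewrite /= limgS //= !dimf.
rewrite subvf /= dimf (dim_quadratic jZ Q) mulnK //.
by rewrite adim_gt0.
Qed.

(** The generator comes from any element of $F\setminus E$ by completing the square. *)
Lemma quadratic_subfield (L : fieldExtType K) (E F : {subfield L}) :
  2%N \notin [pchar K] -> (E <= F)%VS -> \dim_E F = 2 ->
  exists r, [/\ r \in F, r \notin E, r ^+ 2 \in E &
    forall z, z \in F -> exists u v, [/\ u \in E, v \in E & z = u + v * r]].
Proof.
move=> K2 sEF dEF.
have L2 : 2 != 0 :> L by apply: two_neq0; rewrite pchar_lalg.
have dF : \dim F = (2 * \dim E)%N by rewrite (dim_sup_field sEF) dEF.
have [x xF xE] : exists2 x, x \in F & x \notin E.
  apply/subvPn; apply/negP => sFE; have := dimvS sFE.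
  by rewrite dF leqNgt ltn_Pmull // adim_gt0.
have x0 : x != 0 by apply: contraNneq xE => ->; rewrite mem0v.
have VE : (E + E * <[x]>)%VS = F.
  apply/eqP; rewrite eqEdim; apply/andP; split.
    rewrite subv_add sEF /=; apply: subv_trans (asubv F).
    by apply: prodvS => //; rewrite -memvE.
  rewrite dimv_disjoint_sum ?dim_cosetv // ?addnn ?mul2n ?dF ?mul2n //.
  apply/eqP; rewrite -subv0; apply/subvP=> z; rewrite memv_cap => /andP[zE].
  case/memv_cosetP=> v vE zv; rewrite memv0 zv.
  have [->|v0] := eqVneq v 0; first by rewrite mul0r.
  case/negP: xE; rewrite -(mulKf v0 x) -zv rpredM // rpredV //.
have cF z : z \in F -> exists u v, [/\ u \in E, v \in E & z = u + v * x].
  rewrite -VE => /memv_addP[u uE [_ /memv_cosetP[v vE ->] ->]].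
  by exists u, v.
have [al [be [aE bE x2]]] := cF _ (rpredX 2 xF).
have n2 : 2 \in E by rewrite rpred_nat.
exists (x - be / 2); split.
- by rewrite rpredB // rpred_div // (subvP sEF).
- by apply: contra xE => h; rewrite -[x](subrK (be / 2)) rpredD // rpred_div.
- have -> : (x - be / 2) ^+ 2 = al + (be / 2) ^+ 2.
    transitivity (x ^+ 2 - be * x + (be / 2) ^+ 2); first by field.
    by rewrite x2; ring.
  by rewrite rpredD // rpredX // rpred_div.
move=> z /cF[u [v [uE vE ->]]]; exists (u + v * (be / 2)), v; split=> //.
  by rewrite rpredD // rpredM // rpred_div.
by ring.
Qed.

End Tower.

Lemma wres_comp (F E M : fieldType) (j : {rmorphism F -> E}) (h : {rmorphism E -> M})
    (g : {rmorphism F -> M}) K2 L2 M2 (x : witt K2) :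
  (forall a, g a = h (j a)) -> wres g M2 x = wres h M2 (wres j L2 x).
Proof.
move=> gE; elim/witt_classW: x => phi; rewrite !wres_class.
apply: isometric_class => /=; rewrite -map_mx_comp.
have -> : map_mx g phi = map_mx (h \o j) phi by apply/eq_map_mx.
exact: isom_refl.
Qed.

Lemma wres_surj_inj (F E : fieldType) (j : {rmorphism F -> E}) K2 L2 (x y : witt K2) :
  (forall z, exists a, z = j a) -> wres j L2 x = wres j L2 y -> x = y.
Proof.
move=> surj; have [g gK] := boolp.choice surj.
elim/witt_classW: x => phi; elim/witt_classW: y => psi.
rewrite !wres_class => /witt_classP[k [l]].
rewrite /= -!(map_hyp j) -!map_dsum => -[P [Q [PQ QP PE]]].
have mK m n (X : 'M[E]_(m, n)) : X = map_mx j (map_mx g X).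
  by apply/matrixP=> i i'; rewrite !mxE -gK.
apply/witt_classP; exists k, l, (map_mx g P), (map_mx g Q).
by split; apply: (map_mx_inj (f := j)); rewrite ?map_mx1 !map_mxM ?map_trmx -!mK.
Qed.

Lemma lift_subvs (K : fieldType) (A L : fieldExtType K) (F : {subfield L})
    (g : {rmorphism A -> L}) : (forall y, g y \in F) ->
  exists j : {rmorphism A -> subvs_of F}, forall y, vsval (j y) = g y.
Proof.
move=> gF; pose f y : subvs_of F := Subvs (gF y).
have fE y : vsval (f y) = g y by [].
have fB : {morph f : y z / y - z}.
  by move=> y z; apply: val_inj; rewrite -![val _]/(vsval _) raddfB !fE rmorphB.
have fM : monoid_morphism f.
  split=> [|y z]; apply: val_inj; rewrite -![val _]/(vsval _).
    by rewrite fE !rmorph1.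
  by rewrite rmorphM !fE rmorphM.
pose fB' := GRing.isZmodMorphism.Build _ _ f fB.
pose fM' := GRing.isMonoidMorphism.Build _ _ f fM.
by exists (HB.pack f fB' fM' : {rmorphism A -> subvs_of F}).
Qed.

Section NormToSimilarity.
Variables (K : fieldType) (K2 : 2%N \notin [pchar K]) (phi : qform K).

(** This is what can be inherited along a tower: hyperbolicity of $\varphi_M$ is lost
    on the way down to $K$, whereas a similarity factor of $\varphi_M$ is mapped to one by the
    norm. *)
Definition norms_are_similarities (M : fieldExtType K) : Prop :=
  forall (M2 : 2%N \notin [pchar M]) (x : M), x != 0 ->
    wline M2 x * wres (in_alg M) M2 (witt_class K2 phi)
      = wres (in_alg M) M2 (witt_class K2 phi) ->
    wline K2 (ext_norm x) * witt_class K2 phi = witt_class K2 phi.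

Lemma ext_norm_dim1 (M : fieldExtType K) (k : K) :
  (forall z : M, exists c, z = c%:A) -> ext_norm (k%:A : M) = k.
Proof.
move=> surj; rewrite -[RHS]det_scalar1.
apply: (ext_norm_basis (e := fun _ : 'I_1 => 1)).
- by move=> z; have [c ->] := surj z; exists (fun=> c); rewrite big_ord1.
- move=> c; rewrite big_ord1 => /eqP; rewrite scaler_eq0 oner_eq0 orbF => /eqP c0 i.
  by rewrite (ord1 i).
by move=> i; rewrite big_ord1 (ord1 i) mulr1 mxE eqxx mulr1n.
Qed.

Lemma norms_dim1 (M : fieldExtType K) :
  (forall z : M, exists c, z = c%:A) -> norms_are_similarities M.
Proof.
move=> surj M2 x x0; have [c xE] := surj x; subst x.
have c0 : c != 0 by apply: contraNneq x0 => ->; rewrite scale0r.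
rewrite ext_norm_dim1 // -[_%:A]/(in_alg M c) -(wres_wline (in_alg M) K2) // -wresM.
exact: (wres_surj_inj (j := in_alg M)).
Qed.

Lemma norms_quadratic (M L : fieldExtType K) (j : {rmorphism M -> L}) d r :
  (forall k x, j (k *: x) = k *: j x) -> quadratic j d r ->
  norms_are_similarities M -> norms_are_similarities L.
Proof.
move=> jZ Q NM L2 x x0 xE; have [_ cE _] := Q.
have M2 : 2%N \notin [pchar M] by rewrite pchar_lalg.
have [u [v xuv]] := cE x; subst x; rewrite (ext_norm_quadratic jZ Q) //.
apply: (NM M2); first exact: (quadratic_norm_neq0 Q).
have jA k : in_alg L k = j (in_alg M k) by rewrite /= jZ rmorph1.
move: xE; rewrite (wres_comp M2 L2 _ jA).
elim/witt_classW: (wres (in_alg M) M2 _) => psi; rewrite wres_class.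
exact: (norm_principle Q M2).
Qed.

(** Hyperbolicity of $\varphi_L$ makes every $x$ a similarity factor over $L$, and
    [norms_are_similarities] climbs the subfields of the tower, starting from $K$. *)
Lemma norm_similarity (L : fieldExtType K) (x : L) (L2 : 2%N \notin [pchar L]) :
  two_extension L -> x != 0 -> wres (in_alg L) L2 (witt_class K2 phi) = 0 ->
  wline K2 (ext_norm x) * witt_class K2 phi = witt_class K2 phi.
Proof.
move=> [s [ps ls]] x0 h0.
have base : norms_are_similarities (subvs_of (1%AS : {subfield L})).
  apply: norms_dim1 => z; have /vlineP[c zE] := subvsP z.
  exists c; apply: val_inj; apply: etrans zE _.
  by rewrite -[RHS]/(vsval _) linearZ rmorph1.
have valZ (G : {subfield L}) k (y : subvs_of G) : vsval (k *: y) = k *: vsval y.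
  exact: linearZ.
have step (E F : {subfield L}) : (E <= F)%VS && (\dim_E F == 2)%N ->
    norms_are_similarities (subvs_of E) -> norms_are_similarities (subvs_of F).
  case/andP=> sEF /eqP dEF.
  have [r [rF rE r2 cF]] := quadratic_subfield K2 sEF dEF.
  have inF (y : subvs_of E) : vsval y \in F by apply: (subvP sEF); apply: subvsP.
  have [j jE] := lift_subvs inF.
  apply: (@norms_quadratic _ _ j (Subvs r2) (Subvs rF)).
    by move=> k y; apply: val_inj; apply: etrans (jE _) _; rewrite [RHS]valZ [in RHS]jE; apply: valZ.
  have valD (u v : subvs_of E) :
      vsval (j u + j v * Subvs rF) = vsval u + vsval v * r.
    by rewrite rmorphD rmorphM /= !jE.
  split.
  - by apply: val_inj; rewrite -![val _]/(vsval _) rmorphXn jE.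
  - move=> z; have [u [v [uE vE zE]]] := cF _ (subvsP z).
    by exists (Subvs uE), (Subvs vE); apply: val_inj; rewrite -![val _]/(vsval _) valD.
  move=> u v /(congr1 vsval); rewrite valD rmorph0 => h.
  have [v0|v0] := eqVneq v 0.
    by split=> //; apply: val_inj; move: h; rewrite v0 rmorph0 mul0r addr0.
  case/negP: rE; have v0' : vsval v != 0 by rewrite fmorph_eq0.
  have -> : r = - (vsval u / vsval v).
    apply: (mulfI v0'); rewrite mulrN [vsval v * (_ / _)]mulrC divfK //.
    by apply/eqP; rewrite -addr_eq0 addrC h.
  by rewrite rpredN rpred_div ?subvsP.
have all_path E : path (fun E F : {subfield L} => (E <= F)%VS && (\dim_E F == 2)%N) E s ->
    norms_are_similarities (subvs_of E) ->
    norms_are_similarities (subvs_of (last E s)).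
  by elim: s {ps ls} E => //= F s IH E /andP[EF /IH{}IH] /(step _ _ EF).
have := all_path _ ps base; rewrite ls => NL.
have inL (y : L) : y \in {:L}%AS by apply: memvf.
have [j jE] := @lift_subvs _ L L {:L}%AS idfun inL.
have S2 : 2%N \notin [pchar subvs_of {:L}%AS] by rewrite (fmorph_pchar j).
have jZ k y : j (k *: y) = k *: j y.
  by apply: val_inj; apply: etrans (jE _) _; rewrite [RHS]valZ [in RHS]jE.
have jA k : in_alg (subvs_of {:L}%AS) k = j (in_alg L k) by rewrite /= jZ rmorph1.
have -> : ext_norm x = ext_norm (j x).
  apply: esym; apply: (ext_norm_basis (e := fun i : 'I_(\dim {:L}) => j (vbasis {:L})`_i)).
  - move=> z; exists (fun i => coord (vbasis {:L}) i (vsval z)).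
    apply: val_inj; rewrite -![val _]/(vsval _) [LHS](coord_vbasis (memvf _)).
    by rewrite raddf_sum; apply: eq_bigr => i _; rewrite -[RHS]/(vsval _) valZ jE.
  - move=> c; under eq_bigr do rewrite -jZ.
    rewrite -rmorph_sum => /(congr1 vsval); rewrite jE rmorph0.
    exact: (freeP (basis_free (vbasisP {:L}))).
  move=> i; rewrite -rmorphM /= mulmatP rmorph_sum.
  by apply: eq_bigr => k _; rewrite jZ.
apply: (NL S2); first by rewrite fmorph_eq0.
by rewrite (wres_comp L2 S2 _ jA) h0 wres0 mulr0.
Qed.

End NormToSimilarity.

(** * Splitting a form along a tower with prescribed norm *)

Lemma class_eq_odd (F : fieldType) (K2 : 2%N \notin [pchar F]) (f g : qform F) :
  witt_class K2 f = witt_class K2 g -> odd (qdim f) = odd (qdim g).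
Proof.
move/witt_classP=> [k [l /isometric_dim h]].
by have := congr1 odd h; rewrite !oddD !addbb !addbF.
Qed.

Lemma inI_even (F : fieldType) (K2 : 2%N \notin [pchar F]) m (f : qform F) :
  (0 < m)%N -> inI m (witt_class K2 f) -> ~~ odd (qdim f).
Proof.
move=> m0; move: {2}(witt_class K2 f) (erefl (witt_class K2 f)) => x xE; rewrite xE => ix.
move: f xE; move: x ix; apply: inI_ind.
- by move=> f /(class_eq_odd (g := qzero F))->.
- elim/witt_classW=> g; elim/witt_classW=> h Pg Ph f.
  rewrite -class_sum => /class_eq_odd->; rewrite oddD negb_add.
  by rewrite (negPf (Pg g erefl)) (negPf (Ph h erefl)).
- elim/witt_classW=> g Pg f fE; rewrite (@class_eq_odd _ K2 f (qopp g)); first exact: (Pg g).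
  by rewrite fE -witt_opp_classE.
move=> s sm ns f; rewrite -class_pfq // => /class_eq_odd->.
by rewrite qdim_pfq oddX orbF -lt0n (leq_trans m0 sm).
Qed.

(** Two vectors of an anisotropic form $\psi$ with $y\psi\simeq\psi$ whose values are
    $p$ and $yp$ span a binary form $p\langle 1,-d\rangle$ with $y\in\mathsf N(F(\sqrt d)^\times)$;
    if $yp$ is $p$ times a square, any binary form $\langle p,q\rangle$ does. *)
Lemma split_binary (F : fieldType) (K2 : 2%N \notin [pchar F]) (psi : qform F) y :
  ~ isotropic psi -> ~~ odd (qdim psi) -> (0 < qdim psi)%N -> y != 0 ->
  wline K2 y * witt_class K2 psi = witt_class K2 psi ->
  exists p d psi' u v, [/\ p != 0, d != 0, (forall x, x ^+ 2 != d) &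
    witt_class K2 psi = wline K2 p + wline K2 (- (d * p)) + witt_class K2 psi' /\
    qdim psi = (qdim psi').+2 /\ y = u ^+ 2 - d * v ^+ 2].
Proof.
move=> ani even dim0 y0 yE; have [p p0 rp] := qform_represents K2 dim0.
have [psi1 [E1 d1]] := class_split K2 p0 rp.
have d10 : (0 < qdim psi1)%N by move: even; rewrite d1; case: (qdim psi1).
have iso : isometric psi (qsum (qline p) psi1).
  by apply: (@witt_class_eq_isometric _ K2); rewrite ?class_sum // d1.
have : represents (qsum (qline p) psi1) (y * p).
  apply: represents_isometric iso _; apply: (represents_class (K2 := K2) (phi := qscale y psi)).
  - by rewrite class_scale.
  - by [].
  by apply/represents_scale; exists p; rewrite ?nzE.
case/represents_dsum=> _ [s [/(represents_qline _ p0)[x ->] rs ypE]].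
have [q [v [q0 rq yE']]] : exists q v,
    [/\ q != 0, represents psi1 q & y = x ^+ 2 - (- (q / p)) * v ^+ 2].
  have [s0|s0] := eqVneq s 0.
    have [q q0 rq] := qform_represents K2 d10; exists q, 0; split=> //.
    apply: (mulIf p0); rewrite ypE s0; ring.
  exists s, 1; split=> //; apply: (mulIf p0); rewrite ypE; field.
  by [].
have [psi2 [E2 d2]] := class_split K2 q0 rq.
have d0 : - (q / p) != 0 by rewrite oppr_eq0 mulf_neq0 ?invr_eq0.
exists p, (- (q / p)), psi2, x, v; split=> //.
  move=> e; apply/eqP => eE; apply: ani; apply: isotropic_isometric (isom_sym iso) _.
  case: rq => w wq; exists (row_mx e%:M w).
    apply/eqP; rewrite -row_mx0 => /eq_row_mx[/(congr1 (fun M : 'M_1 => M 0 0))].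
    rewrite !mxE eqxx mulr1n => e0; case/eqP: d0.
    by rewrite -eE e0 expr0n.
  by rewrite qval_dsum wq qval1 nzE // eE; field.
split; last by rewrite d1 d2.
have -> : - (- (q / p) * p) = q by field.
by rewrite E1 E2 addrA.
Qed.

Section Forward.
Variables (K : fieldType) (K2 : 2%N \notin [pchar K]) (phi : qform K) (a : K) (n : nat).
Hypothesis n0 : (0 < n)%N.

Lemma quadratic_step (M : fieldExtType K) d : (forall x : M, x ^+ 2 != d) ->
  exists (L : fieldExtType K) (j : {rmorphism M -> L}) (r : L),
    (forall k x, j (k *: x) = k *: j x) /\ quadratic j d r.
Proof.
move=> nd; have [L0 [r Q]] := sqrt_extension nd.
pose L : fieldExtType K := baseFieldType L0.
exists L, (in_alg L0 : {rmorphism M -> L0}), r; split=> //.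
move=> k x; rewrite [RHS]baseField_scaleE.
by rewrite -[LHS]/((k *: x) *: (1 : L0)) -[RHS]/(k%:A *: (x *: (1 : L0))) scalerA mulr_algl.
Qed.

(** As $2\psi=0$, the element $y$ is a similarity factor of $\psi$, and a binary subform
    $p\langle 1,-d\rangle$ with $y=\mathsf N(u+v\sqrt d)$ splits off.  Over $M(\sqrt d)$
    that subform is hyperbolic and $u+v\sqrt d$ takes the place of $y$. *)
Lemma split_tower (k : nat) (M : fieldExtType K) (M2 : 2%N \notin [pchar M]) (y : M)
    (psi : qform M) :
  two_extension M -> y != 0 -> ext_norm y = a -> good n M ->
  inI n (witt_class M2 psi) -> 2 * witt_class M2 psi = 0 ->
  wres (in_alg M) M2 (witt_class K2 phi) = witt_class M2 psi -> (qdim psi <= k)%N ->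
  exists (L : fieldExtType K) (L2 : 2%N \notin [pchar L]) (x : L),
    [/\ two_extension L, x != 0, a = ext_norm x &
    wres (in_alg L) L2 (witt_class K2 phi) = 0].
Proof.
elim/ltn_ind: k M M2 y psi => k IH M M2 y psi tM y0 yE G iI t2 pE dk.
have [chi [cE ani cd]] := anisotropic_part M2 psi.
rewrite -cE in iI t2 pE.
have even := inI_even n0 iI.
have [c0|c0] := posnP (qdim chi).
  exists M, M2, y; split=> //; rewrite pE; apply/witt_class_zeroP; exists 0.
  by case: (chi) c0 => m A sA uA /= m0; subst m; exists 1%:M, 1%:M;
    split; apply/matrixP=> -[].
have [p [d [psi' [u [v [p0 d0 nd [cE' [dE yuv]]]]]]]] :=
  split_binary ani even c0 y0 (torsion_similarity n0 G iI t2 y0).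
have [L [j [r [jZ Q]]]] := quadratic_step nd.
have L2 : 2%N \notin [pchar L] by rewrite pchar_lalg.
have jA c : in_alg L c = j (in_alg M c) by rewrite /= jZ rmorph1.
have y'0 : j u + j v * r != 0.
  apply/eqP => h; have [_ _ inj] := Q; have [u0 v0] := inj _ _ h.
  by move: y0; rewrite yuv u0 v0 !expr0n mulr0 subrr eqxx.
have LE : wres (in_alg L) L2 (witt_class K2 phi) = witt_class L2 (qmap j psi').
  rewrite (wres_comp M2 L2 _ jA) pE cE' !wresD wres_class !wres_wline ?oppr_eq0 ?mulf_neq0 //.
  have [r2 _ _] := Q; rewrite rmorphN rmorphM /= -r2.
  have r0 : r != 0 by apply: contraNneq d0 => r0; rewrite -(fmorph_eq0 j) -r2 r0 expr0n.
  have jp0 : j p != 0 by rewrite fmorph_eq0.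
  by rewrite wlineN ?mulf_neq0 ?expf_neq0 // mulrC wlineMsqr // subrr add0r.
apply: (IH (qdim psi') _ L L2 (j u + j v * r) (qmap j psi')) => //.
- by rewrite dE in cd; apply: leq_trans dk; apply: leq_trans cd.
- exact: (two_extension_quadratic jZ Q).
- by rewrite (ext_norm_quadratic jZ Q) // -yuv.
- exact: (good_quadratic M2 Q).
- by rewrite -LE (wres_comp M2 L2 _ jA) pE; apply: inI_res.
- by rewrite -LE (wres_comp M2 L2 _ jA) pE mulr2n mulrDl mul1r -wresD -mulr2n -mulr_natl t2 wres0.
Qed.

End Forward.

(** * The theorem *)

Lemma fund_power_pf (F : fieldType) (K2 : 2%N \notin [pchar F]) m (s : seq F) :
  size s = m -> nzs s -> fund_power m (pf K2 s).
Proof.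
move=> sm ns; subst m.
exists 1%N, (fun=> 1), (fun=> fun k : 'I_(size s) => wpf K2 s`_k); split; last first.
  by rewrite big_ord1 mul1r /pf (big_nth 0) big_mkord.
move=> _ k; exists (pfq [:: s`_k]) => //.
have n1 : nzs [:: s`_k] by rewrite /= (allP ns) ?mem_nth.
by rewrite class_pfq // pf_cons pf_nil mulr1.
Qed.

(** Every element of $K(i)$ is of the form $u+vi$, with unique $u,v\in K$ unless $-1$ is a
    square in $K$; in that case $K(i)=K$. *)
Lemma good_of_adjoin (K : fieldType) (K2 : 2%N \notin [pchar K])
    (Ki : fieldExtType K) (i : Ki) n :
  i ^+ 2 = -1 -> <<1; i>>%VS = {:Ki}%VS -> vanish n.+1 Ki -> good n K.
Proof.
move=> i2 gen V; have cE z : exists u v, z = in_alg Ki u + in_alg Ki v * i.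
  have : z \in <<1; i>>%VS by rewrite gen memvf.
  case/Fadjoin_polyP=> p /polyOver1P[q ->] ->.
  elim/poly_ind: q => [|q c [u [v qE]]].
    by exists 0, 0; rewrite !rmorph0 horner0 mul0r addr0.
  exists (c - v), u; rewrite rmorphD rmorphM /= map_polyX map_polyC !hornerE qE.
  rewrite /= scalerBl.
  transitivity (u%:A * i + v%:A * i ^+ 2 + c%:A); first by rewrite /=; ring.
  by rewrite i2; ring.
have [[t t2]|nt] := EM (exists t : K, t ^+ 2 = -1); last first.
  right; exists Ki, (in_alg Ki), i; split=> //; split=> //.
    by rewrite i2 rmorphN rmorph1.
  move=> u v h; have [v0|v0] := eqVneq v 0.
    split=> //; apply: (fmorph_inj (in_alg Ki)); rewrite rmorph0 -h v0 rmorph0.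
    by rewrite mul0r addr0.
  case: nt; exists (- (u / v)); apply: (fmorph_inj (in_alg Ki)).
  have jv0 : in_alg Ki v != 0 by rewrite fmorph_eq0.
  have iE : i = in_alg Ki (- (u / v)).
    apply: (mulfI jv0); rewrite rmorphN rmorphM fmorphV mulrN mulrC.
    rewrite [_ * (_ / _)]mulrC divfK //; apply/eqP.
    by rewrite -addr_eq0 addrC [i * _]mulrC; apply/eqP.
  have e2 : in_alg Ki (- (u / v)) ^+ 2 = -1 by rewrite -iE.
  by rewrite rmorphXn; apply: etrans e2 _; rewrite rmorphN rmorph1.
left; exists t => //.
have it : exists e, i = in_alg Ki e.
  have : (i - in_alg Ki t) * (i + in_alg Ki t) = 0.
    transitivity (i ^+ 2 - in_alg Ki (t ^+ 2)); first by rewrite rmorphXn /=; ring.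
    by rewrite i2 t2 rmorphN rmorph1 opprK addNr.
  move/eqP; rewrite mulf_eq0 => /orP[]; rewrite ?subr_eq0 ?addr_eq0 => /eqP->.
    by exists t.
  by exists (- t); rewrite rmorphN.
have [e ie] := it; have surj z : exists c, z = in_alg Ki c.
  have [u [v ->]] := cE z; exists (u + v * e).
  by rewrite ie rmorphD rmorphM.
have Ki2 : 2%N \notin [pchar Ki] by rewrite pchar_lalg.
move=> K2' s sm ns; apply: (wres_surj_inj (j := in_alg Ki) (L2 := Ki2)) => //.
by rewrite wres0 wres_pf // V ?size_map ?nzs_map.
Qed.

Section Regular.
Variable K : fieldType.

Lemma two_extension_regular : two_extension K^o.
Proof. by exists [::]; split=> //=; apply: val_inj; rewrite /= regular_fullv. Qed.

Lemma ext_norm_regular (y : K^o) : ext_norm y = y.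
Proof.
have yE : y = (y : K)%:A :> K^o by rewrite /GRing.scale /= mulr1.
rewrite [in LHS]yE ext_norm_dim1 // => z; exists z.
by rewrite /GRing.scale /= mulr1.
Qed.

(** The base field occurs in two guises, $K$ and the trivial extension $K^o$; the property is
    transported along the identity. *)
Lemma good_regular n : good n K -> good n K^o.
Proof.
have inR k : in_alg K^o k = k by rewrite /= /GRing.scale /= mulr1.
have surj (z : K^o) : exists k, z = in_alg K^o k by exists z; rewrite inR.
case=> [[t t2 V]|[E [j [i [q V]]]]].
  by left; exists (in_alg K^o t); [rewrite -rmorphXn t2 rmorphN rmorph1 | apply: vanish_surj surj V].
pose h (x : K^o) : K := x.
have hB : {morph h : x y / x - y} by [].
have hM : monoid_morphism h by [].
pose hB' := GRing.isZmodMorphism.Build _ _ h hB.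
pose hM' := GRing.isMonoidMorphism.Build _ _ h hM.
pose h' : {rmorphism K^o -> K} := HB.pack h hB' hM'.
by right; exists E, (j \o h'), i.
Qed.

End Regular.

Theorem theorem3 (n : nat) (K : fieldType) (K2 : 2%N \notin [pchar K])
    (Ki : fieldExtType K) (i : Ki) (phi : qform K) (a : K) :
    (1 <= n)%N ->
    i ^+ 2 = -1 -> <<1; i>>%VS = {:Ki}%VS ->
    (forall x : witt (pchar2_ext Ki K2), fund_power n.+1 x -> x = 0) ->
    fund_power n (witt_class K2 phi) ->
    a != 0 ->
  isometric (a *: (phi : 'M_(qdim phi))) phi <->
  exists L : fieldExtType K,
    [/\ two_extension L,
        exists2 x : L, x != 0 & a = ext_norm x
      & hyperbolic (qext L phi)].
Proof.
move=> n0 i2 gen I0 phiI a0.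
have wE : isometric (a *: (phi : 'M_(qdim phi))) phi <->
    wline K2 a * witt_class K2 phi = witt_class K2 phi.
  rewrite -class_scale; split=> [h|h].
    by apply: isometric_class; rewrite /= nzE.
  by have := witt_class_eq_isometric h erefl; rewrite /= nzE.
have hypE (L : fieldExtType K) (L2 : 2%N \notin [pchar L]) :
    hyperbolic (qext L phi) <-> wres (in_alg L) L2 (witt_class K2 phi) = 0.
  rewrite wres_class -(witt_class_zeroP L2).
  by have -> : witt_class L2 (qext L phi) = witt_class L2 (qmap (in_alg L) phi)
    by apply: isometric_class; apply: isom_refl.
rewrite wE; split; last first.
  case=> L [tL [x x0 ->] hL].
  have L2 := pchar2_ext L K2.
  by apply: (@norm_similarity _ K2 phi L x L2) => //; apply/hypE.
move=> aphi.
have V : vanish n.+1 Ki.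
  move=> Ki2 s sm ns; rewrite (bool_irrelevance Ki2 (pchar2_ext Ki K2)).
  exact/I0/fund_power_pf.
have G : good n K := good_of_adjoin K2 i2 gen V.
have iI := inI_fund_power phiI.
(* It suffices to reach an extension from which $a$ is a norm and over which
   $2\varphi=0$: the rest of $\varphi$ can be split afterwards. *)
have final (M : fieldExtType K) (M2 : 2%N \notin [pchar M]) (y : M) :
    two_extension M -> y != 0 -> ext_norm y = a -> good n M ->
    2 * wres (in_alg M) M2 (witt_class K2 phi) = 0 ->
    exists L : fieldExtType K, [/\ two_extension L,
      exists2 x : L, x != 0 & a = ext_norm x & hyperbolic (qext L phi)].
  move=> tM y0 yE GM t2.
  have [||||L [L2 [x [tL x0 xE /hypE hL]]]] :=
      @split_tower K K2 phi a n n0 (qdim phi) M M2 y (qmap (in_alg M) phi) tM y0 yE GM.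
  - by rewrite -(wres_class _ K2); apply: inI_res.
  - by rewrite -(wres_class _ K2).
  - exact: wres_class.
  - exact: leqnn.
  by exists L; split=> //; exists x.
have R2 : 2%N \notin [pchar K^o] by [].
have inR k : in_alg K^o k = k by rewrite /= /GRing.scale /= mulr1.
(* If $-a$ is a square, then $\langle a\rangle=-1$ and $2\varphi=0$ over $K$ itself, where
   $a$ is its own norm; otherwise both are achieved over $K(\sqrt{-a})$ by
   $a=\mathsf N(\sqrt{-a})$. *)
have [[c cE]|nsq] := EM (exists c : K, c ^+ 2 = - a).
  have c0 : c != 0 by apply: contraNneq a0 => c0; rewrite -oppr_eq0 -cE c0 expr0n.
  have aE : wline K2 a = -1.
    by rewrite -[a]opprK -cE wlineN ?expf_neq0 // wline_sqr.
  have t2 : 2 * witt_class K2 phi = 0.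
    move: aphi; rewrite aE mulN1r => h.
    by rewrite mulr_natl mulr2n -[X in X + _]h addNr.
  have T2 : 2 * wres (in_alg K^o) R2 (witt_class K2 phi) = 0.
    by rewrite mulr_natl mulr2n -wresD -mulr2n -mulr_natl t2 wres0.
  exact: (final K^o R2 a (two_extension_regular K) a0 (ext_norm_regular a)
    (good_regular G) T2).
have [|L [j [r [jZ Q]]]] := @quadratic_step K K^o (- a).
  by move=> x; apply/eqP => xE; apply: nsq; exists x.
have L2 := pchar2_ext L K2.
have [r2 _ inj] := Q.
have r0 : r != 0.
  apply/eqP => r0; have := inj 0 1; rewrite rmorph0 rmorph1 mul1r r0 addr0 => /(_ erefl)[_ /eqP].
  by rewrite oner_eq0.
apply: (final L L2 r) => //.
- exact: (two_extension_quadratic jZ Q (two_extension_regular K)).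
- have rE : r = j 0 + j 1 * r by rewrite rmorph0 rmorph1 mul1r add0r.
  rewrite [in LHS]rE (ext_norm_quadratic jZ Q) -?rE // ext_norm_regular.
  by rewrite expr0n expr1n mulr1 sub0r opprK.
- exact: (good_quadratic R2 Q (good_regular G)).
have aE : in_alg L a = - r ^+ 2.
  by rewrite r2 rmorphN opprK -[in RHS](inR a) /= jZ rmorph1.
have wa : wline L2 (in_alg L a) = -1.
  by rewrite aE wlineN ?expf_neq0 // wline_sqr.
have := congr1 (wres (in_alg L) L2) aphi.
rewrite wresM wres_wline // [wline _ _]wa mulN1r => h.
by rewrite mulr_natl mulr2n -[X in X + _]h addNr.
Qed.
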